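(* Let $X$ be a minimal surface of general type over $\mathbb{C}$ with canonical map $\varphi_{K_X}$ and canonical degree $d=\deg\varphi_{K_X}$. If $\varphi=\varphi_{K_X}: X\to\mathbb{P}^2$ is an abelian cover, then $d$ is equal to $2,3,4,6,8,9$, or $16$. In particular, if the canonical degree of $X$ is $36$, then $\varphi_{K_X}$ cannot be an abelian cover.
   Context: The canonical map $\varphi_{K_X}: X\dashrightarrow\mathbb{P}^{p_g-1}$ is the rational map given by the complete linear system $|K_X|$, where $p_g=h^0(X,K_X)$; when it is generically finite onto its image, its degree $d$ is called the canonical degree of $X$. An abelian cover $\varphi:X\to Y$ is a finite cover with $X$ normal such that the function field $\mathbb{C}(X)$ is a Galois extension of $\mathbb{C}(Y)$ with finite abelian Galois group. *)

(* Defs.v *)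
(* Complex projective surfaces in the language of classical varieties: closed *)
(* subsets of projective space, their function fields, and the local rings    *)
(* of the latter at closed points.  MathComp, with multinomials and R[i].     *)
From mathcomp Require Import all_boot all_order all_algebra all_fingroup.
From mathcomp Require Import all_field.
From mathcomp Require Import complex mpoly reals.

Set Implicit Arguments.
Unset Strict Implicit.
Unset Printing Implicit Defensive.

Import GRing.Theory.
Local Open Scope ring_scope.

Section ProjectiveSets.
Variable k : closedFieldType.

(* Homogeneous coordinate vectors; two proportional vectors are the same      *)
(* point of the projective space.                                             *)
Definition proj_zeros (N : nat) (eqs : {mpoly k[N.+1]} -> Prop)
    (p : 'I_N.+1 -> k) : Prop :=
  (exists i, p i != 0) /\ forall F, eqs F -> F.@[p] = 0.

(* For y = [y_0 : ... : y_n] with entries in K, the subfield k(y_i / y_j):    *)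
(* quotients of two forms of the same degree evaluated at y.                  *)
Definition homfrac (K : fieldType) (cst : {rmorphism k -> K}) (n : nat)
    (y : 'I_n.+1 -> K) (f : K) : Prop :=
  exists (d : nat) (F G : {mpoly k[n.+1]}),
    [/\ F \is d.-homog, G \is d.-homog, mmap cst y G != 0
      & f = mmap cst y F / mmap cst y G].

(* An irreducible closed subset of P^N with its function field.  The field    *)
(* funField is given up to isomorphism: coord is the tuple of homogeneous     *)
(* coordinate functions (up to a common factor), a form vanishes at coord iff *)
(* it vanishes on the variety, and the quotients of forms of the same degree  *)
(* exhaust funField.                                                          *)
Record projVariety := ProjVariety {
  ambient : nat;
  equations : {mpoly k[ambient.+1]} -> Prop;
  equations_homog : forall F, equations F -> exists d : nat, F \is d.-homog;
  irreducible_zeros : forall (d e : nat) (F G : {mpoly k[ambient.+1]}),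
    F \is d.-homog -> G \is e.-homog ->
    (forall p, proj_zeros equations p -> (F * G).@[p] = 0) ->
    (forall p, proj_zeros equations p -> F.@[p] = 0) \/
    (forall p, proj_zeros equations p -> G.@[p] = 0);
  funField : fieldType;
  cst : {rmorphism k -> funField};
  coord : 'I_ambient.+1 -> funField;
  coord_vanish : forall (d : nat) (F : {mpoly k[ambient.+1]}),
    F \is d.-homog ->
    (mmap cst coord F = 0 <->
     forall p, proj_zeros equations p -> F.@[p] = 0);
  coord_gen : forall f : funField, homfrac cst coord f
}.

End ProjectiveSets.

Section Varieties.
Variables (k : closedFieldType) (X : projVariety k).
Local Notation K := (funField X).
Local Notation cstX := (@cst k X).

Definition point (p : 'I_(ambient X).+1 -> k) : Prop :=
  proj_zeros (@equations k X) p.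

(* f belongs to the local ring O_{X,p} and f(p) = c. *)
Definition value_at (p : 'I_(ambient X).+1 -> k) (f : K) (c : k) : Prop :=
  exists (d : nat) (F G : {mpoly k[(ambient X).+1]}),
    [/\ F \is d.-homog, G \is d.-homog, G.@[p] != 0,
        f = mmap cstX (@coord k X) F / mmap cstX (@coord k X) G
      & c = F.@[p] / G.@[p]].

Definition regular_at (p : 'I_(ambient X).+1 -> k) (f : K) : Prop :=
  exists c, value_at p f c.

Definition alg_indep (n : nat) (u : 'I_n -> K) : Prop :=
  forall F : {mpoly k[n]}, mmap cstX u F = 0 -> F = 0.

(* The subfield S of K has transcendence degree n over k. *)
Definition trdeg (S : K -> Prop) (n : nat) : Prop :=
  (exists u : 'I_n -> K, (forall i, S (u i)) /\ alg_indep u) /\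
  (forall u : 'I_n.+1 -> K, (forall i, S (u i)) -> ~ alg_indep u).

(* O_{X,p} is a regular local ring of dimension 2. *)
Definition smooth_at (p : 'I_(ambient X).+1 -> k) : Prop :=
  exists t : 'I_2 -> K,
    (forall i, value_at p (t i) 0) /\
    (forall f, value_at p f 0 ->
       exists a : 'I_2 -> K,
         (forall i, regular_at p (a i)) /\ f = \sum_(i < 2) a i * t i).

Definition smooth_surface : Prop :=
  trdeg (fun=> True) 2 /\ forall p, point p -> smooth_at p.

Definition normal_variety : Prop :=
  forall p, point p -> forall (f : K) (q : {poly K}),
    q \is monic -> (forall i : nat, regular_at p q`_i) -> root q f ->
    regular_at p f.

(* Rational maps from X to P^n are given by n+1 elements of K, not all zero,  *)
(* up to a common factor.  The map is defined at p, with value [z].           *)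
Definition map_value (n : nat) (y : 'I_n.+1 -> K)
    (p : 'I_(ambient X).+1 -> k) (z : 'I_n.+1 -> k) : Prop :=
  (exists i, z i != 0) /\
  exists2 l : K, l != 0 & forall i, value_at p (l * y i) (z i).

Definition is_morphism (n : nat) (y : 'I_n.+1 -> K) : Prop :=
  forall p, point p -> exists z, map_value y p z.

(* k-derivations of K, i.e. rational vector fields *)
Record derivation := Derivation {
  der_fun :> K -> K;
  der_add : forall f g, der_fun (f + g) = der_fun f + der_fun g;
  der_mul : forall f g, der_fun (f * g) = der_fun f * g + f * der_fun g;
  der_cst : forall c, der_fun (cstX c) = 0
}.

(* The m-th power of a rational 2-form w is encoded by its values             *)
(* (D, E) |-> w(D, E)^m on pairs of rational vector fields; on a surface,     *)
(* both the 2-forms and their m-th tensor powers form a line over K, so this  *)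
(* loses nothing.                                                             *)
Definition pluriform := derivation -> derivation -> K.

(* Sections near p of the m-th power of the canonical sheaf: sums of terms    *)
(* f (du_1 /\ dv_1) ... (du_m /\ dv_m) with f, u_j, v_j in O_{X,p}.           *)
Definition pluriform_regular_at (m : nat) (p : 'I_(ambient X).+1 -> k)
    (w : pluriform) : Prop :=
  exists (r : nat) (f : 'I_r -> K) (u v : 'I_r -> 'I_m -> K),
    [/\ forall i, regular_at p (f i),
        forall i j, regular_at p (u i j),
        forall i j, regular_at p (v i j)
      & forall D E : derivation,
          w D E = \sum_(i < r) f i *
            \prod_(j < m) (D (u i j) * E (v i j) - D (v i j) * E (u i j))].

(* H^0(X, m K_X) *)
Definition pluricanonical_section (m : nat) (w : pluriform) : Prop :=
  forall p, point p -> pluriform_regular_at m p w.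

Definition pluricanonical_basis (m n : nat) (s : 'I_n -> pluriform) : Prop :=
  [/\ forall i, pluricanonical_section m (s i),
      forall c : 'I_n -> k,
        (forall D E, \sum_(i < n) cstX (c i) * s i D E = 0) ->
        forall i, c i = 0
    & forall w, pluricanonical_section m w ->
        exists c : 'I_n -> k,
          forall D E, w D E = \sum_(i < n) cstX (c i) * s i D E].

(* y is the rational map given by the complete linear system |m K_X|, in the  *)
(* coordinates of P^n given by some basis of H^0(X, m K_X); in particular     *)
(* h^0(X, m K_X) = n + 1.                                                     *)
Definition pluricanonical_map (m n : nat) (y : 'I_n.+1 -> K) : Prop :=
  exists2 s : 'I_n.+1 -> pluriform, pluricanonical_basis m s &
    exists eta : pluriform, forall i D E, s i D E = y i * eta D E.

Definition canonical_map (n : nat) (y : 'I_n.+1 -> K) : Prop :=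
  pluricanonical_map 1 y.

(* Some pluricanonical image is a surface, i.e. the Kodaira dimension is 2. *)
Definition general_type : Prop :=
  exists (m n : nat) (y : 'I_n.+1 -> K),
    [/\ (0 < m)%N, pluricanonical_map m y & trdeg (homfrac cstX y) 2].

(* The extension K / k(y_i / y_j) is isomorphic, via j, to L / F. *)
Definition extension_model (n : nat) (y : 'I_n.+1 -> K)
    (F : fieldType) (L : fieldExtType F) (j : {rmorphism L -> K}) : Prop :=
  bijective j /\ forall f : K, homfrac cstX y f <-> exists a : F, f = j a%:A.

(* The map is generically finite of degree d onto its image. *)
Definition map_degree (n : nat) (y : 'I_n.+1 -> K) (d : nat) : Prop :=
  exists (F : fieldType) (L : fieldExtType F) (j : {rmorphism L -> K}),
    extension_model y j /\ \dim {:L} = d.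

Definition abelian_extension (n : nat) (y : 'I_n.+1 -> K) : Prop :=
  exists (F : fieldType) (L : splittingFieldType F) (j : {rmorphism L -> K}),
    [/\ extension_model y j, galois 1 {:L} & abelian 'Gal({:L} / 1)].

(* The open subset U of X is isomorphic, via a, to a closed subvariety of the *)
(* affine space A^m: a is regular on U, maps U onto the zero set of the       *)
(* relations between the a_i, and identifies the local rings.                 *)
Definition affine_open (U : ('I_(ambient X).+1 -> k) -> Prop) : Prop :=
  exists (m : nat) (a : 'I_m -> K),
    [/\ forall p, U p -> forall i, regular_at p (a i),
        forall z : 'I_m -> k,
          (forall F : {mpoly k[m]}, mmap cstX a F = 0 -> F.@[z] = 0) ->
          exists2 p, U p & forall i, value_at p (a i) (z i)
      & forall p, U p -> forall f, regular_at p f ->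
          exists (F G : {mpoly k[m]}) (z : 'I_m -> k),
            [/\ forall i, value_at p (a i) (z i), G.@[z] != 0
              & f = mmap cstX a F / mmap cstX a G]].

Definition regular_on (U : ('I_(ambient X).+1 -> k) -> Prop) (f : K) : Prop :=
  forall p, U p -> regular_at p f.

(* Preimage of the standard affine open z_j <> 0 of P^n. *)
Definition chart_preim (n : nat) (y : 'I_n.+1 -> K) (j : 'I_n.+1)
    (p : 'I_(ambient X).+1 -> k) : Prop :=
  point p /\ exists2 z, map_value y p z & z j != 0.

(* Image in K of the coordinate ring of the chart z_j <> 0 of P^n. *)
Definition chart_ring (n : nat) (y : 'I_n.+1 -> K) (j : 'I_n.+1)
    (f : K) : Prop :=
  exists (d : nat) (F : {mpoly k[n.+1]}),
    F \is d.-homog /\ f = mmap cstX y F / y j ^+ d.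

(* Over each standard chart the preimage is affine and its coordinate ring is *)
(* a finite module over that of the chart (the preimage is empty if y_j = 0). *)
Definition finite_morphism (n : nat) (y : 'I_n.+1 -> K) : Prop :=
  is_morphism y /\
  forall j, y j != 0 ->
    affine_open (chart_preim y j) /\
    exists (r : nat) (e : 'I_r -> K),
      (forall i, regular_on (chart_preim y j) (e i)) /\
      (forall f, regular_on (chart_preim y j) f ->
         exists b : 'I_r -> K,
           (forall i, chart_ring y j (b i)) /\ f = \sum_(i < r) b i * e i).

Definition surjective_map (n : nat) (y : 'I_n.+1 -> K) : Prop :=
  forall z : 'I_n.+1 -> k, (exists i, z i != 0) ->
    exists2 p, point p & map_value y p z.

(* y : X -> P^n is an abelian cover. *)
Definition abelian_cover (n : nat) (y : 'I_n.+1 -> K) : Prop :=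
  [/\ finite_morphism y, surjective_map y, normal_variety
    & abelian_extension y].

End Varieties.

(* A birational map X --> Y, given by the k-isomorphism th of function fields *)
(* with inverse th'. *)
Definition birational_map (k : closedFieldType) (X Y : projVariety k)
    (th : {rmorphism funField Y -> funField X})
    (th' : {rmorphism funField X -> funField Y}) : Prop :=
  [/\ cancel th th', cancel th' th & forall c, th (@cst k Y c) = @cst k X c].

(* The birational map X --> Y given by th is everywhere defined on X. *)
Definition birational_morphism (k : closedFieldType) (X Y : projVariety k)
    (th : {rmorphism funField Y -> funField X}) : Prop :=
  forall p : 'I_(ambient X).+1 -> k, point p ->
    exists2 q : 'I_(ambient Y).+1 -> k, point q &
      map_value (fun i => th (@coord k Y i)) p q.

(* Every birational morphism to a smooth projective surface is an isomorphism *)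
(* (equivalently, by Castelnuovo, there is no (-1)-curve).                    *)
Definition minimal_surface (k : closedFieldType) (X : projVariety k) : Prop :=
  smooth_surface X /\
  forall (Y : projVariety k)
    (th : {rmorphism funField Y -> funField X})
    (th' : {rmorphism funField X -> funField Y}),
    smooth_surface Y -> birational_map th th' -> birational_morphism th ->
    birational_morphism th'.

Definition minimal_surface_of_general_type (k : closedFieldType)
    (X : projVariety k) : Prop :=
  minimal_surface X /\ general_type X.

(* Main.v *)
(* Let K be the function field of X and F0 that of P^2. As K / F0 is Galois    *)
(* with abelian group, K has a basis of eigenvectors w_i, and they can be      *)
(* scaled so that w_i^m is a form Phi_i of degree m l_i on P^2 without m-th    *)
(* power factors. Over P^2 the canonical sheaf of X then splits as             *)
(* (+)_i O(l_i - 3) w_i^-1. It is also the pullback of O(1), because phi is a  *)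
(* canonical map, so some l_i is at least 4; and p_g = 3 leaves no room for    *)
(* any other l_i above 2. The exponents of the irreducible factors of the      *)
(* Phi_i form a subgroup C of (Z/m)^r of order d in which m l_i is a weighted  *)
(* sum of coordinates. If c0 is the heavy element, c and c0 - c are light, so  *)
(* c <= c0 coordinatewise and c has weight exactly 2m; applying this to the    *)
(* multiples of -c0 shows that -c0 has order 2, 3, 4 or 6 (if d > 2), and      *)
(* averaging the weight over subgroups that avoid c0 then bounds d.            *)

From HB Require Import structures.
Require Import Defs.
From mathcomp Require Import all_boot all_order all_algebra all_fingroup.
From mathcomp Require Import all_solvable all_field.
From mathcomp Require Import boolp complex mpoly reals.
From mathcomp Require Import ring zify.

Set Implicit Arguments.
Unset Strict Implicit.
Unset Printing Implicit Defensive.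

Import Order.TTheory GRing.Theory Num.Theory.
Local Open Scope ring_scope.

(** * Weights of subgroups of (Z/m)^r *)

(** Let F0 be the function field of the plane. Kummer theory ([kummer_basis], [kummer_normal_form])
    gives an F0-basis of K = k(X) of eigenvectors w_i, one for each character of the Galois group,
    with w_i^m = Phi_i a form of degree m l_i without m-th power factors; W_i is w_i dehomogenised
    on a chart. Multiplying characters adds the exponents of the primes in the Phi_i modulo m, so
    exponent vectors embed the character group as a subgroup C of (Z/m)^r on which m l_i is a weight
    ([kummer_degree]).

    Geometry restricts the weights. Let A be the coordinate ring of a chart. As X is normal, the
    functions over the chart are the direct sum of the A W_i ([Bring_regular], [regular_Bring]). The
    regular 2-forms are the direct sum of the A W_i^-1 dx_a /\ dx_b: logarithmic derivatives show
    that these forms are regular ([theta_regular]), and Jacobians of functions have no worse poles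
    ([Jac_Bring], [form_regular_polyring]). So the canonical sheaf pushes forward to the sum of the
    O(l_i - 3). For a canonical map all y_a g Omega are regular, so g is a section after a twist by
    -1, and some l_i is at least 4 ([canonical_degree]). That summand already has three independent
    sections while p_g = 3, so every other l_i is at most 2 ([canonical_degrees]).

    The rest is combinatorial ([card_weighted_code]): C has one element c0 of weight at least 4m and
    all others weigh at most 2m. For c different from 0 and c0, the weights of c and c0 - c add up
    to at least that of c0, so subtraction has no borrow, c <= c0 coordinatewise, and c weighs
    exactly 2m. Applied to the multiples of eps = -c0, this leaves the orders 2, 3, 4 and 6 for eps
    when |C| > 2. Double counting over the codewords that vanish at one coordinate ([average],
    [card_bound]) bounds |C| by 16 or 18 in the prime power cases, and order 6 forces |C| = 6.

    For the last claim the target is not given as a plane; [cover_dimension] shows that it is one,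
    and 36 is not in the list. *)

HB.instance Definition _ (I : finType) (T : finZmodType) := Finite.on {ffun I -> T}.

Section WeightedCodes.
Variables (m' r : nat).
Local Notation m := m'.+2.
Local Notation V := {ffun 'I_r -> 'I_m'.+2}.
Variable d : 'I_r -> nat.
Hypothesis d_gt0 : forall q, (0 < d q)%N.

Definition weight (c : V) : nat := (\sum_q d q * c q)%N.

Lemma code_valN (c : V) q : ((c q + (- c)%R q) = (c q != 0%R) * m)%N.
Proof.
rewrite ffunE /= -val_eqE /=; case: (c q) => [[|i]] /= ilt; first by rewrite subn0 modnn.
by rewrite modn_small; lia.
Qed.

Lemma code_valB (a c : V) q :
  ((c q + (a - c)%R q) = a q + (a q < c q) * m)%N.
Proof.
rewrite !ffunE /=; case: (c q) (a q) => [i ilt] [j jlt] /=.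
rewrite modnDmr; case: ltnP => h.
  by rewrite modn_small ?mul1n; lia.
have -> : (j + (m - i) = (j - i) + m)%N by lia.
by rewrite modnDr modn_small; lia.
Qed.

Lemma code_valM (c : V) k q : ((c *+ k)%R q = (k * c q) %% m :> nat)%N.
Proof.
elim: k => [|k IHk]; first by rewrite mulr0n ffunE mul0n mod0n.
by rewrite mulrS ffunE /= IHk modnDmr mulSn.
Qed.

Lemma weight0 : weight 0 = 0%N.
Proof. by rewrite /weight big1 // => q _; rewrite ffunE muln0. Qed.

(** Opposite coordinates add up to m on the support and to 0 elsewhere, so the weights of c and -c
    together measure the support. *)
Lemma weightN (c : V) :
  (weight c + weight (- c) = m * \sum_(q | c q != 0%R) d q)%N.
Proof.
rewrite /weight -big_split /= big_distrr /= [RHS]big_mkcond; apply: eq_bigr => q _.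
by rewrite -mulnDr code_valN; case: eqP => _ /=; rewrite ?muln0 // mul1n mulnC.
Qed.

Variables (C : {set V}) (c0 : V).
Hypothesis C_0 : 0 \in C.
Hypothesis C_B : {in C &, forall a b, a - b \in C}.
Hypothesis C_c0 : c0 \in C.
Hypothesis c0_large : (4 * m <= weight c0)%N.
Hypothesis C_small : forall c, c \in C -> c != c0 -> (weight c <= 2 * m)%N.

Let C_N c : c \in C -> - c \in C.
Proof. by rewrite -[- c]add0r; apply: C_B. Qed.

Let C_D : {in C &, forall a b, a + b \in C}.
Proof. by move=> a b aC bC; rewrite -[b]opprK; apply: C_B => //; apply: C_N. Qed.

Let C_M c k : c \in C -> c *+ k \in C.
Proof.
by move=> cC; elim: k => [|k IHk]; rewrite ?mulr0n // mulrS; apply: C_D.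
Qed.

Let c0_neq0 : c0 != 0.
Proof. by apply: contraTneq c0_large => ->; rewrite weight0 -ltnNge. Qed.

Let card_C_gt1 : (1 < #|C|)%N.
Proof. by apply/card_gt1P; exists 0, c0; rewrite eq_sym. Qed.

Section MoreThanTwo.
Hypothesis card_C : (2 < #|C|)%N.

(* [c] and [c0 - c] both have weight at most [2m], while their coordinates add *)
(* up to those of [c0] except for carries.                                     *)
Let pairing c : c \in C -> c != 0 -> c != c0 ->
  [/\ forall q, (c q <= c0 q)%N, weight c0 = (4 * m)%N & weight c = (2 * m)%N].
Proof.
move=> cC cn0 cnc0; have c'C : c0 - c \in C by apply: C_B.
have c'n : c0 - c != c0 by rewrite -subr_eq0 addrAC subrr add0r oppr_eq0.
have wc := C_small cC cnc0; have wc' := C_small c'C c'n.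
have e : (weight c + weight (c0 - c)%R =
    weight c0 + m * \sum_(q | (c0 q < c q)%N) d q)%N.
  rewrite /weight -big_split /= big_distrr /= [X in (_ + X)%N]big_mkcond -big_split.
  apply: eq_bigr => q _ /=; rewrite -mulnDr code_valB mulnDr.
  by case: ifP => _ /=; rewrite ?muln0 // mul1n [(m * _)%N]mulnC.
have s0 : (\sum_(q | (c0 q < c q)%N) d q = 0)%N.
  move: e c0_large wc wc'; case: (\sum_(q | _) _)%N => // s; rewrite mulnS.
  by move: (weight _) (weight _) (weight _) (m * s)%N => x y z t; clear; lia.
have [e1 e2] : weight c0 = (4 * m)%N /\ weight c = (2 * m)%N.
  move: e c0_large wc wc'; rewrite s0.
  by move: (weight _) (weight _) (weight _) => x y z; clear; lia.
split=> // q.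
rewrite leqNgt; apply/negP => h; have := d_gt0 q.
by move/eqP: s0; rewrite sum_nat_eq0 => /forallP/(_ q); rewrite h /= => /eqP->.
Qed.

Let c0_max c q : c \in C -> (c q <= c0 q)%N.
Proof.
move=> cC; have [->|cn0] := eqVneq c 0; first by rewrite ffunE.
by have [->//|cnc0] := eqVneq c c0; have [] := pairing cC cn0 cnc0.
Qed.

Let weight_c0 : weight c0 = (4 * m)%N.
Proof.
have /card_gt2P[x [y [z [[xC yC zC] [xy yz zx]]]]] := card_C.
have [w [wC w0 wc]] : exists w, [/\ w \in C, w != 0 & w != c0].
  have [ex|x0] := eqVneq x 0; have [ey|y0] := eqVneq y 0.
  - by move: xy; rewrite ex ey eqxx.
  - have [ey|] := eqVneq y c0; last by exists y.
    by exists z; split; rewrite // -1?ex // -ey eq_sym.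
  - have [ex|] := eqVneq x c0; last by exists x.
    by exists z; split; rewrite // -1?ey // 1?eq_sym // -ex eq_sym.
  - have [ex|] := eqVneq x c0; last by exists x.
    by exists y; split; rewrite // -ex eq_sym.
by have [] := pairing wC w0 wc.
Qed.

Let weight_C c : c \in C -> c != 0 -> c != c0 -> weight c = (2 * m)%N.
Proof. by move=> cC c1 c2; have [] := pairing cC c1 c2. Qed.

(** As c0 is the coordinatewise maximum of C, the convenient element is its opposite [eps], whose
    coordinates on the support [act] of c0 are the [n q]. *)
Let act (q : 'I_r) : bool := c0 q != 0.
Let n (q : 'I_r) : nat := (m - c0 q)%N.
Let eps : V := - c0.

Let n_gt0 q : (0 < n q)%N. Proof. by rewrite subn_gt0. Qed.
Let n_c0 q : (c0 q + n q = m)%N. Proof. by rewrite subnKC // ltnW. Qed.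
Let c0_gt0 q : act q -> (0 < c0 q)%N. Proof. by rewrite lt0n. Qed.

Let inactive c q : c \in C -> ~~ act q -> c q = 0.
Proof.
move=> cC; rewrite negbK => /eqP e; apply/val_inj/eqP.
by have := c0_max q cC; rewrite e leqn0.
Qed.

(** Write c q = s * n q + r with r < n q. If r were positive, the coordinate q of c + (s+1) c0 would
    be c0 q + r, above the maximum c0 q. *)
Let n_dvd c q : c \in C -> (n q %| c q)%N.
Proof.
move=> cC; rewrite /dvdn; apply/negPn/negP => rn0.
have := c0_max q (C_D cC (C_M (c q %/ n q).+1 C_c0)).
rewrite ffunE /= code_valM modnDmr; set s := (_ %/ _)%N in rn0 *; rewrite leqNgt => /negP[].
have rlt := ltn_pmod (c q) (n_gt0 q); have e := divn_eq (c q) (n q).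
have -> : (c q + s.+1 * c0 q = s * m + (c0 q + c q %% n q))%N.
  have -> : (s * m = s * c0 q + s * n q)%N by rewrite -mulnDr n_c0.
  by rewrite {1}e -/s mulSn; ring.
rewrite modnMDl modn_small.
  by rewrite -[X in (X < _)%N]addn0 ltn_add2l lt0n.
by rewrite -[X in (_ < X)%N](n_c0 q) ltn_add2l.
Qed.

Let n_dvdm q : act q -> (n q %| m)%N.
Proof.
move=> aq; have := n_dvd q C_c0.
by rewrite -[X in _ -> is_true (_ %| X)%N](n_c0 q) => h; rewrite dvdn_add.
Qed.

(** At an active q the coordinates of all codewords lie in the subgroup of Z/m generated by [n q];
    this is its order. *)
Let mq q : nat := (m %/ n q)%N.
Let mqE q : act q -> (mq q * n q = m)%N. Proof. by move/n_dvdm/divnK. Qed.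

Let mq_gt1 q : act q -> (1 < mq q)%N.
Proof.
move=> aq; have := mqE aq; have := n_c0 q; have := c0_gt0 aq.
case: (mq q) => [|[|]] //; rewrite mul1n => + + e; rewrite e.
by move: (nat_of_ord _) => x; clear; lia.
Qed.

Let epsE q : act q -> eps q = n q :> nat.
Proof.
move=> aq; have := code_valN c0 q; rewrite (_ : c0 q != 0) // mul1n => e.
by apply/(@addnI (c0 q)); rewrite e n_c0.
Qed.

Let epsM k q : act q -> ((eps *+ k)%R q = n q * (k %% mq q) :> nat)%N.
Proof. by move=> aq; rewrite code_valM epsE // -{1}(mqE aq) -muln_modl mulnC. Qed.

Let eps_C : eps \in C. Proof. exact: C_N. Qed.
Let epsM_C k : eps *+ k \in C. Proof. exact: C_M. Qed.

Let epsM_eq0 k : (eps *+ k == 0) = [forall (q | act q), (mq q %| k)%N].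
Proof.
apply/eqP/forall_inP => [e q aq|h].
  have := epsM k aq; rewrite e ffunE => /esym/eqP.
  by rewrite muln_eq0 eqn0Ngt n_gt0.
apply/ffunP => q; rewrite [RHS]ffunE; have [aq|/inactive->//] := boolP (act q).
by apply/val_inj; apply: etrans (epsM k aq) _; rewrite (eqP (h q aq)) muln0.
Qed.

Let weight_act c : c \in C -> weight c = (\sum_(q | act q) d q * c q)%N.
Proof.
move=> cC; rewrite /weight [RHS]big_mkcond; apply: eq_bigr => q _.
by case: ifP => // /negbT/(inactive cC)->; rewrite muln0.
Qed.

(** [A] is the weight of [eps], [E] the total of d over the support of c0, and [A_ j] the part of
    [A] coming from the coordinates where [eps] has order j. *)
Let a q : nat := (d q * n q)%N.
Let E : nat := (\sum_(q | act q) d q)%N.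
Let A : nat := (\sum_(q | act q) a q)%N.
Let A_ j : nat := (\sum_(q | act q && (mq q == j)) a q)%N.

Let EA : (E * m = A + 4 * m)%N.
Proof.
rewrite -weight_c0 weight_act // /E /A big_distrl -big_split /=.
by apply: eq_bigr => q aq; rewrite /a -mulnDr addnC n_c0.
Qed.

Let weight_eps k : (weight (eps *+ k) = \sum_(q | act q) a q * (k %% mq q))%N.
Proof.
by rewrite weight_act //; apply: eq_bigr => q aq; rewrite epsM // mulnA.
Qed.

Let A_E j : (0 < j)%N -> (j * A_ j = m * \sum_(q | act q && (mq q == j)) d q)%N.
Proof.
move=> j0; rewrite /A_ !big_distrr /=; apply: eq_bigr => q /andP[aq /eqP ej].
by rewrite /a -[X in (X * d q)%N](mqE aq) ej; ring.
Qed.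

Let A_exists j : (0 < A_ j)%N -> exists2 q, act q & mq q = j.
Proof.
rewrite lt0n sum_nat_eq0 negb_forall => /existsP[q].
by rewrite negb_imply => /andP[/andP[aq /eqP ej] _]; exists q.
Qed.

Let subcode (H : {set V}) :=
  [/\ H \subset C, 0 \in H & {in H &, forall x y, x - y \in H}].

Let kernel (H : {set V}) q : {set V} := [set c in H | c q == 0].

Let kernel_subcode H q : subcode H -> subcode (kernel H q).
Proof.
case=> HC H0 HB; split.
- by apply: subset_trans HC; apply/subsetP => c; rewrite inE => /andP[].
- by rewrite inE H0 ffunE eqxx.
- move=> x y; rewrite !inE => /andP[xH /eqP xq] /andP[yH /eqP yq].
  by rewrite HB //= !ffunE xq yq subrr.
Qed.

(** Elements of H with the same coordinate q differ by an element of the kernel, and that coordinate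
    takes at most [mq q] values. *)
Let fiber_bound H q : subcode H -> act q -> (#|H| <= mq q * #|kernel H q|)%N.
Proof.
case=> HC H0 HB aq; have HCP := subsetP HC.
rewrite -sum1_card (partition_big (fun c : V => inord (c q %/ n q) : 'I_(mq q).-1.+1)
  predT) //=.
rewrite -[X in (_ <= X * _)%N](ltn_predK (mq_gt1 aq)).
rewrite -[X in (_ <= X * _)%N]card_ord -sum_nat_const; apply: leq_sum => j _.
rewrite sum1_card.
have [b /andP[bH /eqP bj]|] := pickP [pred c in H | inord (c q %/ n q) == j]; last first.
  by move=> e; rewrite (eq_card0 e).
rewrite -(card_imset _ (addIr (- b))); apply: subset_leq_card.
apply/subsetP => _ /imsetP[c /andP[cH /eqP cj] ->]; rewrite inE HB //= !ffunE subr_eq0.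
rewrite -val_eqE /= -(divnK (n_dvd q (HCP c cH))) -(divnK (n_dvd q (HCP b bH))).
have lt x : x \in H -> (x q %/ n q < (mq q).-1.+1)%N.
  move=> xH; rewrite (ltn_predK (mq_gt1 aq)) ltn_divLR ?mqE //; exact: ltn_ord.
by have := congr1 val (etrans cj (esym bj)); rewrite /= !inordK ?lt // => ->.
Qed.

(** The total of weight c + weight (- c) over H is computed twice. Since H misses c0, its nonzero
    elements all weigh 2m. On the other hand, by [weightN], a coordinate q contributes m * d q for
    every element of H outside [kernel H q]. *)
Let average H : subcode H -> c0 \notin H ->
  (\sum_(q | act q) d q * #|kernel H q| + 4 * #|H| = E * #|H| + 4)%N.
Proof.
case=> HC H0 HB c0H; have HCP := subsetP HC.
have HN c : c \in H -> - c \in H by move=> cH; rewrite -[- c]add0r HB.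
have sw : (\sum_(c in H) weight c = 2 * m * #|H|.-1)%N.
  rewrite (bigD1 (0 : V)) //= weight0 add0n (eq_bigr (fun=> 2 * m)%N).
    rewrite sum_nat_const mulnC (cardD1 (0 : V) H) H0; congr (_ * _)%N.
    by apply: eq_card => c; rewrite !inE andbC.
  move=> c /andP[cH cn0]; apply: weight_C => //; first exact: HCP.
  by apply: contraNneq c0H => <-.
have sw2 : (\sum_(c in H) (weight c + weight (- c)) = 4 * m * #|H|.-1)%N.
  rewrite big_split /= sw [X in (_ + X)%N](reindex_inj (inv_inj (@opprK V))) /=.
  rewrite (eq_bigl (mem H)) => [|c]; last first.
    by rewrite /=; apply/idP/idP => /HN; rewrite ?opprK.
  by under eq_bigr do rewrite opprK; rewrite sw; ring.
have sq : (\sum_(c in H) (weight c + weight (- c)) + m * \sum_(q | act q) d q * #|kernel H q|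
    = m * (E * #|H|))%N.
  under eq_bigr => c cH do rewrite weightN.
  rewrite -big_distrr /= -mulnDr; congr (_ * _)%N.
  rewrite (exchange_big_dep act) /=; last first.
    move=> c q cH; apply: contraNT => /(inactive (HCP c cH))->; exact: eqxx.
  rewrite /E big_distrl -big_split /=; apply: eq_bigr => q aq.
  rewrite sum_nat_const mulnC -mulnDr; congr (_ * _)%N.
  rewrite -[RHS](cardID [pred c : V | c q == 0]) addnC; congr (_ + _)%N.
    by apply: eq_card => c; rewrite !inE.
  by apply: eq_card => c; rewrite !inE andbC.
have hH : (0 < #|H|)%N by apply/card_gt0P; exists 0.
move: sq; rewrite sw2 => sq; apply/eqP; rewrite -(eqn_pmul2l (ltn0Sn m'.+1)); apply/eqP.
by rewrite !mulnDr -sq -[in X in (_ + X = _)%N](prednK hH); ring.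
Qed.

(** [average] for H = [kernel C q], which misses c0. The term of q itself is d q * |H|, the other
    terms are bounded below by [fiber_bound], and after [EA] only the excess of the term of q
    remains to be compared with 4m. *)
Let kernel_bound q : act q -> ((m - n q) * #|kernel C q| <= 4 * m)%N.
Proof.
move=> aq; set H := kernel C q.
have sH : subcode H by apply: kernel_subcode; split.
have c0H : c0 \notin H by rewrite inE; apply/nandP; right.
have av := average sH c0H.
have KH : kernel H q = H by apply/setP => c; rewrite !inE -andbA andbb.
have : (A * #|H| + d q * (m - n q) * #|H| <= m * \sum_(p | act p) d p * #|kernel H p|)%N.
  have t : (a q * #|H| + d q * (m - n q) * #|H| = m * (d q * #|H|))%N.
    by rewrite /a -mulnDl -mulnDr subnKC ?leq_subr // mulnA [(m * _)%N]mulnC.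
  rewrite /A big_distrl big_distrr /= (bigD1 q) //= [X in (_ <= X)%N](bigD1 q) //= KH -t.
  rewrite addnAC leq_add2l; apply: leq_sum => p /andP[ap _].
  rewrite /a -[X in (_ <= X * _)%N](mqE ap).
  have -> x : (mq p * n p * (d p * x) = d p * n p * (mq p * x))%N by ring.
  by rewrite leq_mul2l fiber_bound ?orbT.
have := congr1 (muln m) av; rewrite !mulnDr [(m * (E * _))%N]mulnA [(m * E)%N]mulnC EA.
have := leq_mul (d_gt0 q) (leqnn ((m - n q) * #|H|)%N); rewrite mul1n mulnA mulnDl.
by move: (_ * _)%N => x; move: (_ * _)%N => y; move: (_ * _)%N => z; clear; lia.
Qed.

(** [fiber_bound] and [kernel_bound] together. The cases of interest are [mq q] = 2, where |C| is at
    most 16, and [mq q] = 3, where it is at most 18. *)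
Let card_bound q : act q -> ((mq q).-1 * #|C| <= 4 * mq q ^ 2)%N.
Proof.
move=> aq; have k_le := kernel_bound aq; have mE := mqE aq; have n0 := n_gt0 q.
have := @fiber_bound C q (And3 (subxx C) C_0 C_B) aq; move: mE n0 k_le.
move: #|C| #|kernel C q| (mq q) (n q) => c K Q N; move: m => M <- N0.
rewrite -{2}[N]mul1n -mulnBl subn1 mulnAC mulnA leq_pmul2r // => h cK.
by apply: leq_trans (leq_mul (leqnn _) cK) _; rewrite -mulnn mulnCA [X in (_ <= X)%N]mulnCA leq_mul2l h orbT.
Qed.

Let C_exponent N c : (forall q, act q -> (mq q %| N)%N) -> c \in C -> c *+ N = 0.
Proof.
move=> h cC; apply/ffunP => q; rewrite [RHS]ffunE.
have [aq|/inactive->//] := boolP (act q); last exact: C_M.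
apply/val_inj; apply: etrans (code_valM _ _ _) _; apply/eqP; rewrite -/(_ %| _)%N.
by rewrite -[X in (X %| _)%N](mqE aq) dvdn_mul ?h ?n_dvd.
Qed.

(** By Cauchy's theorem every prime divisor of |C| is the order of a codeword. *)
Let C_prime_power p N : prime p -> (forall c, c \in C -> c *+ p ^ N = 0) ->
  exists e, #|C| = (p ^ e)%N.
Proof.
move=> pp hN; have gC : group_set C.
  by apply/group_setP; split=> [|x y xC yC]; rewrite ?C_0 //; exact: C_D.
have : (p.-group (Group gC))%g.
  apply/pgroupP => l lp /(Cauchy lp)[x xC ox]; rewrite inE -dvdn_prime2 //.
  have : (l %| p ^ N)%N by rewrite -ox order_dvdn; apply/eqP; apply: hN.
  by rewrite Euclid_dvdX // => /andP[].
by case/p_natP => e; exists e.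
Qed.

Let six_torsion (H : {set V}) q : subcode H -> act q ->
  (forall c, c \in H -> c != 0 -> c q != 0) -> (#|H| <= mq q)%N.
Proof.
move=> sH aq hq; rewrite -[mq q]muln1; have [HC H0 HB] := sH.
have -> : 1%N = #|kernel H q|; last exact: fiber_bound.
rewrite (_ : kernel H q = [set 0]) ?cards1 //; apply/setP => c; rewrite !inE.
apply/andP/eqP => [[cH cq]|->]; last by rewrite H0 ffunE eqxx.
by apply: contraTeq cq => /(hq c cH).
Qed.

Let torsion_coord k c q :
  c \in C -> c *+ k = 0 -> act q -> coprime (mq q) k -> c q = 0.
Proof.
move=> cC ck aq cop; have : (m %| k * c q)%N by rewrite /dvdn -code_valM ck ffunE.
rewrite -[X in (X %| _)%N](mqE aq) -(divnK (n_dvd q cC)) mulnA dvdn_pmul2r //.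
rewrite Gauss_dvdr // => h; apply/val_inj/eqP; rewrite -[X in X == _](modn_small (ltn_ord (c q))).
have : (mq q * n q %| c q)%N by rewrite -(divnK (n_dvd q cC)) dvdn_mul.
by rewrite mqE.
Qed.

(** Both c and -c differ from c0, so they weigh 2m and the support of c has d-total 4. It avoids the
    coordinates of order j, whose d-total is 2; as [E] = 6 there is no room for avoiding q0 as
    well. *)
Let torsion_support k j q0 c : E = 6 -> (\sum_(q | act q && (mq q == j)) d q = 2)%N ->
  coprime j k -> act q0 -> mq q0 != j ->
  c \in C -> c *+ k = 0 -> c != 0 -> c0 *+ k != 0 -> c q0 != 0.
Proof.
move=> E6 Dj cop aq0 mq0 cC ck cn0 c0k; apply/eqP => cq0.
have cc0 : c != c0 by apply: contraNneq c0k => <-; rewrite ck.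
have Nc0 : - c != 0 by rewrite oppr_eq0.
have Ncc0 : - c != c0 by apply: contraNneq c0k => <-; rewrite mulNrn ck oppr0.
have := weightN c; rewrite (weight_C cC) // (weight_C (C_N cC)) // -mulnDl mulnC.
move/eqP; rewrite eqn_pmul2l // => /eqP s4.
have : (\sum_(q | c q != 0%R) d q + d q0 + 2 <= E)%N.
  rewrite -Dj /E big_mkcond [X in (_ + X <= _)%N]big_mkcond [X in (_ <= X)%N]big_mkcond /=.
  rewrite (bigD1 q0) //= [X in (_ + X <= _)%N](bigD1 q0) //= [X in (_ <= X)%N](bigD1 q0) //=.
  rewrite cq0 eqxx aq0 (negPf mq0) /= !add0n addnAC addnC leq_add2l -big_split.
  apply: leq_sum => q _ /=; case: (boolP (act q)) => [aq|/(inactive cC)->]; last by rewrite eqxx.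
  case: (mq q =P j) => [ej|_]; last by rewrite addn0; case: ifP.
  by rewrite (torsion_coord cC ck aq) ?ej // eqxx.
by have := d_gt0 q0; rewrite -s4 E6; move: (d q0) => x; clear; lia.
Qed.

Let weight_epsM k : eps *+ k != 0 -> eps *+ k.+1 != 0 -> weight (eps *+ k) = (2 * m)%N.
Proof.
move=> k0 k1; apply: weight_C => //; apply: contraNneq k1 => e.
by rewrite mulrS e addNr.
Qed.

Let A_mk j : (A_ j = \sum_(q | act q) (mq q == j) * a q)%N.
Proof.
by rewrite /A_ big_mkcondr; apply: eq_bigr => q _; case: eqP; rewrite ?mul1n.
Qed.

Let act_exists : exists q, act q.
Proof.
have [/existsP//|/existsPn h] := boolP [exists q, act q].
by case/eqP: c0_neq0; apply/ffunP => q; rewrite (inactive C_c0 (h q)) ffunE.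
Qed.

(** The order of [eps] is found by comparing the weights of its multiples, all equal to 2m except
    those of 0 and c0. Order 2 or 4 makes |C| a power of 2 with some [mq q] = 2, order 3 makes it a
    power of 3 with [mq q] = 3; otherwise the order is 6 and the multiples of [eps] exhaust C. *)
Lemma card_code_gt2 : #|C| \in [:: 3; 4; 6; 8; 9; 16]%N.
Proof.
have [q0 aq0] := act_exists.
have two_power : (#|C| <= 16)%N -> (exists e, #|C| = 2 ^ e)%N ->
    #|C| \in [:: 3; 4; 6; 8; 9; 16]%N.
  move=> + [e eC]; move: card_C; rewrite eC; case: e {eC} => [|[|[|[|[|e]]]]] //.
  by rewrite !expnS; have := expn_gt0 2 e; move: (2 ^ e)%N => x /=; clear; lia.
have mq2_bound q : act q -> mq q = 2 -> (#|C| <= 16)%N.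
  by move=> aq e; have := card_bound aq; rewrite e mul1n.
have [/eqP|e2] := boolP (eps *+ 2 == 0).
  move/eqP; rewrite epsM_eq0 => /forall_inP d2.
  have mq2 q : act q -> mq q = 2.
    by move=> aq; apply/eqP; rewrite eqn_leq mq_gt1 // dvdn_leq ?d2.
  apply: two_power; first exact: (mq2_bound q0 aq0 (mq2 q0 aq0)).
  by apply: (@C_prime_power 2 1) => // c; apply: C_exponent => q /d2.
have e1 : eps *+ 1 != 0 by apply: contraNneq e2 => e; rewrite mulrS -[eps in X in X + _]mulr1n e addr0.
have A2m : A = (2 * m)%N.
  rewrite -(weight_epsM e1 e2) weight_eps; apply: eq_bigr => q aq.
  by rewrite modn_small ?muln1 // mq_gt1.
have E6 : E = 6.
  by apply/eqP; rewrite -(eqn_pmul2r (ltn0Sn m'.+1)) EA A2m -mulnDl.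
have [/eqP|e3] := boolP (eps *+ 3 == 0).
  move/eqP; rewrite epsM_eq0 => /forall_inP d3.
  have [e eC] : exists e, #|C| = (3 ^ e)%N.
    by apply: (@C_prime_power 3 1) => // c; apply: C_exponent => q /d3.
  have mq3 : mq q0 = 3.
    have := d3 q0 aq0; have := mq_gt1 aq0; rewrite (dvdn_divisors _ (ltn0Sn 2)).
    by case: (mq q0) => [|[|[|[|[|x]]]]].
  have := card_bound aq0; move: card_C; rewrite eC mq3; case: e {eC} => [|[|[|e]]] // _.
  by rewrite !expnS; have := expn_gt0 3 e; move: (3 ^ e)%N => x /=; clear; lia.
(* Reducing the coefficient 2 modulo [mq q] loses 2 exactly where [mq q] = 2, while eps and 2 eps
   have the same weight 2m. *)
have A2 : A_ 2 = m.
  have : (weight (eps *+ 2) + 2 * A_ 2 = 2 * A)%N.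
    rewrite weight_eps A_mk /A !big_distrr -big_split /=; apply: eq_bigr => q aq.
    by have := mq_gt1 aq; case: (mq q) => [|[|[|x]]] // _; rewrite ?modnn ?modn_small //=; ring.
  by rewrite weight_epsM // A2m; move: (A_ 2) => x; clear; lia.
have [q2 aq2 mq2] : exists2 q, act q & mq q = 2 by apply: A_exists; rewrite A2.
have [/eqP|e4] := boolP (eps *+ 4 == 0).
  move/eqP; rewrite epsM_eq0 => /forall_inP d4.
  apply: two_power; first exact: (mq2_bound q2).
  by apply: (@C_prime_power 2 2) => // c; apply: C_exponent => q /d4.
have A3 : (3 * A_ 3 = 2 * m)%N.
  have : (weight (eps *+ 3) + 2 * A_ 2 + 3 * A_ 3 = 3 * A)%N.
    rewrite weight_eps !A_mk /A !big_distrr -!big_split /=; apply: eq_bigr => q aq.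
    have := mq_gt1 aq; case: (mq q) => [|[|[|[|x]]]] // _.
    - by rewrite -[(3 %% 2)%N]/1%N /=; ring.
    - by rewrite modnn /=; ring.
    - by rewrite modn_small //=; ring.
  by rewrite weight_epsM // A2 A2m; move: (A_ 3) => x; clear; lia.
have [q3 aq3 mq3] : exists2 q, act q & mq q = 3.
  by apply: A_exists; move: A3; case: (A_ 3) => // ; rewrite muln0 mulnS.
(* Otherwise 5 eps would weigh 2m as well, but the coordinates of orders 2 and 3 alone contribute m
   + 4m/3 to it. *)
have e6 : eps *+ 6 = 0.
  apply/eqP; apply: contraT => e6.
  have e5 : eps *+ 5 != 0 by rewrite epsM_eq0; apply/forall_inPn; exists q2; rewrite // mq2.
  have : (A_ 2 + 2 * A_ 3 <= weight (eps *+ 5))%N.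
    rewrite weight_eps !A_mk !big_distrr -!big_split /=; apply: leq_sum => q aq.
    have := mq_gt1 aq; case: (mq q) => [|[|[|[|x]]]] // _.
    - by rewrite -[(5 %% 2)%N]/1%N /= muln0 mul1n muln1 addn0.
    - by rewrite -[(5 %% 3)%N]/2%N /= add0n mul1n mulnC.
  rewrite weight_epsM // A2; move: A3; move: (A_ 3) => x; clear; lia.
have d6 q : act q -> (mq q %| 6)%N.
  by move/eqP: e6; rewrite epsM_eq0 => /forall_inP; apply.
have D2 : (\sum_(q | act q && (mq q == 2)) d q = 2)%N.
  by have /eqP := A_E (ltn0Sn 1); rewrite A2 mulnC eqn_pmul2l // => /eqP.
have D3 : (\sum_(q | act q && (mq q == 3)) d q = 2)%N.
  by have /eqP := A_E (ltn0Sn 2); rewrite A3 mulnC eqn_pmul2l // => /eqP.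
have c0k k : eps *+ k != 0 -> c0 *+ k != 0 by rewrite mulNrn oppr_eq0.
pose H k := [set c in C | c *+ k == 0].
have sH k : subcode (H k).
  split; first by apply/subsetP => c; rewrite inE => /andP[].
    by rewrite inE C_0 mul0rn eqxx.
  move=> x y; rewrite !inE => /andP[xC /eqP xk] /andP[yC /eqP yk].
  by rewrite C_B //= mulrnBl xk yk subrr.
have H2 : (#|H 2| <= 2)%N.
  rewrite -[X in (_ <= X)%N]mq2; apply: six_torsion => // c; rewrite inE => /andP[cC /eqP c2] cn0.
  by apply: (torsion_support E6 D3 _ aq2) c2 cn0 _; rewrite ?mq2 //; apply: c0k.
have H3 : (#|H 3| <= 3)%N.
  rewrite -[X in (_ <= X)%N]mq3; apply: six_torsion => // c; rewrite inE => /andP[cC /eqP c3] cn0.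
  by apply: (torsion_support E6 D2 _ aq3) c3 cn0 _; rewrite ?mq3 //; apply: c0k.
(* C embeds into the product of its 2-torsion and its 3-torsion by c -> (3c, 2c). *)
have C6 : (#|C| <= 6)%N.
  apply: leq_trans (leq_mul H2 H3); rewrite -cardsX.
  have injC : injective (fun c : V => (c *+ 3, c *+ 2)).
    have zE (z : V) : z = z *+ 3 - z *+ 2 by rewrite [z *+ 3]mulrS addrK.
    by move=> x y [h3 h2]; rewrite [x]zE [y]zE h3 h2.
  rewrite -(card_imset _ injC); apply/subset_leq_card/subsetP => _ /imsetP[c cC ->].
  have c6 : c *+ 6 = 0 by apply: C_exponent.
  by rewrite !inE /= !C_M //= -!mulrnA c6 eqxx.
suff C6' : (6 <= #|C|)%N by rewrite (eqP (_ : #|C| == 6)) // eqn_leq C6.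
have inj6 : injective (fun k : 'I_6 => eps *+ k).
  suff le (x y : 'I_6) : eps *+ x = eps *+ y -> (x <= y)%N -> x = y.
    move=> x y e; have [/(le x y e)//|/ltnW/(le y x (esym e))//] := leqP x y.
  move=> e xy; apply/val_inj/eqP; rewrite /= eqn_leq xy /=.
  have : eps *+ (y - x) == 0 by rewrite mulrnBr // e subrr.
  rewrite epsM_eq0 => /forall_inP h; rewrite -subn_eq0.
  have := h q2 aq2; have := h q3 aq3; rewrite mq2 mq3; have := ltn_ord y.
  by move: (nat_of_ord x) (nat_of_ord y) xy; clear; move=> x y; lia.
rewrite -[X in (X <= _)%N]card_ord -(card_imset _ inj6).
by apply/subset_leq_card/subsetP => _ /imsetP[k _ ->].
Qed.

End MoreThanTwo.

Theorem card_weighted_code : #|C| \in [:: 2; 3; 4; 6; 8; 9; 16]%N.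
Proof.
have [/eqP e|C2] := eqVneq #|C| 2; first by rewrite (eqP e).
rewrite in_cons; apply/orP; right; apply: card_code_gt2.
by rewrite ltn_neqAle eq_sym C2.
Qed.

End WeightedCodes.

(** * Unique factorization *)

Definition edvd (R : comNzRingType) (a b : R) : Prop := exists c, b = c * a.

Section Edvd.
Variable R : comNzRingType.
Implicit Types a b c : R.

Lemma edvdd a : edvd a a. Proof. by exists 1; rewrite mul1r. Qed.
Lemma edvd0 a : edvd a 0. Proof. by exists 0; rewrite mul0r. Qed.
Lemma edvd_mull a b c : edvd a b -> edvd a (c * b).
Proof. by case=> q ->; exists (c * q); rewrite mulrA. Qed.
Lemma edvd_mulr a b c : edvd a b -> edvd a (b * c).
Proof. by rewrite mulrC; apply: edvd_mull. Qed.
Lemma edvd_trans a b c : edvd a b -> edvd b c -> edvd a c.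
Proof. by move=> ? [q ->]; apply: edvd_mull. Qed.
Lemma edvdD a b c : edvd a b -> edvd a c -> edvd a (b + c).
Proof. by case=> q -> [r ->]; exists (q + r); rewrite mulrDl. Qed.
Lemma edvdN a b : edvd a b -> edvd a (- b).
Proof. by case=> q ->; exists (- q); rewrite mulNr. Qed.
Lemma edvdB a b c : edvd a b -> edvd a c -> edvd a (b - c).
Proof. by move=> ? /edvdN; apply: edvdD. Qed.
Lemma edvd_unit a b : edvd a 1 -> edvd a b.
Proof. by move=> ?; rewrite -[b]mulr1; apply: edvd_mull. Qed.
Lemma edvd1M a b : edvd a 1 -> edvd b 1 -> edvd (a * b) 1.
Proof. by move=> [c e] [d e']; exists (c * d); rewrite mulrACA -e -e' mulr1. Qed.

End Edvd.

Definition prime_elt (R : comNzRingType) (p : R) : Prop :=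
  [/\ p != 0, ~ edvd p 1
    & forall a b, edvd p (a * b) -> edvd p a \/ edvd p b].

(** The factors are required to be prime and not only irreducible, so that uniqueness is built
    in. *)
Definition factorial_ring (R : comNzRingType) : Prop :=
  forall a : R, a != 0 -> exists (u : R) (s : seq R),
    [/\ edvd u 1, forall p, p \in s -> prime_elt p & a = u * \prod_(p <- s) p].

Lemma prime_edvd_exp (R : comNzRingType) (p a : R) n :
  prime_elt p -> edvd p (a ^+ n) -> edvd p a.
Proof.
move=> [_ p1 pM]; elim: n => [|n IHn]; first by rewrite expr0.
by rewrite exprS => /pM[].
Qed.

Lemma prime_edvd_prod (R : comNzRingType) (p u : R) (s : seq R) :
  prime_elt p -> edvd u 1 -> edvd p (u * \prod_(q <- s) q) ->
  exists2 q, q \in s & edvd p q.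
Proof.
move=> [_ p1 pM] u1; elim: s => [|q s IHs]; rewrite ?big_nil ?big_cons.
  by rewrite mulr1 => /edvd_trans/(_ u1).
rewrite mulrCA => /pM[pq|/IHs[r rs pr]]; first by exists q; rewrite ?mem_head.
by exists r; rewrite // in_cons rs orbT.
Qed.

Lemma prime_assoc (R : idomainType) (p q : R) :
  prime_elt p -> prime_elt q -> edvd p q -> exists2 u, edvd u 1 & q = u * p.
Proof.
move=> [p0 p1 _] [q0 _ qM] [u e]; exists u => //.
have [|[c e']|[c e']] := qM u p; first by rewrite -e; apply: edvdd.
  case: p1; exists c; apply: (mulfI q0).
  by rewrite mulr1 [in LHS]e e'; ring.
exists c; apply: (mulIf p0); rewrite mul1r {1}e'.
by rewrite e -mulrA.
Qed.

Lemma edvd_prime (R : comNzRingType) (a : R) :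
  factorial_ring R -> a != 0 -> ~ edvd a 1 -> exists2 p, prime_elt p & edvd p a.
Proof.
move=> fR a0 a1; have [u [s [u1 sp e]]] := fR a a0.
case: s e sp => [|p s] e sp; first by case: a1; rewrite e big_nil mulr1.
exists p; first by apply: sp; rewrite mem_head.
by rewrite e big_cons mulrCA; exact/edvd_mulr/edvdd.
Qed.

(** * Gauss's lemma: polynomials over a factorial ring *)

Section Gauss.
Variable R : idomainType.
Hypothesis fR : factorial_ring R.

(** If p divides a * b, it divides the product of the leading coefficients, hence one of them.
    Removing that leading term keeps the divisibility and lowers the size. *)
Lemma prime_polyC (p : R) : prime_elt p -> prime_elt p%:P.
Proof.
case=> p0 p1 pM; split; first by rewrite polyC_eq0.
  case=> c /(congr1 (fun f : {poly R} => f`_0)).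
  by rewrite coefMC coef1 /= => e; case: p1; exists c`_0.
have pC (a : R) : edvd p a -> edvd p%:P a%:P.
  by case=> c ->; exists c%:P; rewrite polyCM.
have lcP (f : {poly R}) : edvd p%:P f -> edvd p (lead_coef f).
  by case=> c ->; exists (lead_coef c); rewrite lead_coefM lead_coefC.
have lcX (f : {poly R}) : edvd p (lead_coef f) -> f != 0 ->
    exists g : {poly R}, [/\ edvd p%:P (f - g), edvd p%:P g -> edvd p%:P f
      & (size g < size f)%N].
  move=> pf f0; exists (f - lead_coef f *: 'X^((size f).-1)).
  have pl : edvd p%:P (lead_coef f *: 'X^((size f).-1)).
    by rewrite -mul_polyC; apply/edvd_mulr/pC.
  split; first by rewrite opprB addrC addrNK.
    by move=> pg; rewrite -[f](subrK (lead_coef f *: 'X^((size f).-1))); apply: edvdD.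
  have s0 : (0 < size f)%N by rewrite size_poly_gt0.
  rewrite -(ltn_predK s0) ltnS; apply/leq_sizeP => j.
  rewrite coefB coefZ coefXn leq_eqVlt => /orP[/eqP<-|h].
    by rewrite eqxx mulr1 -lead_coefE subrr.
  rewrite gtn_eqF // mulr0 subr0 nth_default //.
  by rewrite -(ltn_predK s0).
move=> a b; have [n] := ubnP (size a + size b)%N.
elim: n => // n IHn in a b *; rewrite ltnS => sn pab.
have [->|a0] := eqVneq a 0; first by left; apply: edvd0.
have [->|b0] := eqVneq b 0; first by right; apply: edvd0.
have := lcP _ pab; rewrite lead_coefM => /pM[/lcX/(_ a0)|/lcX/(_ b0)] [g [pg gP sg]].
  have [||/gP|] := IHn g b; [ | | by left | by right].
    by apply: leq_trans sn; rewrite ltn_add2r.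
  have -> : g * b = a * b - (a - g) * b by ring.
  by apply: edvdB => //; apply: edvd_mulr.
have [|||/gP] := IHn a g; [ | | by left | by right].
  by apply: leq_trans sn; rewrite ltn_add2l.
have -> : a * g = a * b - a * (b - g) by ring.
by apply: edvdB => //; apply: edvd_mull.
Qed.

Let primitive (f : {poly R}) := forall p : R, prime_elt p -> ~ edvd p%:P f.

(** A prime constant dividing f divides its leading coefficient, so the number of prime factors of
    that coefficient bounds how many constants can be taken out. *)
Lemma content_primitive (f : {poly R}) :
  f != 0 -> exists (c : R) (g : {poly R}), [/\ c != 0, f = c%:P * g & primitive g].
Proof.
move=> f0; have lf0 : lead_coef f != 0 by rewrite lead_coef_eq0.
have [u [s [u1 sp e]]] := fR lf0.
have [n] := ubnP (size s); elim: n => // n IHn in f s u f0 lf0 u1 sp e *.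
rewrite ltnS => sn.
have [[p [pp [g fg]]]|nex] := pselect (exists p, prime_elt p /\ edvd p%:P f); last first.
  exists 1, f; rewrite oner_neq0 mul1r; split=> // p pp pf.
  by apply: nex; exists p.
have elc : lead_coef f = lead_coef g * p by rewrite fg lead_coefM lead_coefC.
have [q qs pq] : exists2 q, q \in s & edvd p q.
  by apply: prime_edvd_prod pp u1 _; rewrite -e elc; apply/edvd_mull/edvdd.
have [v v1 qv] := prime_assoc pp (sp q qs) pq.
have p0 : p != 0 by case: pp.
have g0 : g != 0 by apply: contraNneq f0 => g0; rewrite fg g0 mul0r.
have lg0 : lead_coef g != 0 by rewrite lead_coef_eq0.
have [|||c [h [c0 gh hp]]] := IHn g (rem q s) (u * v) g0 lg0 (edvd1M u1 v1).
- by move=> r /mem_rem; apply: sp.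
- apply: (mulIf p0); rewrite -elc e (perm_big _ (perm_to_rem qs)) big_cons /= qv.
  by ring.
- by rewrite size_rem //; case: (s) qs sn => //= ? ? _.
exists (c * p), h; split=> //; first by rewrite mulf_neq0.
by rewrite fg gh polyCM; ring.
Qed.

(** Each prime factor of c divides q * f but not f, so it divides q and can be cancelled. *)
Lemma primitive_cancel (f q h : {poly R}) (c : R) :
  primitive f -> c != 0 -> c%:P * h = q * f -> edvd f h.
Proof.
move=> pf c0; have [u [s [u1 sp ->]]] := fR c0; move: sp.
elim: s => [|p s IHs] in q *.
  move=> _; rewrite big_nil mulr1 => e; have [v ev] := u1.
  exists (v%:P * q); rewrite -mulrA -e mulrA -polyCM -ev.
  by rewrite mul1r.
move=> sp; rewrite big_cons => e.
have pp : prime_elt p by apply: sp; rewrite mem_head.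
have [_ _ pM] := prime_polyC pp.
have [|[q' q'E]|/(pf p pp)//] := pM q f.
  by rewrite -e mulrCA polyCM -mulrA; exists ((u * \prod_(j <- s) j)%:P * h); rewrite mulrC.
apply: (IHs q'); first by move=> r rs; apply: sp; rewrite in_cons rs orbT.
have p0 : p%:P != 0 by case: (prime_polyC pp).
apply: (mulfI p0); rewrite mulrA -polyCM mulrCA e q'E.
by ring.
Qed.

(** Over a domain [%|] is pseudo-division, that is, divisibility over the fraction field, where
    irreducible elements are prime. [primitive_cancel] brings the resulting divisibility back to
    R. *)
Lemma primitive_irreducible_prime (f : {poly R}) :
  primitive f -> irreducible_poly f -> prime_elt f.
Proof.
move=> pf [f1 fI].
have dvdE (a : {poly R}) : f %| a -> edvd f a.
  case/Pdiv.Idomain.dvdpP=> [[c q] /= c0 e].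
  by apply: (primitive_cancel pf c0 (q := q)); rewrite mul_polyC.
split.
- by apply: contraTneq f1 => ->; rewrite size_poly0.
- case=> c /(congr1 (fun g : {poly R} => size g)); rewrite size_poly1.
  have [->|c0] := eqVneq c 0; first by rewrite mul0r size_poly0.
  have f0 : f != 0 by apply: contraTneq f1 => ->; rewrite size_poly0.
  rewrite size_mul // => e; move: e f1; rewrite -size_poly_gt0 in c0.
  by move: c0; case: (size c) (size f) => [|i] [|[|j]] //; rewrite !addnS.
move=> a b [q e].
have fab : f %| a * b by rewrite e Pdiv.Idomain.dvdp_mull.
have [/dvdE|nfa] := boolP (f %| a); first by left.
right; apply: dvdE; rewrite -(Pdiv.Idomain.Gauss_dvdpr _ (q := a)) //.
rewrite Pdiv.CommonIdomain.coprimep_def; apply: contraR nfa => g1.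
have := fI _ g1 (Pdiv.Idomain.dvdp_gcdl f a).
by rewrite /eqp => /andP[_ /Pdiv.Idomain.dvdp_trans-> //]; rewrite Pdiv.Idomain.dvdp_gcdr.
Qed.

(** Induction on the size. The content factors in R; the primitive part is prime if irreducible, and
    otherwise [primitive_cancel] splits it into two factors of smaller size. *)
Lemma factorial_poly : factorial_ring {poly R}.
Proof.
have Fmul (a b : {poly R}) : (exists (u : {poly R}) s, [/\ edvd u 1,
      forall p, p \in s -> prime_elt p & a = u * \prod_(p <- s) p]) ->
    (exists (u : {poly R}) s, [/\ edvd u 1,
      forall p, p \in s -> prime_elt p & b = u * \prod_(p <- s) p]) ->
    exists (u : {poly R}) s, [/\ edvd u 1,
      forall p, p \in s -> prime_elt p & a * b = u * \prod_(p <- s) p].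
  move=> [u [s [u1 sp ->]]] [v [t [v1 tp ->]]]; exists (u * v), (s ++ t).
  split; first exact: edvd1M.
    by move=> p; rewrite mem_cat => /orP[/sp|/tp].
  by rewrite big_cat /=; ring.
have FC (c : R) : c != 0 -> exists (u : {poly R}) s, [/\ edvd u 1,
      forall p, p \in s -> prime_elt p & c%:P = u * \prod_(p <- s) p].
  move=> /fR[u [s [[v v1] sp ->]]]; exists u%:P, [seq p%:P | p <- s]; split.
  - by exists v%:P; rewrite -polyCM -v1.
  - by move=> p /mapP[q /sp/prime_polyC qp ->].
  - by rewrite polyCM rmorph_prod big_map.
move=> f f0; have [n] := ubnP (size f); elim: n => // n IHn in f f0 *.
rewrite ltnS => sn; have [c [g [c0 fg pg]]] := content_primitive f0.
rewrite fg; apply: (Fmul _ _); first exact: FC.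
have g0 : g != 0 by apply: contraNneq f0 => g0; rewrite fg g0 mulr0.
have sg : size g = size f by rewrite fg mul_polyC size_scale.
have [/eqP/size_poly1P[a a0 ->]|g1] := eqVneq (size g) 1%N; first exact: FC.
have [gI|] := pselect (irreducible_poly g).
  exists 1, [:: g]; rewrite big_seq1 mul1r; split=> //; first exact: edvdd.
  by move=> p; rewrite inE => /eqP->; apply: primitive_irreducible_prime.
move=> gI; have [q [q1 qg nqg]] : exists q : {poly R}, [/\ size q != 1%N, q %| g & ~~ (q %= g)].
  apply: contrapT => nq; apply: gI; split.
    by move: g1; have := size_poly_gt0 g; rewrite g0; lia.
  move=> q q1 qg; apply/negP => nqg; apply: nq; exists q; split=> //.
  exact/negP.
have q0 : q != 0 by apply: contraTneq qg => ->; rewrite Pdiv.Idomain.dvd0p.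
have [b [h [b0 qh ph]]] := content_primitive q0.
have sh : size h = size q by rewrite qh mul_polyC size_scale.
have [[a r] /= a0 agr] := Pdiv.Idomain.dvdpP _ _ qg.
have [|k gk] := @primitive_cancel h (b%:P * r) g a ph a0.
  by rewrite mul_polyC agr qh; ring.
have h0 : h != 0 by rewrite -size_poly_gt0 sh size_poly_gt0.
have k0 : k != 0 by apply: contraNneq g0 => k0; rewrite gk k0 mul0r.
have sgk : size g = (size k + size h).-1 by rewrite gk size_mul.
have sq : (size q < size g)%N.
  have := Pdiv.Idomain.dvdp_leq g0 qg; rewrite leq_eqVlt => /orP[|//].
  by rewrite -(Pdiv.Idomain.dvdp_size_eqp qg) in nqg; rewrite (negPf nqg).
have k1 : (0 < size k)%N by rewrite size_poly_gt0.
rewrite gk; apply: (Fmul _ _); apply: IHn => //.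
  apply: leq_trans sn; rewrite -sg sgk; move: q1 sh k1 q0; rewrite -size_poly_gt0.
  by case: (size q) => [|[|i]] // _ -> _ _; rewrite !addnS ltnS leq_addr.
by rewrite sh; apply: leq_trans sn; rewrite -sg.
Qed.

End Gauss.

(** * Multivariate polynomials, by induction on the number of variables *)

Lemma mpoly_rmorph_ext (n : nat) (R S : comNzRingType)
    (f g : {rmorphism {mpoly R[n]} -> S}) :
  (forall c, f c%:MP = g c%:MP) -> (forall i, f 'X_i = g 'X_i) -> f =1 g.
Proof.
move=> fgC fgX p; rewrite [p]mpolyE !rmorph_sum; apply: eq_bigr => m _.
rewrite -mul_mpolyC !rmorphM fgC /=; congr (_ * _).
rewrite mpolyXE_id !rmorph_prod; apply: eq_bigr => i _.
by rewrite !rmorphXn /= fgX.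
Qed.

Section Split.
Variables (n : nat) (R : comNzRingType).

Definition msplit_var (i : 'I_n.+1) : {poly {mpoly R[n]}} :=
  if unlift ord0 i is Some j then ('X_j)%:P else 'X.

Definition msplit (p : {mpoly R[n.+1]}) : {poly {mpoly R[n]}} :=
  mmap (polyC \o @mpolyC n R) msplit_var p.

HB.instance Definition _ := GRing.RMorphism.copy msplit
  (mmap (polyC \o @mpolyC n R) msplit_var).

Definition mliftX (p : {mpoly R[n]}) : {mpoly R[n.+1]} :=
  mmap (@mpolyC n.+1 R) (fun j => 'X_(lift ord0 j)) p.

HB.instance Definition _ := GRing.RMorphism.copy mliftX
  (mmap (@mpolyC n.+1 R) (fun j => 'X_(lift ord0 j))).

Definition mjoin (q : {poly {mpoly R[n]}}) : {mpoly R[n.+1]} :=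
  (horner_eval 'X_ord0 \o map_poly mliftX) q.

HB.instance Definition _ := GRing.RMorphism.copy mjoin
  (horner_eval ('X_ord0 : {mpoly R[n.+1]}) \o map_poly mliftX).

Lemma msplitC c : msplit c%:MP = c%:MP%:P.
Proof. by rewrite /msplit /= mmapC. Qed.

Lemma msplitX i : msplit 'X_i = msplit_var i.
Proof. by rewrite /msplit /= mmapX mmap1U. Qed.

Lemma mliftXC c : mliftX c%:MP = c%:MP.
Proof. exact: mmapC. Qed.

Lemma mliftXX i : mliftX 'X_i = 'X_(lift ord0 i).
Proof. by rewrite /mliftX /= mmapX mmap1U. Qed.

Lemma mjoinC c : mjoin c%:P = mliftX c.
Proof. by rewrite /mjoin /= /horner_eval map_polyC hornerC. Qed.

Lemma mjoinX : mjoin 'X = 'X_ord0.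
Proof. by rewrite /mjoin /= /horner_eval map_polyX hornerX. Qed.

Lemma msplitK : cancel msplit mjoin.
Proof.
have := @mpoly_rmorph_ext _ _ _ (mjoin \o msplit) idfun; apply => [c|i] /=.
  by rewrite msplitC mjoinC mliftXC.
rewrite msplitX /msplit_var; case: unliftP => [j|] ->; last exact: mjoinX.
by rewrite mjoinC mliftXX.
Qed.

Lemma mjoinK : cancel mjoin msplit.
Proof.
have liftK (c : {mpoly R[n]}) : msplit (mliftX c) = c%:P.
  have := @mpoly_rmorph_ext _ _ _ (msplit \o mliftX) polyC; apply => [a|i] /=.
    by rewrite mliftXC msplitC.
  by rewrite mliftXX msplitX /msplit_var liftK.
elim/poly_ind => [|p c IHp]; first by rewrite !rmorph0.
rewrite !rmorphD !rmorphM /= mjoinX mjoinC liftK IHp msplitX.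
by rewrite /msplit_var unlift_none.
Qed.

End Split.

Lemma meval_msplit (n : nat) (R : comNzRingType) (z : 'I_n -> R) (x : R)
    (p : {mpoly R[n.+1]}) :
  p.@[fun i => if unlift ord0 i is Some j then z j else x] =
    (map_poly (meval z) (msplit p)).[x].
Proof.
set g := fun i => _.
have := @mpoly_rmorph_ext _ _ _ (meval g)
  (horner_eval x \o map_poly (meval z) \o @msplit n R); apply => [c|i] /=.
  by rewrite mevalC msplitC map_polyC /horner_eval hornerC /= mevalC.
rewrite mevalXU msplitX /msplit_var /g /horner_eval.
by case: unliftP => [j _|_]; rewrite ?map_polyC ?map_polyX ?hornerC ?hornerX //= mevalXU.
Qed.

(** By induction there is a point z where the leading coefficient in the first variable survives;
    the polynomial in one variable obtained there has a nonroot. *)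
Lemma mpoly_neq0_meval (k : closedFieldType) (n : nat) (p : {mpoly k[n]}) :
  p != 0 -> exists z, p.@[z] != 0.
Proof.
elim: n p => [|n IHn] p p0.
  exists (fun=> 0); apply: contraNneq p0 => e.
  suff -> : p = (p.@[fun=> 0])%:MP by rewrite e.
  have := @mpoly_rmorph_ext _ _ _ idfun (@mpolyC 0 k \o meval (fun=> 0)).
  by apply => [c|[]//] /=; rewrite mevalC.
have : msplit p != 0 by rewrite -(inj_eq (can_inj (@mjoinK _ _))) msplitK rmorph0.
rewrite -lead_coef_eq0 => /IHn[z lz].
have q0 : map_poly (meval z) (msplit p) != 0.
  by apply: contraNneq lz => e; rewrite lead_coefE -coef_map e coef0.
have /closed_nonrootP[x rx] := q0.
by exists (fun i => if unlift ord0 i is Some j then z j else x); rewrite meval_msplit.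
Qed.

Lemma meval_eq0 (k : closedFieldType) (n : nat) (p : {mpoly k[n]}) :
  (forall z, p.@[z] = 0) -> p = 0.
Proof.
by move=> pz; apply/eqP/negP => /negP/mpoly_neq0_meval[z]; rewrite pz eqxx.
Qed.

Lemma factorial_ring_iso (R S : comNzRingType) (f : {rmorphism R -> S})
    (g : {rmorphism S -> R}) :
  cancel f g -> cancel g f -> factorial_ring R -> factorial_ring S.
Proof.
move=> fK gK fR a a0; have [|u [s [[v v1] sp e]]] := fR (g a).
  by apply: contraNneq a0 => ga0; rewrite -[a]gK ga0 rmorph0.
have fE x y : edvd (f x) y <-> edvd x (g y).
  split=> [[c ->]|[c /(congr1 f)]]; first by exists (g c); rewrite rmorphM fK.
  by rewrite gK rmorphM => ->; exists (f c).
exists (f u), [seq f p | p <- s]; split.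
- by exists (f v); rewrite -rmorphM -v1 rmorph1.
- move=> p /mapP[q /sp[q0 q1 qM] ->]; split.
  + by apply: contraNneq q0 => fq0; rewrite -[q]fK fq0 rmorph0.
  + by move/fE; rewrite rmorph1.
  + by move=> x y /fE; rewrite rmorphM => /qM[]; [left|right]; apply/fE.
- by rewrite big_map -rmorph_prod -rmorphM -e gK.
Qed.

Lemma factorial_mpoly (k : fieldType) (n : nat) : factorial_ring {mpoly k[n]}.
Proof.
elim: n => [|n IHn].
  move=> p p0; exists p, [::]; rewrite big_nil mulr1; split=> //.
  have pC : p = (p@_0)%:MP.
    have := @mpoly_rmorph_ext _ _ _ idfun (@mpolyC 0 k \o meval (fun=> 0)).
    move=> /(_ _ _ p) /= ->; rewrite ?mpolyCK //; first by move=> c; rewrite mevalC.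
    by case.
  exists (p@_0)^-1%:MP; rewrite [X in _ * X]pC -mpolyCM mulVf ?mpolyC1 //.
  by apply: contraNneq p0 => e; rewrite pC e mpolyC0.
have := @factorial_ring_iso _ _ (@mjoin n k) (@msplit n k).
apply; [exact: mjoinK | exact: msplitK |].
exact: factorial_poly.
Qed.

(** * Divisors of forms are forms *)

Section HomogDivisors.
Variables (n : nat) (R : idomainType).
Implicit Types p q : {mpoly R[n]}.

Lemma monomial_factor (S : idomainType) (p q : {poly S}) (c : S) d :
  c != 0 -> p * q = c *: 'X^d -> exists a b, p = a *: 'X^b.
Proof.
have X0 : 'X != 0 :> {poly S} by rewrite polyX_eq0.
move=> c0; elim: d p q => [|d IHd] p q.
  rewrite expr0 alg_polyC => e.
  have [p0 q0] : p != 0 /\ q != 0.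
    by split; apply: contraNneq c0 => e0; rewrite -polyC_eq0 -e e0 ?mulr0 ?mul0r.
  have : size (p * q) = 1%N by rewrite e size_polyC c0.
  rewrite size_mul // => s.
  have s1 : size p = 1%N.
    move: p0 q0 s; rewrite -!size_poly_gt0.
    by case: (size p) (size q) => [|[|i]] [|j] //; rewrite !addnS.
  have /eqP/size_poly1P[a a0 ->] := s1.
  by exists a, 0%N; rewrite expr0 alg_polyC.
move=> e; have : root (p * q) 0 by rewrite e rootE hornerZ hornerXn expr0n mulr0.
rewrite rootM => /orP[/factor_theorem[r]|/factor_theorem[r]]; rewrite subr0 => re.
  have [|a [b rab]] := IHd r q.
    by apply: (mulIf X0); rewrite mulrAC -re e exprSr scalerAl.
  by exists a, b.+1; rewrite re rab exprSr scalerAl.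
apply: (IHd p r); apply: (mulIf X0).
by rewrite -mulrA -re e exprSr scalerAl.
Qed.

(* [P(Y_i T)], whose coefficient of [T^d] is the degree [d] part of [P] *)
Definition grading (p : {mpoly R[n]}) : {poly {mpoly R[n]}} :=
  mmap (polyC \o @mpolyC n R) (fun i => ('X_i)%:P * 'X) p.

HB.instance Definition _ := GRing.RMorphism.copy grading
  (mmap (polyC \o @mpolyC n R) (fun i => ('X_i)%:P * 'X)).

Lemma gradingX (m : 'X_{1..n}) : grading 'X_[m] = 'X_[m] *: 'X^(mdeg m).
Proof.
rewrite /grading /= mmapX /mmap1 mpolyXE_id mdegE -mul_polyC rmorph_prod /=.
rewrite -prodrXr -big_split /=; apply: eq_bigr => i _.
by rewrite exprMn rmorphXn.
Qed.

Lemma coef_grading p d : (grading p)`_d = pihomog mdeg d p.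
Proof.
rewrite [in LHS](mpolyE p) rmorph_sum coef_sum pihomogE [RHS]big_mkcond.
apply: eq_bigr => m _ /=; rewrite -mul_mpolyC rmorphM /= gradingX.
rewrite {1}/grading /= mmapC /= coefCM coefZ coefXn eq_sym.
by case: eqP; rewrite ?mulr1 ?mulr0 ?mul_mpolyC.
Qed.

Lemma grading_homog p d : p \is d.-homog -> grading p = p *: 'X^d.
Proof.
move=> hp; apply/polyP => i; rewrite coef_grading coefZ coefXn.
have [->|id_] := eqVneq i d; first by rewrite mulr1 pihomog_dE.
by rewrite mulr0; apply: pihomog_ne0 hp; rewrite eq_sym.
Qed.

(** [grading] turns a form into a monomial in T, and a factor of a monomial is a monomial. *)
Lemma dhomog_factor p q d :
  p * q != 0 -> p * q \is d.-homog -> exists e, p \is e.-homog.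
Proof.
move=> pq0 /grading_homog; rewrite rmorphM => /(monomial_factor pq0)[a [b e]].
exists b; suff -> : p = pihomog mdeg b p by apply: pihomogP.
have := congr1 (fun r : {poly {mpoly R[n]}} => r.[1]) e.
have -> : (grading p).[1] = p.
  have := @mpoly_rmorph_ext n R _ (horner_eval 1 \o grading) idfun; apply.
    by move=> c /=; rewrite /grading /= mmapC /horner_eval /= hornerC.
  move=> i /=; rewrite /grading /= mmapX mmap1U /horner_eval.
  by rewrite hornerM hornerC hornerX mulr1.
rewrite hornerZ hornerXn expr1n mulr1 => pa.
by rewrite -coef_grading e coefZ coefXn eqxx mulr1.
Qed.

Lemma edvd_dhomog p q d : q != 0 -> q \is d.-homog -> edvd p q ->
  exists e, p \is e.-homog.
Proof. by move=> q0 hq [c e]; apply: (@dhomog_factor p c d); rewrite mulrC -e. Qed.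

End HomogDivisors.

(** * Local rings *)

Section Values.
Variables (k : closedFieldType) (X : projVariety k) (p : 'I_(ambient X).+1 -> k).
Hypothesis Xp : point p.
Local Notation K := (funField X).
Local Notation cstX := (@cst k X).
Local Notation evX := (mmap cstX (@Defs.coord k X)).

Lemma value_at_den d (G : {mpoly k[(ambient X).+1]}) :
  G \is d.-homog -> G.@[p] != 0 -> evX G != 0.
Proof.
move=> hG Gp; apply: contraNneq Gp => /(coord_vanish hG) e.
by apply/eqP; apply: e.
Qed.

(** Two fractions for the same element of K make the form F * G' - F' * G vanish on X, in particular
    at p. *)
Lemma value_at_uniq (f : K) (a b : k) : value_at p f a -> value_at p f b -> a = b.
Proof.
move=> [d [F [G [hF hG Gp -> ->]]]] [d' [F' [G' [hF' hG' Gp' e ->]]]].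
have G0 := value_at_den hG Gp; have G0' := value_at_den hG' Gp'.
apply/eqP; rewrite eqr_div // -subr_eq0; apply/eqP.
have hH : F * G' - F' * G \is (d + d').-homog.
  by rewrite [F' * G]mulrC rpredB ?dhomogM.
have /(coord_vanish hH)/(_ p Xp) : evX (F * G' - F' * G) = 0.
  by rewrite rmorphB !rmorphM /=; apply/eqP; rewrite subr_eq0 -eqr_div // e.
by rewrite rmorphB !rmorphM.
Qed.

Lemma value_atC c : value_at p (cstX c) c.
Proof.
exists 0, c%:MP, 1; rewrite dhomog1 -[c%:MP]mulr1 mul_mpolyC dhomogZ ?dhomog1 //.
rewrite mmapZ meval1 !rmorph1 mulr1 divr1 oner_neq0.
by split=> //; rewrite mevalZ meval1 divr1 mulr1.
Qed.

Lemma value_at0 : value_at p 0 0.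
Proof. by rewrite -[0 : K](rmorph0 cstX); apply: value_atC. Qed.

Lemma value_at1 : value_at p 1 1.
Proof. by rewrite -[1 : K](rmorph1 cstX); apply: value_atC. Qed.

Lemma value_atD (f g : K) (a b : k) :
  value_at p f a -> value_at p g b -> value_at p (f + g) (a + b).
Proof.
move=> [d [F [G [hF hG Gp -> ->]]]] [d' [F' [G' [hF' hG' Gp' -> ->]]]].
have G0 := value_at_den hG Gp; have G0' := value_at_den hG' Gp'.
exists (d + d')%N, (F * G' + F' * G), (G * G'); split.
- by rewrite [F' * G]mulrC rpredD ?dhomogM.
- exact: dhomogM.
- by rewrite mevalM mulf_neq0.
- by rewrite rmorphD !rmorphM addf_div.
- by rewrite mevalD !mevalM addf_div.
Qed.

Lemma value_atM (f g : K) (a b : k) :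
  value_at p f a -> value_at p g b -> value_at p (f * g) (a * b).
Proof.
move=> [d [F [G [hF hG Gp -> ->]]]] [d' [F' [G' [hF' hG' Gp' -> ->]]]].
exists (d + d')%N, (F * F'), (G * G'); split; try exact: dhomogM.
- by rewrite mevalM mulf_neq0.
- by rewrite !rmorphM mulf_div.
- by rewrite !mevalM mulf_div.
Qed.

Lemma value_atN (f : K) (a : k) : value_at p f a -> value_at p (- f) (- a).
Proof.
move=> fa; rewrite -mulN1r -[- a]mulN1r; apply: value_atM fa.
by rewrite -[-1 : K](rmorphN1 cstX); apply: value_atC.
Qed.

Lemma value_atB (f g : K) (a b : k) :
  value_at p f a -> value_at p g b -> value_at p (f - g) (a - b).
Proof. by move=> fa /value_atN; apply: value_atD. Qed.

Lemma value_atV (f : K) (a : k) : a != 0 -> value_at p f a -> value_at p f^-1 a^-1.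
Proof.
move=> a0 [d [F [G [hF hG Gp -> ea]]]]; rewrite ea in a0 *.
exists d, G, F; split=> //; rewrite ?invf_div //.
by apply: contraNneq a0 => ->; rewrite mul0r.
Qed.

Lemma value_at_div (f g : K) (a b : k) :
  b != 0 -> value_at p f a -> value_at p g b -> value_at p (f / g) (a / b).
Proof. by move=> b0 fa /(value_atV b0); apply: value_atM. Qed.

Lemma value_at_neq0 (f : K) (a : k) : a != 0 -> value_at p f a -> f != 0.
Proof.
move=> a0 fa; apply: contraNneq a0 => f0; rewrite f0 in fa.
by rewrite (value_at_uniq fa value_at0).
Qed.

Lemma value_at_sum (I : Type) (r : seq I) (P : pred I) (F : I -> K) (G : I -> k) :
  (forall i, P i -> value_at p (F i) (G i)) ->
  value_at p (\sum_(i <- r | P i) F i) (\sum_(i <- r | P i) G i).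
Proof.
move=> h; elim/big_rec2: _ => [|i a f Pi fa]; first exact: value_at0.
by apply: value_atD => //; apply: h.
Qed.

Lemma value_at_prod (I : Type) (r : seq I) (P : pred I) (F : I -> K) (G : I -> k) :
  (forall i, P i -> value_at p (F i) (G i)) ->
  value_at p (\prod_(i <- r | P i) F i) (\prod_(i <- r | P i) G i).
Proof.
move=> h; elim/big_rec2: _ => [|i a f Pi fa]; first exact: value_at1.
by apply: value_atM => //; apply: h.
Qed.

Lemma value_atX (f : K) (a : k) n : value_at p f a -> value_at p (f ^+ n) (a ^+ n).
Proof.
move=> fa; elim: n => [|n IHn]; first exact: value_at1.
by rewrite !exprS; apply: value_atM.
Qed.

Lemma value_at_mmap n (F : {mpoly k[n]}) (a : 'I_n -> K) (z : 'I_n -> k) :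
  (forall i, value_at p (a i) (z i)) -> value_at p (mmap cstX a F) F.@[z].
Proof.
move=> az; apply: value_at_sum => m _; apply: value_atM; first exact: value_atC.
by apply: value_at_prod => i _; apply: value_atX.
Qed.

Lemma value_at_det n (A : 'M[K]_n) (B : 'M[k]_n) :
  (forall i j, value_at p (A i j) (B i j)) -> value_at p (\det A) (\det B).
Proof.
move=> h; apply: value_at_sum => s _; apply: value_atM.
  by rewrite -(rmorph_sign cstX); apply: value_atC.
exact: value_at_prod.
Qed.

Lemma regular_atC c : regular_at p (cstX c).
Proof. by exists c; apply: value_atC. Qed.

Lemma regular_at0 : regular_at p (0 : K).
Proof. by exists 0; apply: value_at0. Qed.

Lemma regular_atD (f g : K) : regular_at p f -> regular_at p g -> regular_at p (f + g).
Proof. by move=> [a fa] [b gb]; exists (a + b); apply: value_atD. Qed.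

Lemma regular_atM (f g : K) : regular_at p f -> regular_at p g -> regular_at p (f * g).
Proof. by move=> [a fa] [b gb]; exists (a * b); apply: value_atM. Qed.

Lemma regular_atN (f : K) : regular_at p f -> regular_at p (- f).
Proof. by move=> [a fa]; exists (- a); apply: value_atN. Qed.

Lemma regular_atB (f g : K) : regular_at p f -> regular_at p g -> regular_at p (f - g).
Proof. by move=> ? /regular_atN; apply: regular_atD. Qed.

Lemma regular_atX (f : K) n : regular_at p f -> regular_at p (f ^+ n).
Proof. by move=> [a fa]; exists (a ^+ n); apply: value_atX. Qed.

Lemma regular_at_sum (I : Type) (r : seq I) (P : pred I) (F : I -> K) :
  (forall i, P i -> regular_at p (F i)) -> regular_at p (\sum_(i <- r | P i) F i).
Proof.
move=> h; elim/big_ind: _ => //; [exact: regular_at0 | exact: regular_atD].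
Qed.

Lemma regular_at_det n (A : 'M[K]_n) :
  (forall i j, regular_at p (A i j)) -> regular_at p (\det A).
Proof.
move=> h; pose B := \matrix_(i, j) sval (cid (h i j)).
exists (\det B); apply: value_at_det => i j; rewrite mxE.
exact: svalP (cid (h i j)).
Qed.

End Values.

(** * Kummer bases *)

Lemma rmorphism_of (R S : nzRingType) (f : R -> S) :
  {morph f : x y / x + y} -> {morph f : x y / x * y} -> f 1 = 1 ->
  exists g : {rmorphism R -> S}, g =1 f.
Proof.
move=> fD fM f1.
have f0 : f 0 = 0 by apply: (addrI (f 0)); rewrite -fD !addr0.
have fB : zmod_morphism f.
  move=> x y; apply/eqP; rewrite -(inj_eq (addIr (f y))) subrK -fD subrK.
  exact: eqxx.
have fMM : monoid_morphism f by split.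
pose g : {rmorphism R -> S} := HB.pack f (GRing.isZmodMorphism.Build R S f fB)
  (GRing.isMonoidMorphism.Build R S f fMM).
by exists g.
Qed.

Lemma roots_of_unity (k : closedFieldType) (e : nat) : [pchar k] =i pred0 ->
  (0 < e)%N -> exists2 rs : seq k, uniq rs & 'X^e - 1 = \prod_(x <- rs) ('X - x%:P).
Proof.
move=> k0 e0; have [rs rsE] := closed_field_poly_normal ('X^e - 1 : {poly k}).
have m : 'X^e - 1 \is @monic k by apply: monic_Xn_sub_1.
rewrite (monicP m) scale1r in rsE; exists rs => //.
rewrite -separable_prod_XsubC -rsE; apply: separable_Xn_sub_1.
by move/pcharf0P: k0 => ->; rewrite -lt0n.
Qed.

Section EigenBasis.
Variables (F : fieldType) (L : splittingFieldType F).
Local Notation G := ('Gal({:L} / 1))%g.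
Hypothesis abG : abelian G.
Variable rs : seq F.
Hypothesis rs_uniq : uniq rs.
Hypothesis rsE : 'X^#|G| - 1 = \prod_(x <- rs) ('X - x%:P).

Lemma galois_eigenbasis : exists (n : nat) (w : n.+1.-tuple L)
    (chi : 'I_n.+1 -> gal_of {:L} -> F),
  basis_of fullv w /\
    forall (g : gal_of {:L}) (i : 'I_n.+1), g \in G -> g w`_i = chi i g *: w`_i.
Proof.
have [n [b bb]] : exists n, exists b : n.+1.-tuple L, basis_of fullv b.
  move: (vbasis {:L}) (vbasisP {:L}); have := adim_gt0 {:L}%AS.
  by case: (\dim _) => // n _ b bb; exists n, b.
have bf := basis_free bb; have bs := basis_mem bb.
have in_b x : x = \sum_i coord b i x *: b`_i.
  exact: coord_basis bb (memvf x).
pose A (g : gal_of {:L}) : 'M[F]_n.+1 := \matrix_(i, j) coord b j (g b`_i).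
pose vec (u : 'rV[F]_n.+1) : L := \sum_i u 0 i *: b`_i.
have vecA (g : gal_of {:L}) u : g (vec u) = vec (u *m A g).
  rewrite /vec linear_sum; under eq_bigr do rewrite linearZ /= (in_b (g _)) scaler_sumr.
  rewrite exchange_big; apply: eq_bigr => j _ /=; rewrite mxE scaler_suml.
  by apply: eq_bigr => i _; rewrite mxE scalerA.
have vec_inj : injective vec.
  move=> u v e; apply/rowP => i; rewrite -(coord_sum_free (fun i => u 0 i) i bf).
  by rewrite -(coord_sum_free (fun i => v 0 i) i bf) -/(vec u) e.
have A_eq (B B' : 'M[F]_n.+1) : (forall u, vec (u *m B) = vec (u *m B')) -> B = B'.
  by move=> h; apply/row_matrixP => i; rewrite !rowE; apply/vec_inj/h.
have AM g h : A (g * h)%g = A g *m A h.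
  by apply: A_eq => u; rewrite mulmxA -!vecA galM ?memvf.
have A1 : A 1%g = 1%:M by apply: A_eq => u; rewrite mulmx1 -vecA gal_id.
have AX g e : A (g ^+ e)%g = A g ^+ e.
  by elim: e => [|e IHe]; rewrite ?expg0 // expgS exprS AM IHe.
have [P Pu /allP dP] : exists2 P : 'M[F]_n.+1, P \in unitmx &
    all [pred B | similar_diag P B] [seq A g | g in G].
  apply/codiagonalizableP; split=> [_ _ /imageP[g gG ->] /imageP[h hG ->]|].
    by rewrite /comm_mx -!AM (centsP abG).
  move=> _ /imageP[g gG ->]; apply/diagonalizableP; exists rs => //.
  rewrite -rsE; apply: mxminpoly_min.
  by rewrite rmorphB rmorph1 rmorphXn /= horner_mx_X -AX (eqP (_ : g ^+ _ == 1)%g)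
    ?A1 ?subrr // -order_dvdn order_dvdG.
have PA g (i : 'I_n.+1) : g \in G -> exists c, row i P *m A g = c *: row i P.
  move=> gG; have /diagonalizable_forPex[D] := dP _ (image_f A gG).
  move=> /(simmxP Pu) e; exists (D 0 i).
  by rewrite -row_mul e row_mul row_diag_mx -scalemxAl -rowE.
pose w := [tuple vec (row i P) | i < n.+1].
have wE (i : 'I_n.+1) : w`_i = vec (row i P) by rewrite nth_mktuple.
have /choice[chi chiE] : forall i : 'I_n.+1, exists chi : gal_of {:L} -> F,
    forall g : gal_of {:L}, g \in G -> g w`_i = chi g *: w`_i.
  move=> i; have /choice[chi h] : forall g : gal_of {:L}, exists c, g \in G -> g w`_i = c *: w`_i.
    move=> g; have [gG|] := boolP (g \in G); last by exists 0.
    have [c e] := PA g i gG; exists c => _; rewrite wE vecA e /vec scaler_sumr.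
    by apply: eq_bigr => j _; rewrite [in LHS]mxE scalerA.
  by exists chi => g; apply: h.
exists n, w, chi; split; last by move=> g i gG; apply: chiE.
have dn : \dim {:L} = n.+1 by rewrite -(span_basis bb) (eqP bf) size_tuple.
rewrite basisEfree subvf size_tuple dn leqnn !andbT.
apply/freeP => c e i; have cP : \row_i c i *m P = 0.
  apply: vec_inj; transitivity (0 : L); last first.
    by rewrite /vec big1 // => j _; rewrite mxE scale0r.
  rewrite -[RHS]e mulmx_sum_row /vec; under eq_bigr do rewrite summxE scaler_suml.
  rewrite exchange_big; apply: eq_bigr => l _; rewrite wE /vec scaler_sumr.
  by apply: eq_bigr => j _; rewrite !mxE scalerA.
have := congr1 (mulmx^~ (invmx P)) cP; rewrite /= mulmxK // mul0mx.
by move/rowP/(_ i); rewrite !mxE.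
Qed.

End EigenBasis.

Section KummerTransfer.
Variables (k : closedFieldType) (K : fieldType) (cst : {rmorphism k -> K}).
Hypothesis k_char0 : [pchar k] =i pred0.
Variables (F : fieldType) (L : splittingFieldType F) (j : {rmorphism L -> K}).
Hypothesis j_bij : bijective j.
Variable F0 : K -> Prop.
Hypothesis F0E : forall f, F0 f <-> exists a : F, f = j a%:A.
Hypothesis F0_cst : forall c, F0 (cst c).
Hypothesis gal_L : galois 1 {:L}.
Hypothesis ab_L : abelian ('Gal({:L} / 1))%g.
Local Notation G := ('Gal({:L} / 1))%g.

(** [galois_eigenbasis] carried over to K by [j]. The characters [lam i] are pairwise distinct: if
    two agreed, the quotient of their eigenvectors would be fixed, hence in F, against freeness.
    Orthogonality of distinct characters then gives the last clause, by which averaging isolates one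
    component. *)
Lemma kummer_basis : exists (gT : finGroupType) (A : {group gT})
    (sg : gT -> {rmorphism K -> K}) (n : nat) (v : 'I_n.+1 -> K)
    (lam : 'I_n.+1 -> gT -> k),
  [/\ n.+1 = \dim {:L}, forall i, v i != 0,
      forall g i, g \in A -> sg g (v i) = cst (lam i g) * v i,
      forall f, exists r, (forall i, F0 (r i)) /\ f = \sum_i r i * v i
    & forall r, (forall i, F0 (r i)) -> \sum_i r i * v i = 0 -> forall i, r i = 0] /\
  [/\ forall g f, F0 f -> sg g f = f,
      forall f, (forall g, g \in A -> sg g f = f) -> F0 f,
      (0 < #|A|)%N, forall i, F0 (v i ^+ #|A|)
    & forall r i, (forall i, F0 (r i)) ->
        \sum_(g in A) cst (lam i g)^-1 * sg g (\sum_i r i * v i) =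
          #|A|%:R * (r i * v i)].
Proof.
have [j' jK j'K] := j_bij.
have G0 : (0 < #|G|)%N by apply: cardG_gt0.
have [rsk rsk_uniq rskE] := roots_of_unity k_char0 G0.
have /choice[toF toFE] : forall c, exists a : F, cst c = j a%:A by move=> c; apply/F0E.
pose jF : {rmorphism F -> K} := j \o in_alg L.
have jZ (a : F) x : j (a *: x) = j a%:A * j x by rewrite -rmorphM mulr_algl.
have jFE a : jF a = j a%:A by [].
have rs_uniq : uniq (map toF rsk).
  rewrite map_inj_in_uniq // => a b _ _ e; apply: (fmorph_inj cst).
  by rewrite !toFE e.
have rsE : 'X^#|G| - 1 = \prod_(x <- map toF rsk) ('X - x%:P).
  apply: (map_poly_inj jF); rewrite rmorphB rmorphXn rmorph1 /= map_polyX.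
  have := congr1 (map_poly cst) rskE; rewrite rmorphB rmorphXn rmorph1 /= map_polyX => ->.
  rewrite big_map !rmorph_prod; apply: eq_bigr => x _ /=.
  by rewrite !rmorphB /= !map_polyX !map_polyC /= toFE.
have [n [w [chi [wb wchi]]]] := galois_eigenbasis ab_L rs_uniq rsE.
have wf := basis_free wb; have /freeP wP := wf.
have /choice[sg sgE] : forall g : gal_of {:L}, exists s : {rmorphism K -> K},
    forall x, s x = j (g (j' x)).
  move=> g; have j'D x y : j' (x + y) = j' x + j' y.
    by apply: (can_inj jK); rewrite rmorphD !j'K.
  have j'M x y : j' (x * y) = j' x * j' y.
    by apply: (can_inj jK); rewrite rmorphM !j'K.
  have j'1 : j' 1 = 1 by apply: (can_inj jK); rewrite rmorph1 j'K.
  apply: rmorphism_of => [x y|x y|]; rewrite ?j'D ?j'M ?j'1.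
  - by rewrite !rmorphD.
  - by rewrite !rmorphM.
  - by rewrite !rmorph1.
have sgF g f : F0 f -> sg g f = f.
  by move=> /F0E[a ->]; rewrite sgE jK linearZ /= rmorph1.
have w0 (i : 'I_n.+1) : w`_i != 0.
  by apply: (free_not0 wf); rewrite mem_nth ?size_tuple.
have sgM g h x : sg (g * h)%g x = sg h (sg g x).
  by rewrite !sgE jK galM ?memvf.
have chiM g h (i : 'I_n.+1) : g \in G -> h \in G -> chi i (g * h)%g = chi i g * chi i h.
  move=> gG hG; apply: (fmorph_inj (in_alg L)); apply: (mulIf (w0 i)).
  rewrite /= !mulr_algl -wchi ?groupM // galM ?memvf // wchi // linearZ /= wchi //.
  by rewrite scalerA.
have chi1 (i : 'I_n.+1) : chi i 1%g = 1.
  apply: (fmorph_inj (in_alg L)); apply: (mulIf (w0 i)).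
  by rewrite /= !mulr_algl -wchi ?group1 // gal_id scale1r.
have chiX g (i : 'I_n.+1) e : g \in G -> chi i (g ^+ e)%g = chi i g ^+ e.
  move=> gG; elim: e => [|e IHe]; first by rewrite expg0 chi1.
  by rewrite expgS exprS chiM ?groupX // IHe.
have chi_unity g (i : 'I_n.+1) : g \in G -> chi i g ^+ #|G| = 1.
  move=> gG; rewrite -chiX // (eqP (_ : g ^+ _ == 1)%g) ?chi1 //.
  by rewrite -order_dvdn order_dvdG.
have chi0 g (i : 'I_n.+1) : g \in G -> chi i g != 0.
  move=> gG; apply: contra_eq_neq (chi_unity g i gG) => ->.
  by rewrite expr0n -leqn0 leqNgt G0 eq_sym oner_neq0.
have /choice[lam lamE] : forall i, exists l : gal_of {:L} -> k,
    forall g, g \in G -> cst (l g) = j (chi i g)%:A.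
  move=> i; have /choice[l h] : forall g : gal_of {:L}, exists c,
      g \in G -> cst c = j (chi i g)%:A; last by exists l.
  move=> g; have [gG|] := boolP (g \in G); last by exists 0.
  have : root (\prod_(x <- rsk) ('X - (cst x)%:P)) (jF (chi i g)).
    have := congr1 (map_poly cst) rskE; rewrite rmorphB rmorphXn rmorph1 /= map_polyX.
    rewrite rmorph_prod; under [in X in _ = X -> _]eq_bigr do
      rewrite /= rmorphB /= map_polyX map_polyC.
    have u : j (chi i g)%:A ^+ #|G| = 1 by rewrite -jFE -rmorphXn chi_unity ?rmorph1.
    by move=> <-; rewrite rootE !hornerE ?hornerXn u subrr.
  rewrite -(big_map cst predT (fun x => 'X - x%:P)) root_prod_XsubC => /mapP[c _ e].
  by exists c => _; rewrite -e.
pose v (i : 'I_n.+1) := j w`_i.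
have v0 i : v i != 0 by rewrite fmorph_eq0.
have sgv g i : g \in G -> sg g (v i) = cst (lam i g) * v i.
  by move=> gG; rewrite sgE jK wchi // lamE // jZ.
have F0_r r : (forall i, F0 (r i)) -> exists a : 'I_n.+1 -> F, forall i, r i = j (a i)%:A.
  move=> h; have /choice[a aE] : forall i, exists x : F, r i = j x%:A.
    by move=> i; apply/F0E.
  by exists a.
exists (gal_of {:L}), [group of G], sg, n, v, lam; split; split=> //.
- by rewrite -(span_basis wb) (eqP wf) size_tuple.
- move=> f; exists (fun i => j (coord w i (j' f))%:A); split.
    by move=> i; apply/F0E; exists (coord w i (j' f)).
  rewrite -[LHS]j'K {1}(coord_basis wb (memvf (j' f))) rmorph_sum.
  by apply: eq_bigr => i _; rewrite jZ.
- move=> r /F0_r[a ra] e i; rewrite ra.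
  have -> : a i = 0; last by rewrite scale0r rmorph0.
  apply: wP; apply: (fmorph_inj j); rewrite rmorph0 -[RHS]e rmorph_sum.
  by apply: eq_bigr => l _; rewrite ra jZ.
- move=> f fix_f; have : j' f \in fixedField G.
    apply/fixedFieldP; rewrite ?memvf // => g gG.
    by apply: (can_inj jK); rewrite -sgE fix_f // j'K.
  rewrite (galois_fixedField gal_L) => /vlineP[a e]; apply/F0E; exists a.
  by rewrite -e j'K.
- move=> i; apply/F0E; have : w`_i ^+ #|G| \in fixedField G.
    apply/fixedFieldP; rewrite ?memvf // => g gG.
    by rewrite rmorphXn /= wchi // exprZn chi_unity // scale1r.
  rewrite (galois_fixedField gal_L) => /vlineP[a e]; exists a.
  by rewrite -e rmorphXn.
move=> r i rF.
pose S l := \sum_(g in G) lam l g / lam i g.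
transitivity (\sum_l r l * v l * cst (S l)).
  under eq_bigr do rewrite rmorph_sum mulr_sumr.
  rewrite exchange_big; apply: eq_bigr => l _ /=.
  rewrite /S rmorph_sum mulr_sumr; apply: eq_bigr => g gG.
  by rewrite rmorphM sgF // sgv // rmorphM /= mulrCA !mulrA; ring.
have lam0 l g : g \in G -> lam l g != 0.
  by move=> gG; rewrite -(fmorph_eq0 cst) lamE // !fmorph_eq0 scaler_eq0 oner_eq0 orbF chi0.
rewrite (bigD1 i) //= big1 ?addr0 => [|l li].
  have -> : S i = #|G|%:R.
    by rewrite /S (eq_bigr (fun=> 1)) ?sumr_const // => g gG; rewrite divff ?lam0.
  by rewrite rmorph_nat mulrC.
suff -> : S l = 0 by rewrite rmorph0 mulr0.
pose mu g := lam l g / lam i g.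
have muM g h : g \in G -> h \in G -> mu (g * h)%g = mu g * mu h.
  have lamM (q : 'I_n.+1) : g \in G -> h \in G -> lam q (g * h)%g = lam q g * lam q h.
    move=> gG hG; apply: (fmorph_inj cst); rewrite rmorphM !lamE ?groupM //.
    by rewrite chiM // -scalerA jZ.
  by move=> gG hG; rewrite /mu !lamM // invfM; ring.
have [h hG muh] : exists2 h, h \in G & mu h != 1.
  apply: contrapT => nh; have mu1 g : g \in G -> lam l g = lam i g.
    move=> gG; apply/eqP; rewrite -(inj_eq (mulIf (invr_neq0 (lam0 i g gG)))) divff ?lam0 //.
    by apply: contrapT => m; apply: nh; exists g => //; apply/negP.
  have : w`_l / w`_i \in fixedField G.
    apply/fixedFieldP; rewrite ?memvf // => g gG.
    have chiE : chi l g = chi i g.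
      by apply: (fmorph_inj jF); rewrite !jFE -!lamE // mu1.
    have c0 : in_alg L (chi i g) != 0 by rewrite fmorph_eq0 chi0.
    rewrite fmorph_div /= !wchi // chiE -[_ *: w`_l]mulr_algl -[_ *: w`_i]mulr_algl.
    by rewrite -mulf_div divff ?mul1r.
  rewrite (galois_fixedField gal_L) => /vlineP[a e].
  have lw : w`_l = a *: w`_i by rewrite -mulr_algl -e divfK.
  pose c (q : 'I_n.+1) : F := (q == l)%:R - a * (q == i)%:R.
  have := wP c; have -> : \sum_q c q *: w`_q = 0.
    rewrite /c; under eq_bigr do rewrite scalerBl -scalerA.
    rewrite sumrB (bigD1 l) //= eqxx scale1r big1 ?addr0 => [|q /negPf->]; last first.
      by rewrite scale0r.
    rewrite (bigD1 i) //= eqxx scale1r big1 ?addr0 => [|q /negPf->]; last first.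
      by rewrite scale0r scaler0.
    by rewrite lw subrr.
  move=> /(_ erefl l); rewrite /c eqxx (negPf li) mulr0 subr0.
  by move/eqP; rewrite oner_eq0.
have : (1 - mu h) * S l = 0.
  rewrite -[S l]/(\sum_(g in G) mu g).
  rewrite mulrBl mul1r mulr_sumr [X in X - _](reindex_inj (mulIg h)) /=.
  rewrite (eq_bigl (mem G)) => [|g]; last by rewrite /= groupMr.
  by rewrite -sumrB big1 // => g gG; rewrite muM // mulrC subrr.
by move/eqP; rewrite mulf_eq0 subr_eq0 eq_sym (negPf muh) /= => /eqP.
Qed.

End KummerTransfer.

(** With its converse, this makes the degree independent of the chosen model: a basis of L over F
    stays independent in L', because F and F' have the same image in K. *)
Lemma model_dim_le (K F F' : fieldType) (L : fieldExtType F) (L' : fieldExtType F')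
    (j : {rmorphism L -> K}) (j' : {rmorphism L' -> K}) :
  bijective j -> bijective j' ->
  (forall f, (exists a : F, f = j a%:A) <-> (exists a : F', f = j' a%:A)) ->
  (\dim {:L} <= \dim {:L'})%N.
Proof.
move=> [g gK Kg] [g' g'K Kg'] h.
have /basis_free/freeP bP := vbasisP {:L}%AS.
pose b' := map_tuple (g' \o j) (vbasis {:L}).
suff fb' : free b' by rewrite -[X in (X <= _)%N](size_tuple b') -(eqP fb') dimvS ?subvf.
apply/freeP => c e i.
have /choice[a aE] : forall l, exists a : F, j a%:A = j' (c l)%:A.
  by move=> l; have [|x ->] := (h (j' (c l)%:A)).2; [exists (c l) | exists x].
have a0 : a i = 0.
  apply: bP; apply: (fmorph_inj j); rewrite rmorph0 -(rmorph0 j') -e !rmorph_sum.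
  apply: eq_bigr => l _; rewrite -[a l *: _]mulr_algl -[c l *: _]mulr_algl !rmorphM.
  by rewrite -/(j (a l)%:A) aE (nth_map 0) ?size_tuple //= Kg'.
have := aE i; rewrite a0 scale0r rmorph0 => /esym/eqP.
by rewrite fmorph_eq0 scaler_eq0 oner_eq0 orbF => /eqP.
Qed.

(** * Homogeneous primes *)

Section HomogPrimes.
Variables (k : fieldType) (n : nat).
Local Notation S := {mpoly k[n]}.
Implicit Types P Q p : S.

Lemma dhomogM_inv P Q d : P * Q != 0 -> P * Q \is d.-homog ->
  exists i j, [/\ P \is i.-homog, Q \is j.-homog & (i + j)%N = d].
Proof.
move=> PQ0 hPQ; have [a hP] := dhomog_factor PQ0 hPQ.
have [b hQ] : exists j, Q \is j.-homog.
  by apply: (@dhomog_factor _ _ Q P d); rewrite mulrC.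
by exists a, b; split=> //; apply: dhomog_uniq PQ0 (dhomogM hP hQ) hPQ.
Qed.

Lemma dhomog0_const P : P \is 0.-homog -> P = (P@_0)%:MP.
Proof.
move=> hP; apply/mpolyP => m; rewrite mcoeffC.
have [->|m0] := eqVneq m 0%MM; first by rewrite mulr1.
by rewrite mulr0; apply: dhomog_nemf_coeff hP _; rewrite mdeg_eq0.
Qed.

Lemma mpolyC_dhomog (c : k) : c%:MP_[n] \is 0.-homog.
Proof. by rewrite -[c%:MP]mulr1 mul_mpolyC dhomogZ ?dhomog1. Qed.

Lemma mpolyC_unit (c : k) : c != 0 -> edvd (c%:MP_[n]) 1.
Proof. by move=> c0; exists (c^-1)%:MP; rewrite -mpolyCM mulVf. Qed.

Lemma edvd1_const P : edvd P 1 -> exists2 c, c != 0 & P = c%:MP.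
Proof.
case=> Q e; have PQ0 : Q * P != 0 by rewrite -e oner_neq0.
have [a [b [hQ hP]]] : exists i j, [/\ Q \is i.-homog, P \is j.-homog & (i + j)%N = 0%N].
  by apply: dhomogM_inv => //; rewrite -e dhomog1.
move/eqP; rewrite addn_eq0 => /andP[_ /eqP b0]; rewrite b0 in hP.
exists P@_0; last exact: dhomog0_const.
by apply: contraNneq PQ0 => P0; rewrite (dhomog0_const hP) P0 mpolyC0 mulr0.
Qed.

Definition hprime p := prime_elt p /\ exists d, p \is d.-homog.

Lemma hprime_neq0 p : hprime p -> p != 0. Proof. by case=> -[]. Qed.

Lemma hprime_deg p d : hprime p -> p \is d.-homog -> (0 < d)%N.
Proof.
move=> [[p0 p1 _] _] hp; rewrite lt0n; apply/eqP => d0; apply: p1.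
rewrite d0 in hp; rewrite (dhomog0_const hp); apply: mpolyC_unit.
by apply: contraNneq p0 => c0; rewrite (dhomog0_const hp) c0 mpolyC0.
Qed.

Lemma hprime_exists P d : P != 0 -> P \is d.-homog -> (0 < d)%N ->
  exists2 p, hprime p & edvd p P.
Proof.
move=> P0 hP d0; have [|p pp pP] := @edvd_prime _ P (@factorial_mpoly _ _) P0.
  move=> /edvd1_const[c c0 Pc]; rewrite Pc in hP P0.
  by rewrite (dhomog_uniq P0 hP (mpolyC_dhomog c)) in d0.
by exists p => //; split=> //; apply: edvd_dhomog hP pP.
Qed.

Lemma hprimeM p P Q : hprime p -> edvd p (P * Q) -> edvd p P \/ edvd p Q.
Proof. by case=> -[_ _ h] _; apply: h. Qed.

Lemma multP p P : hprime p -> P != 0 ->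
  exists e Q, P = p ^+ e * Q /\ ~ edvd p Q.
Proof.
move=> pp; have [m] := ubnP (msize P); elim: m => // m IHm in P *.
rewrite ltnS => sP P0; have [[Q PQ]|np] := pselect (edvd p P); last first.
  by exists 0, P; rewrite mul1r.
have Q0 : Q != 0 by apply: contraNneq P0 => Q0; rewrite PQ Q0 mul0r.
have p0 := hprime_neq0 pp.
have sp : (1 < msize p)%N.
  rewrite ltn_neqAle eq_sym lt0n msize_poly_eq0 p0 andbT.
  apply/negP => /msize_poly1P[c c0 pc]; case: pp => -[_ p1 _] _; apply: p1.
  by rewrite pc; apply: mpolyC_unit.
have [|//|e [Q' [QE nQ']]] := IHm Q.
  apply: leq_trans sP; rewrite PQ msizeM //.
  move: sp; case: (msize p) => [|[|s]] // _.
  by rewrite addnS /= addnS ltnS leq_addr.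
by exists e.+1, Q'; rewrite PQ QE exprS; split=> //; rewrite mulrC mulrA.
Qed.

(** The exponent of p in P, extracted from an existence statement and pinned down by [mult_uniq].
    The value 0 is a default where no decomposition exists, as for P = 0 and p prime. *)
Definition mult p P : nat :=
  if pselect (exists e Q, P = p ^+ e * Q /\ ~ edvd p Q) is left h
  then sval (cid h) else 0.

Lemma multE p P : hprime p -> P != 0 ->
  exists Q, P = p ^+ mult p P * Q /\ ~ edvd p Q.
Proof.
move=> pp P0; rewrite /mult; case: pselect => [h|[]]; last exact: multP.
by case: (cid h).
Qed.

Lemma mult_uniq p P Q e : hprime p -> P = p ^+ e * Q -> ~ edvd p Q -> mult p P = e.
Proof.
move=> pp PE nQ; have p0 := hprime_neq0 pp.
have P0 : P != 0.
  rewrite PE mulf_neq0 ?expf_neq0 //; apply/eqP => Q0; apply: nQ.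
  by rewrite Q0; apply: edvd0.
have [Q' [PE' nQ']] := multE pp P0; move: (mult p P) PE' => e' PE'.
have aux a b (A B : S) : p ^+ a * A = p ^+ b * B -> ~ edvd p B -> (a <= b)%N.
  move=> e1 nB; rewrite leqNgt; apply/negP => ba; apply: nB.
  move: e1; rewrite -(subnKC ba) addSn -addnS exprD -mulrA => /(mulfI (expf_neq0 _ p0)) <-.
  by rewrite exprS -mulrA; apply/edvd_mulr/edvdd.
by apply/eqP; rewrite eqn_leq (aux _ _ Q' Q) -?PE -?PE' // (aux _ _ Q Q') // -PE.
Qed.

Lemma multM p P Q : hprime p -> P != 0 -> Q != 0 ->
  mult p (P * Q) = (mult p P + mult p Q)%N.
Proof.
move=> pp /(multE pp)[P' [PE nP]] /(multE pp)[Q' [QE nQ]].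
apply: (@mult_uniq _ _ (P' * Q')) => //; last by case/(hprimeM pp).
by rewrite exprD mulrACA -PE -QE.
Qed.

Lemma mult1 p : hprime p -> mult p 1 = 0.
Proof.
by move=> pp; apply: (@mult_uniq _ _ 1); rewrite ?mulr1 //; case: pp => -[].
Qed.

Lemma multX p P e : hprime p -> P != 0 -> mult p (P ^+ e) = (e * mult p P)%N.
Proof.
move=> pp P0; elim: e => [|e IHe]; first by rewrite mult1.
by rewrite exprS multM ?expf_neq0 // IHe mulSn.
Qed.

Lemma mult_self p : hprime p -> mult p p = 1.
Proof.
by move=> pp; apply: (@mult_uniq _ _ 1); rewrite ?mulr1 //; case: pp => -[].
Qed.

Lemma mult_ge p P e : hprime p -> P != 0 -> (e <= mult p P)%N <-> edvd (p ^+ e) P.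
Proof.
move=> pp P0; split=> [h|[Q PQ]].
  have [Q [-> _]] := multE pp P0; rewrite -(subnKC h) exprD.
  by apply/edvd_mulr/edvd_mulr/edvdd.
have Q0 : Q != 0 by apply: contraNneq P0 => Q0; rewrite PQ Q0 mul0r.
have p0 := hprime_neq0 pp.
by rewrite PQ multM ?expf_neq0 // multX // mult_self // muln1 leq_addl.
Qed.

Lemma mult_gt0 p P : hprime p -> P != 0 -> (0 < mult p P)%N <-> edvd p P.
Proof. by move=> pp P0; rewrite -[edvd p P]/(edvd (p ^+ 1) P); apply: mult_ge. Qed.

Lemma mult_eq0 p P : hprime p -> P != 0 -> mult p P = 0 <-> ~ edvd p P.
Proof.
move=> pp P0; rewrite -mult_gt0 //.
by case: (mult p P) => [|e]; split=> // h; exfalso; apply: h.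
Qed.

(** Induction on the degree of Q: a homogeneous prime factor of Q divides P too, and cancelling it
    on both sides preserves the comparison. *)
Lemma edvd_mult P Q d e : P != 0 -> Q != 0 -> P \is d.-homog -> Q \is e.-homog ->
  (forall p, hprime p -> (mult p Q <= mult p P)%N) -> edvd Q P.
Proof.
move=> P0 Q0 hP; have [m] := ubnP e; elim: m => // m IHm in e P Q d P0 Q0 hP *.
rewrite ltnS => em hQ le; case: e => [|e] in em hQ *.
  rewrite (dhomog0_const hQ) in Q0 *; apply/edvd_unit/mpolyC_unit.
  by apply: contraNneq Q0 => ->; rewrite mpolyC0.
have [p pp pQ] := hprime_exists Q0 hQ (ltn0Sn e).
have pP : edvd p P.
  by apply/(mult_gt0 pp P0)/(leq_trans _ (le p pp))/(mult_gt0 pp Q0).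
case: pQ pP => Q1 QE [P1 PE]; have p0 := hprime_neq0 pp.
have P10 : P1 != 0 by apply: contraNneq P0 => e0; rewrite PE e0 mul0r.
have Q10 : Q1 != 0 by apply: contraNneq Q0 => e0; rewrite QE e0 mul0r.
have [||i [j [hP1 hp _]]] := @dhomogM_inv P1 p d; rewrite -?PE //.
have [||i' [j' [hQ1 hp' ij]]] := @dhomogM_inv Q1 p e.+1; rewrite -?QE //.
have j'0 := hprime_deg pp hp'.
have [|q qq|C CE] := IHm i' P1 Q1 i P10 Q10 hP1 _ hQ1.
- by apply: leq_trans em; rewrite -ij -addn1 leq_add2l.
- have := le q qq; rewrite PE QE !multM //.
  by rewrite leq_add2r.
- by exists C; rewrite PE QE CE mulrA.
Qed.

Lemma edvd_antisym P Q : P != 0 -> edvd P Q -> edvd Q P -> exists2 c, c != 0 & Q = c *: P.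
Proof.
move=> P0 [A QE] [B PE]; have : edvd A 1.
  exists B; apply: (mulIf P0); rewrite mul1r {1}PE QE; ring.
by case/edvd1_const => c c0 Ac; exists c; rewrite // QE Ac mul_mpolyC.
Qed.

End HomogPrimes.

(** * Forms evaluated at a generic point of projective space *)

Section Cone.
Variables (k : closedFieldType) (K : fieldType) (cst : {rmorphism k -> K}).
Variables (n : nat) (y : 'I_n.+1 -> K).
Local Notation S := {mpoly k[n.+1]}.
Local Notation ev := (mmap cst y).
Local Notation F0 := (homfrac cst y).
Implicit Types (P Q p : S) (f g : K) (t : 'I_n.+1).

(** Says that the rational map given by y is dominant onto projective space. *)
Definition generic_coord := forall d P, P \is d.-homog -> ev P = 0 -> P = 0.
Hypothesis y_generic : generic_coord.

Lemma ev_neq0 d P : P \is d.-homog -> P != 0 -> ev P != 0.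
Proof. by move=> hP; apply: contraNneq => /(y_generic hP)->. Qed.

Lemma ev_inj d P Q : P \is d.-homog -> Q \is d.-homog -> ev P = ev Q -> P = Q.
Proof.
move=> hP hQ e; apply/eqP; rewrite -subr_eq0; apply/eqP.
by apply: (@y_generic d); rewrite ?rpredB // rmorphB /= e subrr.
Qed.

Lemma evX t : ev 'X_t = y t. Proof. by rewrite mmapX mmap1U. Qed.

Lemma evC c : ev c%:MP = cst c. Proof. exact: mmapC. Qed.

Lemma dhomogXi t : ('X_t : S) \is 1.-homog.
Proof. by rewrite dhomogX /=; apply/eqP/mdeg1. Qed.

Lemma dhomogXin t e : ('X_t ^+ e : S) \is e.-homog.
Proof. by rewrite -{2}[e]mul1n dhomogMn ?dhomogXi. Qed.

Lemma Xi_neq0 t : 'X_t != 0 :> S.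
Proof. by rewrite -msize_poly_eq0 msizeX mdeg1. Qed.

Lemma coord_neq0 t : y t != 0.
Proof. by rewrite -evX (ev_neq0 (dhomogXi t)) ?Xi_neq0. Qed.

Lemma homfrac_intro d P Q : P \is d.-homog -> Q \is d.-homog -> Q != 0 -> F0 (ev P / ev Q).
Proof. by move=> hP hQ Q0; exists d, P, Q; split=> //; apply: ev_neq0 hQ Q0. Qed.

Lemma homfrac_den d Q : Q \is d.-homog -> ev Q != 0 -> Q != 0.
Proof. by move=> hQ; apply: contraNneq => ->; rewrite rmorph0. Qed.

Lemma homfracC c : F0 (cst c).
Proof.
by exists 0, c%:MP, 1; rewrite mpolyC_dhomog dhomog1 rmorph1 oner_neq0 divr1 evC.
Qed.

Lemma homfrac0 : F0 0. Proof. by rewrite -(rmorph0 cst); apply: homfracC. Qed.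
Lemma homfrac1 : F0 1. Proof. by rewrite -(rmorph1 cst); apply: homfracC. Qed.

Lemma homfracM f g : F0 f -> F0 g -> F0 (f * g).
Proof.
move=> [d [P [Q [hP hQ Q0 ->]]]] [d' [P' [Q' [hP' hQ' Q0' ->]]]].
exists (d + d')%N, (P * P'), (Q * Q').
by rewrite !dhomogM // !rmorphM mulf_neq0 // mulf_div.
Qed.

Lemma homfracD f g : F0 f -> F0 g -> F0 (f + g).
Proof.
move=> [d [P [Q [hP hQ Q0 ->]]]] [d' [P' [Q' [hP' hQ' Q0' ->]]]].
exists (d + d')%N, (P * Q' + P' * Q), (Q * Q').
by rewrite rmorphD !rmorphM mulf_neq0 // addf_div // [P' * Q]mulrC rpredD ?dhomogM.
Qed.

Lemma homfracN f : F0 f -> F0 (- f).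
Proof.
by move=> h; rewrite -mulN1r -(rmorphN1 cst); apply: homfracM h; apply: homfracC.
Qed.

Lemma homfracV f : F0 f -> F0 f^-1.
Proof.
move=> [d [P [Q [hP hQ Q0 ->]]]]; have [P0|P0] := eqVneq (ev P) 0.
  by rewrite P0 mul0r invr0; apply: homfrac0.
by exists d, Q, P; rewrite invf_div.
Qed.

Lemma homfrac_div f g : F0 f -> F0 g -> F0 (f / g).
Proof. by move=> h /homfracV; apply: homfracM. Qed.

Lemma homfracX f e : F0 f -> F0 (f ^+ e).
Proof.
move=> h; elim: e => [|e IHe]; first exact: homfrac1.
by rewrite exprS; apply: homfracM.
Qed.

Lemma homfrac_coord s t : F0 (y s / y t).
Proof.
by rewrite -!evX; apply: homfrac_intro (dhomogXi s) (dhomogXi t) (Xi_neq0 t).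
Qed.

Lemma homfrac_reduced f : F0 f -> exists d N Q,
  [/\ N \is d.-homog, Q \is d.-homog, Q != 0, f = ev N / ev Q
    & forall p, hprime p -> edvd p Q -> ~ edvd p N].
Proof.
move=> [d [P [Q [hP hQ /(homfrac_den hQ) Q0 ->]]]].
have [m] := ubnP d; elim: m => // m IHm in d P Q hP hQ Q0 *.
rewrite ltnS => dm; have [[p [pp [pQ pP]]]|np] :=
  pselect (exists p, hprime p /\ (edvd p Q /\ edvd p P)); last first.
  exists d, P, Q; split=> // p pp pQ pP; apply: np.
  by exists p.
case: pQ pP => Q1 QE [P1 PE]; have p0 := hprime_neq0 pp.
have Q10 : Q1 != 0 by apply: contraNneq Q0 => e0; rewrite QE e0 mul0r.
have [||i [j [hQ1 hp ij]]] := @dhomogM_inv _ _ Q1 p d; rewrite -?QE //.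
have hP1 : P1 \is i.-homog.
  have [P10|P10] := eqVneq P1 0; first by rewrite P10 rpred0.
  have [||i' [j' [hP1 hp' ij']]] := @dhomogM_inv _ _ P1 p d; rewrite -?PE //.
    by rewrite PE mulf_neq0.
  have jj := dhomog_uniq p0 hp hp'.
  by move: ij'; rewrite -ij jj => /addIn <-.
have [|d' [N' [Q' [h1 h2 h3 e h4]]]] := IHm i P1 Q1 hP1 hQ1 Q10.
  by apply: leq_trans dm; rewrite -ij -addn1 leq_add2l (hprime_deg pp hp).
exists d', N', Q'; split=> //; rewrite -e PE QE !rmorphM -mulf_div divff ?mulr1 //.
exact: ev_neq0 hp p0.
Qed.

(* The local ring of the generic point of the hypersurface [p = 0]. *)
Definition vint p f : Prop := exists d P Q,
  [/\ P \is d.-homog, Q \is d.-homog, ~ edvd p Q & f = ev P / ev Q].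

Lemma vint_den p d Q : Q \is d.-homog -> ~ edvd p Q -> ev Q != 0.
Proof.
move=> hQ pQ; apply: ev_neq0 hQ _; apply/eqP => Q0; apply: pQ.
by rewrite Q0; apply: edvd0.
Qed.

Section Vint.
Variable p : S.
Hypothesis pp : hprime p.

Lemma vintC c : vint p (cst c).
Proof.
exists 0, c%:MP, 1; rewrite mpolyC_dhomog dhomog1 rmorph1 divr1 evC.
by split=> //; case: pp => -[].
Qed.

Lemma vint0 : vint p 0. Proof. by rewrite -(rmorph0 cst); apply: vintC. Qed.

Lemma vintM f g : vint p f -> vint p g -> vint p (f * g).
Proof.
move=> [d [P [Q [hP hQ Q0 ->]]]] [d' [P' [Q' [hP' hQ' Q0' ->]]]].
exists (d + d')%N, (P * P'), (Q * Q').
rewrite !dhomogM // !rmorphM mulf_div; split=> //.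
by case/(hprimeM pp).
Qed.

Lemma vintD f g : vint p f -> vint p g -> vint p (f + g).
Proof.
move=> [d [P [Q [hP hQ Q0 ->]]]] [d' [P' [Q' [hP' hQ' Q0' ->]]]].
exists (d + d')%N, (P * Q' + P' * Q), (Q * Q').
have e := vint_den hQ Q0; have e' := vint_den hQ' Q0'.
rewrite rmorphD !rmorphM addf_div // [P' * Q]mulrC rpredD ?dhomogM //; split=> //.
by case/(hprimeM pp).
Qed.

Lemma vintN f : vint p f -> vint p (- f).
Proof. by move=> h; rewrite -mulN1r -(rmorphN1 cst); apply: vintM h; apply: vintC. Qed.

Lemma vintB f g : vint p f -> vint p g -> vint p (f - g).
Proof. by move=> ? /vintN; apply: vintD. Qed.

Lemma vintX f e : vint p f -> vint p (f ^+ e).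
Proof.
move=> h; elim: e => [|e IHe]; last by rewrite exprS; apply: vintM.
by rewrite expr0 -(rmorph1 cst); apply: vintC.
Qed.

Lemma vint_sum (I : Type) (r : seq I) (A : pred I) (F : I -> K) :
  (forall i, A i -> vint p (F i)) -> vint p (\sum_(i <- r | A i) F i).
Proof. by move=> h; elim/big_ind: _ => //; [exact: vint0 | exact: vintD]. Qed.

Lemma vint_not_edvd d N Q : N \is d.-homog -> Q \is d.-homog -> Q != 0 ->
  edvd p Q -> vint p (ev N / ev Q) -> edvd p N.
Proof.
move=> hN hQ Q0 pQ [e [P [R [hP hR nR /eqP]]]].
rewrite eqr_div; [|exact: ev_neq0 hQ Q0|exact: vint_den hR nR].
rewrite -!rmorphM => /eqP/(ev_inj (d := (d + e)%N)) NR.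
have {}NR : N * R = P * Q by apply: NR; [apply: dhomogM | rewrite mulrC dhomogM].
have : edvd p (N * R) by rewrite NR; apply: edvd_mull.
by case/(hprimeM pp).
Qed.

End Vint.

(* Coordinate ring of the chart [Y_t <> 0]. *)
Definition polyring t f : Prop := exists d P, P \is d.-homog /\ f = ev P / y t ^+ d.

Section PolyRing.
Variable t : 'I_n.+1.

Lemma polyring_homfrac f : polyring t f -> F0 f.
Proof.
move=> [d [P [hP ->]]]; rewrite -evX -rmorphXn.
by apply: homfrac_intro hP (dhomogXin t d) _; rewrite expf_neq0 ?Xi_neq0.
Qed.

Lemma polyringC c : polyring t (cst c).
Proof. by exists 0, c%:MP; rewrite mpolyC_dhomog evC divr1. Qed.

Lemma polyring0 : polyring t 0. Proof. by rewrite -(rmorph0 cst); apply: polyringC. Qed.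
Lemma polyring1 : polyring t 1. Proof. by rewrite -(rmorph1 cst); apply: polyringC. Qed.

Lemma polyringM f g : polyring t f -> polyring t g -> polyring t (f * g).
Proof.
move=> [d [P [hP ->]]] [d' [P' [hP' ->]]]; exists (d + d')%N, (P * P').
by rewrite dhomogM // rmorphM mulf_div exprD.
Qed.

Lemma polyringD f g : polyring t f -> polyring t g -> polyring t (f + g).
Proof.
move=> [d [P [hP ->]]] [d' [P' [hP' ->]]].
exists (d + d')%N, (P * 'X_t ^+ d' + P' * 'X_t ^+ d); split.
  by rewrite [P' * _]mulrC rpredD ?dhomogM ?dhomogXin.
by rewrite rmorphD !rmorphM !rmorphXn /= evX exprD addf_div ?expf_neq0 ?coord_neq0.
Qed.

Lemma polyringN f : polyring t f -> polyring t (- f).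
Proof.
by move=> h; rewrite -mulN1r -(rmorphN1 cst); apply: polyringM h; apply: polyringC.
Qed.

Lemma polyringB f g : polyring t f -> polyring t g -> polyring t (f - g).
Proof. by move=> ? /polyringN; apply: polyringD. Qed.

Lemma polyring_vint p f : hprime p -> ~ edvd p 'X_t -> polyring t f -> vint p f.
Proof.
move=> pp nX [d [P [hP ->]]]; exists d, P, ('X_t ^+ d); rewrite dhomogXin.
rewrite rmorphXn /= evX; split=> //; case: pp => pp _.
by move/(prime_edvd_exp pp).
Qed.

Lemma power_of_coord d Q : Q != 0 -> Q \is d.-homog ->
  (forall p, hprime p -> edvd p Q -> edvd p 'X_t) ->
  exists2 c, c != 0 & Q = c *: 'X_t ^+ d.
Proof.
elim: d Q => [|d IHd] Q Q0 hQ h.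
  rewrite (dhomog0_const hQ) in Q0 *; exists Q@_0; last by rewrite expr0 alg_mpolyC.
  by apply: contraNneq Q0 => ->; rewrite mpolyC0.
have [p pp pQ] := hprime_exists Q0 hQ (ltn0Sn d).
have [C XE] := h p pp pQ; have X0 := Xi_neq0 t.
have [||i [j [hC hp ij]]] := @dhomogM_inv _ _ C p 1; rewrite -?XE ?dhomogXi //.
have j0 := hprime_deg pp hp; have i0 : i = 0%N by move: ij j0; clear; lia.
rewrite i0 in hC; have cC := dhomog0_const hC.
have c0 : C@_0 != 0.
  by apply: contraNneq X0 => e; rewrite XE cC e mpolyC0 mul0r.
have [R QE] : edvd 'X_t Q.
  case: pQ => R ->; exists ((C@_0)^-1 *: R); rewrite XE {2}cC mul_mpolyC.
  by rewrite -scalerAr -scalerAl scalerA divff // scale1r.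
have R0 : R != 0 by apply: contraNneq Q0 => e; rewrite QE e mul0r.
have [||a [b [hR hX ab]]] := @dhomogM_inv _ _ R 'X_t d.+1; rewrite -?QE //.
have b1 := dhomog_uniq X0 hX (dhomogXi t).
move: ab; rewrite b1 addn1 => -[ad]; rewrite ad in hR.
have [q qq qR|c c1 RE] := IHd R R0 hR; first by apply: h; rewrite // QE; apply: edvd_mulr.
by exists c; rewrite // QE RE exprSr scalerAl.
Qed.

(** A rational function without poles along the hypersurfaces meeting the chart is regular on it: a
    reduced denominator can only have prime factors that divide X_t. *)
Lemma vint_polyring f : F0 f ->
  (forall p, hprime p -> ~ edvd p 'X_t -> vint p f) -> polyring t f.
Proof.
move=> /homfrac_reduced[d [N [Q [hN hQ Q0 -> red]]]] h.
have [p pp pQ|c c0 QE] := power_of_coord Q0 hQ.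
  apply: contrapT => nX; apply: (red p pp pQ).
  exact: (vint_not_edvd pp hN hQ Q0 pQ (h p pp nX)).
exists d, (c^-1 *: N); rewrite dhomogZ // mmapZ QE mmapZ rmorphXn /= evX fmorphV.
by split=> //; rewrite invfM; ring.
Qed.

End PolyRing.

Section PowerFree.
Variable m : nat.
Hypothesis m_gt0 : (0 < m)%N.

(** On the cover, w behaves like a form of degree l: its m-th power is a form of degree m l from
    which no m-th power of a prime can be extracted. *)
Definition power_free_form (l : nat) P (w : K) :=
  [/\ P \is (m * l).-homog, P != 0, w != 0, w ^+ m = ev P
    & forall p, hprime p -> (mult p P < m)%N].

(** Multiplying v by the denominator of v^m turns that power into a form of degree divisible by m.
    As long as p^m divides the form, w is replaced by w / p and l drops by the degree of p. *)
Lemma power_free_root v : v != 0 -> F0 (v ^+ m) ->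
  exists l P w, power_free_form l P w /\ forall t, F0 (w / y t ^+ l / v).
Proof.
move=> v0 [d [N [Q [hN hQ Q0 e]]]].
have [l [P [w [hP P0 w0 wm wv]]]] : exists l P w, [/\ P \is (m * l).-homog, P != 0,
    w != 0, w ^+ m = ev P & forall t, F0 (w / y t ^+ l / v)].
  have Q1 := homfrac_den hQ Q0; exists d, (N * Q ^+ m.-1), (v * ev Q); split.
  - by rewrite -(prednK m_gt0) mulSn dhomogM // mulnC dhomogMn.
  - rewrite mulf_neq0 ?expf_neq0 //; apply: contraNneq (expf_neq0 m v0) => N0.
    by rewrite e N0 rmorph0 mul0r.
  - by rewrite mulf_neq0.
  - by rewrite exprMn e rmorphM rmorphXn -{1}(prednK m_gt0) exprS mulrA divfK.
  - move=> t; have -> : v * ev Q / y t ^+ d / v = ev Q / y t ^+ d.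
      by rewrite -mulrA -invfM [v * _]mulrC -mulf_div divff ?mulr1.
    by apply: (@polyring_homfrac t); exists d, Q.
have [b] := ubnP l; elim: b => // b IHb in l P w hP P0 w0 wm wv *.
rewrite ltnS => lb; have [pf|/existsNP[p /not_implyP[pp]]] :=
  pselect (forall p, hprime p -> (mult p P < m)%N).
  by exists l, P, w.
move/negP; rewrite -leqNgt => /(mult_ge _ pp P0)[R PE].
have p0 := hprime_neq0 pp; have [_ [a hp]] := pp; have a0 := hprime_deg pp hp.
have R0 : R != 0 by apply: contraNneq P0 => R0; rewrite PE R0 mul0r.
have [||i [j [hR hpm ij]]] := @dhomogM_inv _ _ R (p ^+ m) (m * l)%N; rewrite -?PE //.
have jE : j = (m * a)%N by apply: dhomog_uniq hpm _; rewrite ?expf_neq0 // mulnC dhomogMn.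
have al : (a <= l)%N by rewrite -(leq_pmul2l m_gt0) -ij jE leq_addl.
have iE : i = (m * (l - a))%N by rewrite mulnBr -ij jE addnK.
have ep0 := ev_neq0 hp p0.
apply: (IHb (l - a)%N R (w / ev p)) => //.
- by rewrite -iE.
- by rewrite mulf_neq0 ?invr_neq0.
- by rewrite expr_div_n wm PE rmorphM rmorphXn mulfK // expf_neq0.
- move=> t; have -> : w / ev p / y t ^+ (l - a) / v = (w / y t ^+ l / v) / (ev p / y t ^+ a).
    rewrite -{2}(subnK al) exprD; have := coord_neq0 t => yt0.
    have ya := expf_neq0 a yt0; have yl := expf_neq0 (l - a)%N yt0.
    by field; rewrite ya yl ep0 v0.
  by apply: homfrac_div => //; apply: (@polyring_homfrac t); exists a, p.
- by apply: leq_trans lb; rewrite ltn_subrL a0 (leq_trans a0 al).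
Qed.

(** The ratio is A / B for forms with P * B^m = A^m * P'. As P' has exponents below m, at each prime
    m times the exponent of B is less than m times one more than the exponent of A. Hence B divides
    A. *)
Lemma power_free_quot t l l' P P' w w' :
  P \is (m * l).-homog -> P != 0 -> w != 0 -> w ^+ m = ev P ->
  power_free_form l' P' w' -> F0 (w / y t ^+ l / (w' / y t ^+ l')) ->
  exists C e, [/\ C \is e.-homog, C != 0, (l = e + l')%N, w = ev C * w'
    & P = C ^+ m * P'].
Proof.
move=> hP P0 w0 wm [hP' P0' w0' wm' pf] /homfrac_reduced[d [N [Q [hN hQ Q0 e red]]]].
have X0 := Xi_neq0 t; have yt0 := coord_neq0 t.
have ya := expf_neq0 l yt0; have yb := expf_neq0 l' yt0.
have eQ := ev_neq0 hQ Q0.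
pose A := N * 'X_t ^+ l; pose B := Q * 'X_t ^+ l'.
have eAB : w * ev B = ev A * w'.
  rewrite /A /B !rmorphM !rmorphXn /= !evX.
  have := congr1 (fun f => f * ev Q * (w' / y t ^+ l') * (y t ^+ l * y t ^+ l')) e => /=.
  rewrite divfK // ?mulf_neq0 ?invr_neq0 //; move=> e'.
  transitivity (w / y t ^+ l / (w' / y t ^+ l') * ev Q * (w' / y t ^+ l') * (y t ^+ l * y t ^+ l')).
    by field; rewrite ya yb w0'.
  by rewrite e'; field; rewrite yb.
have B0 : B != 0 by rewrite mulf_neq0 ?expf_neq0.
have hA : A \is (d + l).-homog by rewrite dhomogM ?dhomogXin.
have hB : B \is (d + l').-homog by rewrite dhomogM ?dhomogXin.
have eB := ev_neq0 hB B0.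
have A0 : A != 0.
  apply: contraNneq (mulf_neq0 w0 eB) => A0.
  by rewrite eAB A0 rmorph0 mul0r.
have PAB : P * B ^+ m = A ^+ m * P'.
  apply: (@ev_inj (m * l + (d + l') * m)%N); first by rewrite dhomogM ?dhomogMn.
    have -> : (m * l + (d + l') * m = (d + l) * m + m * l')%N by ring.
    by rewrite dhomogM ?dhomogMn.
  by rewrite !rmorphM !rmorphXn /= -wm -wm' -!exprMn eAB.
clearbody A B; have [p pp|C AE] := @edvd_mult _ _ A B _ _ A0 B0 hA hB.
  have := congr1 (mult p) PAB; rewrite !multM ?multX ?expf_neq0 // => eq_m.
  rewrite -ltnS -(ltn_pmul2l m_gt0) mulnS.
  apply: leq_ltn_trans (leq_addl (mult p P) _) _; rewrite eq_m addnC.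
  by rewrite ltn_add2r pf.
have C0 : C != 0 by apply: contraNneq A0 => C0; rewrite AE C0 mul0r.
have [||e1 [e2 [hC hB' e12]]] := @dhomogM_inv _ _ C B (d + l)%N; rewrite -?AE //.
have e2E := dhomog_uniq B0 hB' hB; exists C, e1; split=> //.
- by apply/(@addnI d); rewrite -e12 e2E; ring.
- by apply: (mulIf eB); rewrite eAB AE rmorphM mulrAC.
- apply: (mulIf (expf_neq0 m B0)); rewrite PAB AE exprMn; ring.
Qed.

End PowerFree.
End Cone.

Lemma mmap_scale (k : closedFieldType) (K : fieldType) (cst : {rmorphism k -> K})
    (n : nat) (y : 'I_n -> K) (a : K) (d : nat) (P : {mpoly k[n]}) :
  P \is d.-homog -> mmap cst (fun i => a * y i) P = a ^+ d * mmap cst y P.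
Proof.
move=> hP; rewrite /mmap mulr_sumr !big_seq; apply: eq_bigr => m mP.
rewrite mulrCA; congr (_ * _); rewrite /mmap1; under eq_bigr do rewrite exprMn.
by rewrite big_split prodrXr /= -mdegE (dhomog_mf hP mP).
Qed.

(** * Partial derivatives of forms in characteristic zero *)

Section Derivatives.
Variables (k : fieldType) (n : nat).
Hypothesis k_char0 : [pchar k] =i pred0.
Local Notation S := {mpoly k[n]}.
Implicit Types P Q p : S.

Lemma dhomog_mderiv i P d : P \is d.-homog -> P^`M(i) \is d.-1.-homog.
Proof.
move=> hP; apply/dhomogP => m; rewrite mcoeff_msupp mcoeff_mderiv => c0.
have mP : (m + U_(i))%MM \in msupp P.
  by rewrite mcoeff_msupp; apply: contraNneq c0 => ->; rewrite mul0rn.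
by rewrite -(dhomog_mf hP mP) /= mdegD mdeg1 addn1.
Qed.

Lemma euler P d : P \is d.-homog -> \sum_i 'X_i * P^`M(i) = d%:R *: P.
Proof.
move=> hP; rewrite [in RHS](mpolyE P) scaler_sumr.
under eq_bigr do rewrite {1}(mpolyE P) linear_sum mulr_sumr.
rewrite exchange_big /= !big_seq; apply: eq_bigr => m mP.
under eq_bigr do rewrite mderivZ mderivX -scalerAr -scalerAr.
rewrite -(dhomog_mf hP mP) /= mdegE natr_sum scaler_suml.
under eq_bigr => i _.
  have -> : P@_m *: ((m i)%:R *: ('X_i * 'X_[m - U_(i)])) = (m i)%:R *: (P@_m *: 'X_[m]) :> S.
    have [->|mi] := eqVneq (m i) 0%N; first by rewrite !scale0r scaler0.
    rewrite -mpolyXD addmC submK; last by rewrite lep1mP.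
    by rewrite !scalerA mulrC.
  over.
by [].
Qed.

Lemma edvd_small p P d e : p \is d.-homog -> P \is e.-homog -> (e < d)%N ->
  edvd p P -> P = 0.
Proof.
move=> hp hP ed [Q PQ]; apply/eqP/negPn/negP => P0.
have [||i [j [_ hp' ij]]] := @dhomogM_inv _ _ Q p e; rewrite -?PQ //.
have p0 : p != 0 by apply: contraNneq P0 => p0; rewrite PQ p0 mulr0.
by have := dhomog_uniq p0 hp hp'; move: ij ed; clear; lia.
Qed.

Lemma mderivXn i p e : (p ^+ e.+1)^`M(i) = p ^+ e * (e.+1%:R *: p^`M(i)).
Proof.
elim: e => [|e IHe]; first by rewrite expr1 expr0 mul1r scale1r.
rewrite exprS mderivM IHe !exprS -[e.+2%:R]natr1 -!mul_mpolyC mpolyCD mpolyC1; ring.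
Qed.

(** Derivatives have smaller degree than p, so those divisible by p are zero. If all in directions
    other than t were zero, Euler's relation would make p divide X_t or the last derivative, and in
    the latter case deg p times p would be zero. *)
Lemma hprime_mderiv p t : hprime p -> ~ edvd p 'X_t ->
  exists2 i, i != t & ~ edvd p p^`M(i).
Proof.
move=> pp nX; have [_ [d hp]] := pp; have d0 := hprime_deg pp hp.
have small i : edvd p p^`M(i) -> p^`M(i) = 0.
  by apply: edvd_small hp (dhomog_mderiv i hp) _; rewrite prednK.
apply: contrapT => h.
have z i : i != t -> p^`M(i) = 0.
  move=> it; apply: small; apply: contrapT => ni; apply: h.
  by exists i.
have := euler hp; rewrite (bigD1 t) //= big1 ?addr0 => [e|i it]; last first.
  by rewrite z ?mulr0.
have : edvd p ('X_t * p^`M(t)) by rewrite e -mul_mpolyC; apply/edvd_mull/edvdd.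
case/(hprimeM pp) => // /small pt; move: e; rewrite pt mulr0 => /esym/eqP.
rewrite scaler_eq0 (negPf (hprime_neq0 pp)) orbF.
by move/pcharf0P: k_char0 => ->; rewrite gtn_eqF.
Qed.

(** In the derivative of p^(e+1) * Q, the only term not visibly divisible by p^(e+1) is the one that
    differentiates p. *)
Lemma edvd_mderiv_exact i p P e : hprime p -> P != 0 -> mult p P = e.+1 ->
  edvd (p ^+ e.+1) P^`M(i) -> edvd p p^`M(i).
Proof.
move=> pp P0 Pe; have [Q [PQ nQ]] := multE pp P0; rewrite Pe in PQ.
have p0 := hprime_neq0 pp.
rewrite PQ mderivM mderivXn => h.
have : edvd (p ^+ e.+1) (p ^+ e * (e.+1%:R *: p^`M(i)) * Q).
  rewrite -[X in edvd _ X](addrK (p ^+ e.+1 * Q^`M(i))).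
  by apply: edvdB => //; apply/edvd_mulr/edvdd.
case=> R; rewrite exprSr -mulrA [R * _]mulrCA => /(mulfI (expf_neq0 e p0)) eR.
have : edvd p (e.+1%:R *: p^`M(i) * Q) by exists R.
case/(hprimeM pp) => // -[T eT]; exists (e.+1%:R^-1 *: T).
rewrite -scalerAl -eT scalerA mulVf ?scale1r //.
by move/pcharf0P: k_char0 => ->.
Qed.

End Derivatives.

(** * Kummer covers of projective space *)

Section KummerForms.
Variables (k : closedFieldType) (K : fieldType) (cst : {rmorphism k -> K}).
Hypothesis k_char0 : [pchar k] =i pred0.
Variables (n : nat) (y : 'I_n.+1 -> K).
Local Notation S := {mpoly k[n.+1]}.
Local Notation ev := (mmap cst y).
Local Notation F0 := (homfrac cst y).
Implicit Types (P Q p : S) (f g : K) (t : 'I_n.+1).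
Hypothesis y_generic : generic_coord cst y.
Variables (N m : nat) (w : 'I_N -> K) (l : 'I_N -> nat) (Phi : 'I_N -> S).
Local Notation W t i := (w i / y t ^+ l i).

(** The eigenvectors in homogeneous form. The last two fields state that, up to F0, they are closed
    under products and inverses, as characters are. *)
Record kummer_forms : Prop := KummerFormsOf {
  kf_m : (0 < m)%N;
  kf_form : forall i, power_free_form cst y m (l i) (Phi i) (w i);
  kf_span : forall t f, exists r, (forall i, F0 (r i)) /\ f = \sum_i r i * W t i;
  kf_free : forall t r, (forall i, F0 (r i)) -> \sum_i r i * W t i = 0 ->
    forall i, r i = 0;
  kf_prod : forall t i j, exists h, F0 (W t i * W t j / W t h);
  kf_inv : forall t i, exists j, F0 (W t i * W t j)
}.
Hypothesis kf : kummer_forms.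
Let m_gt0 := kf_m kf.

Lemma kf_homog i : Phi i \is (m * l i).-homog. Proof. by case: (kf_form kf i). Qed.
Lemma kf_Phi0 i : Phi i != 0. Proof. by case: (kf_form kf i). Qed.
Lemma kf_w0 i : w i != 0. Proof. by case: (kf_form kf i). Qed.
Lemma kf_pow i : w i ^+ m = ev (Phi i). Proof. by case: (kf_form kf i). Qed.
Lemma kf_mult i p : hprime p -> (mult p (Phi i) < m)%N.
Proof. by case: (kf_form kf i) => _ _ _ _; apply. Qed.

Lemma kf_W0 t i : W t i != 0.
Proof. by rewrite mulf_neq0 ?invr_neq0 ?expf_neq0 ?kf_w0 ?(coord_neq0 y_generic). Qed.

Let form2 i j : [/\ Phi i * Phi j \is (m * (l i + l j)).-homog, Phi i * Phi j != 0,
  w i * w j != 0 & (w i * w j) ^+ m = ev (Phi i * Phi j)].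
Proof.
rewrite mulnDr dhomogM ?kf_homog // !mulf_neq0 ?kf_Phi0 ?kf_w0 //.
by rewrite exprMn !kf_pow rmorphM.
Qed.

Let W2 t i j : W t i * W t j = w i * w j / y t ^+ (l i + l j).
Proof. by rewrite exprD mulf_div. Qed.

(** [power_free_quot] shows that the factor by which w_i w_j differs from the eigenvector of the
    product character is itself a form. *)
Lemma kf_prodC i j : exists h C e, [/\ C \is e.-homog, C != 0, (l i + l j = e + l h)%N,
  w i * w j = ev C * w h & Phi i * Phi j = C ^+ m * Phi h].
Proof.
have [h] := kf_prod kf ord0 i j; rewrite W2 => hF; have [h1 h2 h3 h4] := form2 i j.
have [C [e ?]] := power_free_quot y_generic m_gt0 h1 h2 h3 h4 (kf_form kf h) hF.
by exists h, C, e.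
Qed.

Let form1 : power_free_form cst y m 0 1 1.
Proof.
rewrite /power_free_form muln0 dhomog1 !oner_neq0 expr1n rmorph1; split=> // p pp.
by rewrite mult1.
Qed.

Lemma kf_invC i : exists j C e, [/\ C \is e.-homog, C != 0, (l i + l j = e)%N,
  w i * w j = ev C & Phi i * Phi j = C ^+ m].
Proof.
have [j] := kf_inv kf ord0 i; rewrite W2 => hF; have [h1 h2 h3 h4] := form2 i j.
have [|C [e]] := power_free_quot (t := ord0) y_generic m_gt0 h1 h2 h3 h4 form1.
  by rewrite expr0 !divr1.
by rewrite addn0 !mulr1 => ?; exists j, C, e.
Qed.

(** Here h is the class of w_i / w_j, obtained as i times the inverse class of j. *)
Lemma kf_divC i j : exists h C e, [/\ C \is e.-homog, C != 0, (l h + l j = e + l i)%N,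
  w h * w j = ev C * w i & Phi h * Phi j = C ^+ m * Phi i].
Proof.
have [j' [A [a [hA A0 la wA _]]]] := kf_invC j.
have [h [B [b [hB B0 lb wB _]]]] := kf_prodC i j'.
have [h1 h2 h3 h4] := form2 h j; exists h.
have y0 := coord_neq0 y_generic ord0.
have eB := ev_neq0 y_generic hB B0; have eA := ev_neq0 y_generic hA A0.
have wj := kf_w0 j; have wj' := kf_w0 j'; have wi := kf_w0 i; have wh := kf_w0 h.
have [|C [e ?]] := power_free_quot (t := ord0) y_generic m_gt0 h1 h2 h3 h4 (kf_form kf i);
  last by exists C, e.
have -> : w h * w j / y ord0 ^+ (l h + l j) / (w i / y ord0 ^+ l i)
    = (ev A / y ord0 ^+ a) / (ev B / y ord0 ^+ b).
  have -> : w h = w i * w j' / ev B by rewrite wB mulrAC divff ?mul1r.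
  have -> : ev A = w j * w j' by [].
  have yA := expf_neq0 a y0; have yB := expf_neq0 b y0.
  have yi := expf_neq0 (l i) y0; have yhj := expf_neq0 (l h + l j) y0.
  have : y ord0 ^+ a * y ord0 ^+ l i = y ord0 ^+ b * y ord0 ^+ (l h + l j).
    by rewrite -!exprD; congr (_ ^+ _); move: la lb; clear; lia.
  move=> yy; apply/eqP; rewrite -subr_eq0; apply/eqP.
  transitivity (w j * w j' / ev B / (y ord0 ^+ (l h + l j) * y ord0 ^+ a)
    * (y ord0 ^+ a * y ord0 ^+ l i - y ord0 ^+ b * y ord0 ^+ (l h + l j))).
    by field; rewrite eB yi yhj yA yB wi.
  by rewrite yy subrr mulr0.
by apply: homfrac_div; apply: (@polyring_homfrac _ _ _ _ y y_generic ord0);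
  [exists a, A | exists b, B].
Qed.

(** The trivial class, found as i times its inverse. Its form is an m-th power with exponents below
    m, hence constant. *)
Lemma kf_unit : exists h c, [/\ c != 0, l h = 0%N & w h = cst c].
Proof.
have [i _] : exists i : 'I_N, true.
  have [r [_ e]] := kf_span kf ord0 1; apply: contrapT => h.
  move/eqP: e; rewrite big1 ?oner_eq0 // => i _; case: h.
  by exists i.
have [j [A [a [hA A0 la wA PA]]]] := kf_invC i.
have [h [B [b [hB B0 lb wB PB]]]] := kf_prodC i j.
have eB := ev_neq0 y_generic hB B0; have y0 := coord_neq0 y_generic ord0.
have [hh0 hh1 hh2 hh3 hh4] := kf_form kf h.
have [|C [e [hC C0]]] := power_free_quot (t := ord0) y_generic m_gt0 hh0 hh1 hh2 hh3 form1.
  rewrite expr0 !divr1.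
  have -> : w h / y ord0 ^+ l h = (ev A / y ord0 ^+ a) / (ev B / y ord0 ^+ b).
    rewrite -wA wB -la lb exprD.
    have yh := expf_neq0 (l h) y0; have yb := expf_neq0 b y0.
    by field; rewrite yh yb eB.
  by apply: homfrac_div; apply: (@polyring_homfrac _ _ _ _ y y_generic ord0);
    [exists a, A | exists b, B].
rewrite addn0 !mulr1 => le wE PhiE.
have e0 : e = 0%N.
  apply/eqP; rewrite -leqn0 leqNgt; apply/negP => e0.
  have [p pp pC] := hprime_exists C0 hC e0.
  have := hh4 p pp; rewrite PhiE multX // ltnNge => /negP[].
  by rewrite leq_pmulr //; apply/mult_gt0.
rewrite e0 in hC le; exists h, C@_0; rewrite wE {2}(dhomog0_const hC) evC; split=> //.
by apply: contraNneq C0 => c0; rewrite (dhomog0_const hC) c0 mpolyC0.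
Qed.

Lemma kf_inj i j c : w i = cst c * w j -> l i = l j -> i = j.
Proof.
move=> e le; apply/eqP/negPn/negP => ij.
pose r h : K := (h == i)%:R - cst c * (h == j)%:R.
have rF h : F0 (r h).
  have b (x : bool) : F0 (x%:R : K) by case: x; [apply: homfrac1 | apply: homfrac0].
  by apply: homfracD => //; apply/homfracN/homfracM => //; apply: homfracC.
have := kf_free kf (t := ord0) rF; have -> : \sum_h r h * W ord0 h = 0.
  rewrite /r; under eq_bigr do rewrite mulrBl.
  rewrite sumrB (bigD1 i) //= eqxx mul1r big1 ?addr0 => [|h /negPf->]; last exact: mul0r.
  rewrite (bigD1 j) //= eqxx mulr1 big1 ?addr0 => [|h /negPf->]; last by rewrite mulr0 mul0r.
  by rewrite e le mulrA subrr.
move=> /(_ erefl i); rewrite /r eqxx (negPf ij) mulr0 subr0.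
by move/eqP; rewrite oner_eq0.
Qed.

(** Equal exponents make Phi_i and Phi_j proportional. So w_i / w_j is an m-th root of a constant,
    which lies in k because k is algebraically closed, and freeness gives i = j. *)
Lemma kf_mult_inj i j :
  (forall p, hprime p -> mult p (Phi i) = mult p (Phi j)) -> i = j.
Proof.
move=> h; have [hi hj] := (kf_homog i, kf_homog j).
have dij : edvd (Phi i) (Phi j).
  by apply: edvd_mult hj hi _; rewrite ?kf_Phi0 // => p pp; rewrite h.
have dji : edvd (Phi j) (Phi i).
  by apply: edvd_mult hi hj _; rewrite ?kf_Phi0 // => p pp; rewrite h.
have [c c0 e] := edvd_antisym (kf_Phi0 j) dji dij.
have lij : l i = l j.
  have h1 : Phi i \is (m * l j).-homog by rewrite e dhomogZ.
  by have /eqP := dhomog_uniq (kf_Phi0 i) hi h1; rewrite eqn_pmul2l // => /eqP.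
have [rs _ rsE] := roots_of_unity k_char0 m_gt0.
have [z zm] : exists z : k, z ^+ m = c.
  have [|z /eqP zr] := closed_rootP ('X^m - c%:P : {poly k}) _.
    by rewrite size_XnsubC // gtn_eqF // ltnS.
  by exists z; apply/eqP; rewrite -subr_eq0; move/eqP: zr; rewrite !hornerE ?hornerXn => ->.
have z0 : z != 0 by apply: contraNneq c0 => z0; rewrite -zm z0 expr0n gtn_eqF.
pose u := w i / (cst z * w j).
have cz0 : cst z != 0 by rewrite fmorph_eq0.
have um : u ^+ m = 1.
  rewrite /u expr_div_n exprMn !kf_pow -rmorphXn zm e mmapZ divff //.
  by rewrite mulf_neq0 ?fmorph_eq0 // -kf_pow expf_neq0 ?kf_w0.
have : root (\prod_(x <- rs) ('X - (cst x)%:P)) u.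
  have := congr1 (map_poly cst) rsE; rewrite rmorphB rmorphXn rmorph1 /= map_polyX.
  rewrite rmorph_prod; under [in X in _ = X -> _]eq_bigr do
    rewrite /= rmorphB /= map_polyX map_polyC.
  by move=> <-; rewrite rootE !hornerE ?hornerXn um subrr.
rewrite -(big_map cst predT (fun x => 'X - x%:P)) root_prod_XsubC => /mapP[x _ ux].
apply: (@kf_inj i j (x * z)) lij; rewrite rmorphM -ux /u -mulrA divfK //.
by rewrite mulf_neq0 ?kf_w0.
Qed.

End KummerForms.

(** * Prime factors of a form and its degree *)

Section PrimeList.
Variables (k : fieldType) (n : nat).
Local Notation S := {mpoly k[n]}.
Implicit Types P Q p : S.

Lemma prime_list P : P != 0 -> exists r (q : 'I_r -> S),
  [/\ forall a, prime_elt (q a), forall a, edvd (q a) P,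
      forall a b, edvd (q a) (q b) -> a = b
    & forall p, prime_elt p -> edvd p P -> exists a, edvd (q a) p].
Proof.
move=> P0; have [u [s [u1 sp ->]]] := @factorial_mpoly k n P P0.
have [r [q [h1 h4 h2 h3]]] : exists r (q : 'I_r -> S), [/\ forall a, prime_elt (q a),
    forall a, q a \in s, forall a b, edvd (q a) (q b) -> a = b
  & forall p, p \in s -> exists a, edvd (q a) p].
  elim: s sp => [|p s IHs] sp.
    by exists 0%N, (fun=> 0); split=> // -[].
  have [|r [q [h1 h4 h2 h3]]] := IHs; first by move=> q qs; apply: sp; rewrite in_cons qs orbT.
  have pp : prime_elt p by apply: sp; rewrite mem_head.
  have [[a qp]|nex] := pselect (exists a, edvd (q a) p).
    exists r, q; split=> // [b|z]; first by rewrite in_cons h4 orbT.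
    by rewrite in_cons => /predU1P[->|/h3//]; exists a.
  exists r.+1, (fun i => if unlift ord0 i is Some j then q j else p); split.
  - by move=> a; case: unliftP.
  - by move=> a; case: unliftP => *; rewrite in_cons ?eqxx // h4 orbT.
  - move=> a b; case: unliftP => [a' ->|->]; case: unliftP => [b' ->|->] //.
    + by move/h2 => ->.
    + by move=> h; case: nex; exists a'.
    + move=> /(prime_assoc pp (h1 b'))[v [v' v1] e]; case: nex; exists b'; exists v'.
      by rewrite e mulrA -v1 mul1r.
  - move=> z; rewrite in_cons => /predU1P[->|/h3[a az]].
      by exists ord0; rewrite unlift_none; apply: edvdd.
    by exists (lift ord0 a); rewrite liftK.
exists r, q; split=> // [a|p pp pP].
  by rewrite (perm_big _ (perm_to_rem (h4 a))) big_cons /= mulrCA; apply/edvd_mulr/edvdd.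
have [z zs pz] := prime_edvd_prod pp u1 pP.
have [a az] := h3 z zs; exists a.
have [v [v' v1] e] := prime_assoc pp (sp z zs) pz.
by apply: edvd_trans az _; exists v'; rewrite e mulrA -v1 mul1r.
Qed.

Lemma mult_assoc p q P : hprime p -> hprime q -> P != 0 -> edvd q p ->
  mult p P = mult q P.
Proof.
move=> pp qq P0 qp; have [v [v' v1] pE] := prime_assoc qq.1 pp.1 qp.
have le a b : hprime a -> hprime b -> edvd a b -> (mult b P <= mult a P)%N.
  move=> aa bb [z bE]; apply/(mult_ge _ aa P0).
  apply: (@edvd_trans _ _ (b ^+ mult b P)); last by apply/(mult_ge _ bb P0).
  by rewrite {2}bE exprMn; apply/edvd_mull/edvdd.
have pq : edvd p q by exists v'; rewrite pE mulrA -v1 mul1r.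
by apply/eqP; rewrite eqn_leq !le.
Qed.

Lemma degree_mult r (q : 'I_r -> S) (d : 'I_r -> nat) P e :
  (forall a, hprime (q a)) -> (forall a, q a \is (d a).-homog) ->
  (forall a b, edvd (q a) (q b) -> a = b) ->
  P != 0 -> P \is e.-homog ->
  (forall p, hprime p -> edvd p P -> exists a, edvd (q a) p) ->
  e = (\sum_a d a * mult (q a) P)%N.
Proof.
move=> qp qd qI; have [b] := ubnP e; elim: b => // b IHb in e P *.
rewrite ltnS => eb P0 hP hq; have [e0|e0] := posnP e.
  rewrite e0 in hP *; have PC := dhomog0_const hP.
  have P1 : edvd P 1.
    by rewrite PC; apply: mpolyC_unit; apply: contraNneq P0 => c0; rewrite PC c0 mpolyC0.
  rewrite big1 // => a _; rewrite (_ : mult _ _ = 0%N) ?muln0 //.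
  apply/(mult_eq0 (qp a) P0) => qP; have [[_ q1 _] _] := qp a.
  by apply: q1; apply: edvd_trans qP P1.
have [p pp pP] := hprime_exists P0 hP e0; have [a qp'] := hq p pp pP.
have [R PR] : edvd (q a) P by apply: edvd_trans qp' pP.
have R0 : R != 0 by apply: contraNneq P0 => R0; rewrite PR R0 mul0r.
have q0 := hprime_neq0 (qp a).
have [||i [j [hR hq' ij]]] := @dhomogM_inv _ _ R (q a) e; rewrite -?PR //.
have jd := dhomog_uniq q0 hq' (qd a); rewrite jd in ij.
have d0 := hprime_deg (qp a) (qd a).
have ib : (i < b)%N by apply: leq_trans eb; rewrite -ij -addn1 leq_add2l.
rewrite -ij (IHb i R ib R0 hR); last first.
  by move=> z zp zR; apply: hq => //; rewrite PR; apply: edvd_mulr.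
rewrite (bigD1 a) //= [RHS](bigD1 a) //= PR multM // mult_self // mulnDr muln1.
rewrite addnAC; congr (_ + _)%N; apply: eq_bigr => c ca.
rewrite multM // (_ : mult (q c) (q a) = 0%N) ?addn0 //.
by apply/(mult_eq0 (qp c) q0) => /qI ac; rewrite ac eqxx in ca.
Qed.

End PrimeList.

(** * From Kummer covers to weighted codes *)

Section KummerDegree.
Variables (k : closedFieldType) (K : fieldType) (cst : {rmorphism k -> K}).
Hypothesis k_char0 : [pchar k] =i pred0.
Variables (n : nat) (y : 'I_n.+1 -> K).
Local Notation S := {mpoly k[n.+1]}.
Hypothesis y_generic : generic_coord cst y.
Variables (N m' : nat) (w : 'I_N -> K) (l : 'I_N -> nat) (Phi : 'I_N -> S).
Local Notation m := m'.+2.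
Hypothesis kf : kummer_forms cst y m w l Phi.

(** The codeword of i lists the exponents in Phi_i of the primes that occur, and has weight m * l i.
    Codewords are closed under subtraction by [kf_divC] and distinct by [kf_mult_inj], so they form
    a group of N elements. *)
Theorem kummer_degree (i0 : 'I_N) : (4 <= l i0)%N ->
  (forall i, i != i0 -> (l i <= 2)%N) -> N \in [:: 2; 3; 4; 6; 8; 9; 16]%N.
Proof.
move=> l0 l2; have Phi0 i : Phi i != 0 := kf_Phi0 kf i.
have prod0 : \prod_i Phi i != 0 by apply/prodf_neq0 => i _.
have [r [q [qp qprod qI qP]]] := prime_list prod0.
have Phi_prod i p : edvd p (Phi i) -> edvd p (\prod_i Phi i).
  by move=> pi; rewrite (bigD1 i) //=; apply: edvd_mulr.
have [D hprod] : exists D, \prod_i Phi i \is D.-homog.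
  elim/big_ind: _ => [|P Q [a hP] [b hQ]|i _]; first by exists 0%N; apply: dhomog1.
    by exists (a + b)%N; apply: dhomogM.
  by exists (m * l i)%N; apply: (kf_homog kf).
have qh a : hprime (q a).
  by split; [apply: qp | apply: edvd_dhomog prod0 hprod (qprod a)].
have /choice[d qd] : forall a, exists d, q a \is d.-homog by move=> a; case: (qh a).
have d0 a : (0 < d a)%N := hprime_deg (qh a) (qd a).
have lE i : (m * l i = \sum_a d a * mult (q a) (Phi i))%N.
  apply: degree_mult qh qd qI (Phi0 i) (kf_homog kf i) _ => p [pp _] pi.
  by apply: qP pp _; apply: Phi_prod pi.
have mult_lt i a : (mult (q a) (Phi i) < m)%N := kf_mult kf i (qh a).
pose c i : {ffun 'I_r -> 'I_m} := [ffun a => Ordinal (mult_lt i a)].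
have weight_c i : weight d (c i) = (m * l i)%N.
  by rewrite lE; apply: eq_bigr => a _; rewrite ffunE.
have c_inj : injective c.
  move=> i j /ffunP e; apply: (kf_mult_inj k_char0 kf) => p pp.
  have [[a ap]|na] := pselect (exists a, edvd (q a) p).
    rewrite !(mult_assoc pp (qh a) _ ap) //.
    by have := congr1 val (e a); rewrite !ffunE.
  have np h : ~ edvd p (Phi h).
    by move/Phi_prod => pP; apply: na; apply: qP pP; case: pp.
  by rewrite (mult_eq0 pp (Phi0 i)).2 // (mult_eq0 pp (Phi0 j)).2.
pose C := [set c i | i : 'I_N].
have cardC : #|C| = N by rewrite card_imset // card_ord.
rewrite -cardC; apply: (@card_weighted_code m' r d d0 C (c i0)).
- have [h [e [e0 lh _]]] := kf_unit y_generic kf; apply/imsetP; exists h => //.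
  apply/ffunP => a; rewrite !ffunE; apply/val_inj => /=.
  have := kf_homog kf h; rewrite lh muln0 => /dhomog0_const PhC.
  apply/esym/(mult_eq0 (qh a) (Phi0 h)) => qa; have [[_ q1 _] _] := qh a; apply: q1.
  apply: edvd_trans qa _; rewrite PhC; apply: mpolyC_unit.
  by apply: contraNneq (Phi0 h) => z; rewrite PhC z mpolyC0.
- move=> _ _ /imsetP[i _ ->] /imsetP[j _ ->].
  have [h [A [e [hA A0 _ _ PhE]]]] := kf_divC y_generic kf i j.
  apply/imsetP; exists h => //; apply/eqP; rewrite subr_eq; apply/eqP/ffunP => a.
  apply/val_inj; rewrite !ffunE /=; have := congr1 (mult (q a)) PhE.
  rewrite (multM (qh a) (Phi0 h) (Phi0 j)) (multM (qh a) (expf_neq0 m A0) (Phi0 i)).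
  rewrite multX // => ->.
  by rewrite mulnC modnMDl modn_small.
- exact: imset_f.
- by rewrite weight_c mulnC leq_mul2l l0 orbT.
- move=> _ /imsetP[i _ ->] ci; rewrite weight_c mulnC leq_mul2r l2 ?orbT //.
  by apply: contraNneq ci => ->.
Qed.

End KummerDegree.

(** * Integrality tests along a hypersurface *)

Section PrimeLocal.
Variables (k : closedFieldType) (K : fieldType) (cst : {rmorphism k -> K}).
Hypothesis k_char0 : [pchar k] =i pred0.
Variables (n : nat) (y : 'I_n.+1 -> K).
Local Notation S := {mpoly k[n.+1]}.
Local Notation ev := (mmap cst y).
Local Notation F0 := (homfrac cst y).
Implicit Types (P Q p : S) (f g r : K) (t : 'I_n.+1).
Hypothesis y_generic : generic_coord cst y.
Local Notation vint := (vint cst y).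
Local Notation polyring := (polyring cst y).

Lemma edvd_vint p d P Q b : hprime p -> P \is d.-homog -> Q \is d.-homog -> Q != 0 ->
  edvd (p ^+ b) Q -> vint p (ev P / ev Q) -> edvd (p ^+ b) P.
Proof.
move=> pp hP hQ Q0 pQ [e [A [B [hA hB nB /eqP]]]].
have [->|P0] := eqVneq P 0; first by move=> _; apply: edvd0.
rewrite eqr_div; [|exact: (ev_neq0 y_generic hQ Q0)|exact: (vint_den y_generic hB nB)].
rewrite -!rmorphM => /eqP/(ev_inj (d := (d + e)%N) y_generic) PB.
have {}PB : P * B = A * Q by apply: PB; [apply: dhomogM | rewrite mulrC dhomogM].
have B0 : B != 0 by apply/eqP => B0; apply: nB; rewrite B0; apply: edvd0.
have A0 : A != 0 by apply: contraNneq (mulf_neq0 P0 B0) => A0; rewrite PB A0 mul0r.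
apply/(mult_ge b pp P0); move/(mult_ge b pp Q0): pQ => /leq_trans; apply.
have := congr1 (mult p) PB; rewrite (multM pp P0 B0) (multM pp A0 Q0).
by rewrite ((mult_eq0 pp B0).2 nB) addn0 => ->; apply: leq_addl.
Qed.

Lemma vint_or_inv p f : hprime p -> F0 f -> vint p f \/ vint p f^-1.
Proof.
move=> pp /(homfrac_reduced y_generic)[d [P [Q [hP hQ Q0 -> red]]]].
have [pQ|nQ] := pselect (edvd p Q); last by left; exists d, P, Q.
by right; exists d, Q, P; rewrite invf_div; split=> //; apply: red.
Qed.

(** If f is not integral at p then f^-1 is, and dividing the equation by a power of f writes f as a
    polynomial in f^-1 with integral coefficients. *)
Lemma integrally_closed t f (q : {poly K}) : F0 f -> q \is monic ->
  (forall i : nat, polyring t q`_i) -> root q f -> polyring t f.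
Proof.
move=> Ff qm qA qf; apply: (vint_polyring y_generic Ff) => p pp nX.
have [//|vf] := vint_or_inv pp Ff.
have [->|f0] := eqVneq f 0; first exact: vint0.
have q1 : (1 < size q)%N by apply: root_size_gt1 qf; apply: monic_neq0.
have [D sD] : exists D, size q = D.+2 by case: (size q) q1 => [|[|D]] // _; exists D.
have qD : q`_D.+1 = 1 by have := monicP qm; rewrite lead_coefE sD.
have -> : f = - \sum_(i < D.+1) q`_i * f^-1 ^+ (D - i).
  move: qf; rewrite rootE horner_coef sD big_ord_recr /= qD mul1r addrC addr_eq0 => /eqP e.
  apply: (mulIf (expf_neq0 D f0)); rewrite -exprS e mulNr; congr (- _).
  rewrite mulr_suml; apply: eq_bigr => i _; have iD : (i <= D)%N by rewrite -ltnS.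
  rewrite -mulrA; congr (_ * _); rewrite -[X in _ = _ * f ^+ X](subnK iD) exprD mulrA.
  by rewrite exprVn mulVf ?mul1r // expf_neq0.
apply/vintN/vint_sum => // i _; apply: vintM => //; last exact: vintX.
exact: polyring_vint pp nX (qA i).
Qed.

(** A pole of r along p would put p^m into the denominator of r^m, and P does not contain p^m to
    compensate for it. *)
Lemma power_free_integral t m l P w r : (0 < m)%N -> power_free_form cst y m l P w ->
  F0 r -> polyring t ((r * (w / y t ^+ l)) ^+ m) -> polyring t r.
Proof.
move=> m0 [hP P0 w0 wm pf] Fr hr; apply: (vint_polyring y_generic Fr) => p pp nX.
have /(homfrac_reduced y_generic)[d [A [B [hA hB B0 rE red]]]] := Fr.
have [pB|nB] := pselect (edvd p B); last by exists d, A, B.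
have nA := red p pp pB; have A0 : A != 0 by apply/eqP => A0; apply: nA; rewrite A0; apply: edvd0.
have Xl : 'X_t ^+ (m * l) != 0 :> S by rewrite expf_neq0 ?Xi_neq0.
have e : (r * (w / y t ^+ l)) ^+ m = ev (A ^+ m * P) / ev (B ^+ m * 'X_t ^+ (m * l)).
  rewrite !rmorphM !rmorphXn /= evX rE !exprMn !exprVn wm -exprM [(l * m)%N]mulnC.
  by rewrite mulf_div.
have := polyring_vint pp nX hr; rewrite e => /(edvd_vint (b := m) pp).
move=> /(_ (d * m + m * l)%N); rewrite !dhomogM ?dhomogMn ?dhomogXin //.
rewrite (mulf_neq0 (expf_neq0 m B0) Xl) => /(_ isT isT isT).
case: pB => B' ->; rewrite exprMn -mulrA => h.
have /(mult_ge m pp) : edvd (p ^+ m) (A ^+ m * P).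
  by apply: h; rewrite mulrCA; apply/edvd_mulr/edvdd.
rewrite (mulf_neq0 (expf_neq0 m A0) P0) => /(_ isT).
rewrite (multM pp (expf_neq0 m A0) P0) multX // ((mult_eq0 pp A0).2 nA) muln0 add0n.
by rewrite leqNgt pf.
Qed.

(* Away from the branch curve a section is tested by [F], and along a branch   *)
(* component [p] by the logarithmic derivatives [F * P_s / P], which have no   *)
(* zero along [p] in at least one direction [s].                               *)
Lemma log_derivative_test t p d P F e r : hprime p -> ~ edvd p 'X_t ->
  P \is d.-homog -> P != 0 -> F \is e.-homog -> F != 0 ->
  (mult p P = 0%N -> mult p F = 0%N) -> (mult p F <= 1)%N ->
  F0 r ->
  vint p (r * (ev F / y t ^+ e)) ->
  (forall s, s != t -> vint p (r * (ev F / y t ^+ e) * (ev P^`M(s) * y t / ev P))) ->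
  vint p r.
Proof.
move=> pp nX hP P0 hF F00 mF0 mF1 Fr h1 h2.
have /(homfrac_reduced y_generic)[a [A [B [hA hB B0 rE red]]]] := Fr.
have [pB|nB] := pselect (edvd p B); last by exists a, A, B.
have nA := red p pp pB; have A0 : A != 0 by apply/eqP => A0; apply: nA; rewrite A0; apply: edvd0.
have X0 i : 'X_t ^+ i != 0 :> S by rewrite expf_neq0 ?Xi_neq0.
have mX i : mult p ('X_t ^+ i) = 0%N.
  apply/(mult_eq0 pp (X0 i)); case: (pp) => pp' _.
  by move/(prime_edvd_exp pp').
have mA := (mult_eq0 pp A0).2 nA; have mB := (mult_gt0 pp B0).2 pB.
have BF : (mult p B <= mult p F)%N.
  have : vint p (ev (A * F) / ev (B * 'X_t ^+ e)).
    by rewrite !rmorphM rmorphXn /= evX -mulf_div -rE.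
  move/(edvd_vint (b := mult p B) pp) => /(_ (a + e)%N).
  rewrite !dhomogM ?dhomogXin // (mulf_neq0 B0 (X0 e)) => /(_ isT isT isT) h.
  have /(mult_ge _ pp (mulf_neq0 A0 F00)) : edvd (p ^+ mult p B) (A * F).
    by apply: h; apply/edvd_mulr/(mult_ge _ pp B0).
  by rewrite (multM pp A0 F00) mA.
have [P_0|P_0] := posnP (mult p P); first by move: BF; rewrite mF0 // leqNgt mB.
(* The direction s is chosen so that p does not divide its derivative along s. If r had a pole, the
   second test would put p^(E+1) into the derivative of P, where E+1 is the exponent of p in P, and
   p would divide that derivative of p after all. *)
have [s st ns] := hprime_mderiv k_char0 pp nX; case: ns.
case mP: (mult p P) P_0 => [//|E] _.
apply: (edvd_mderiv_exact k_char0 pp P0 mP).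
have [Ps0|Ps0] := eqVneq (P^`M(s)) 0; first by rewrite Ps0; apply: edvd0.
have : vint p (ev (A * F * (P^`M(s) * 'X_t)) / ev (B * 'X_t ^+ e * P)).
  have := h2 s st; rewrite !rmorphM rmorphXn /= evX rE.
  by rewrite [in X in X -> _]mulf_div mulf_div.
have d0 : (0 < d)%N.
  rewrite lt0n; apply/eqP => d0; rewrite d0 in hP.
  by move: Ps0; rewrite (dhomog0_const hP) mderivC eqxx.
move/(edvd_vint (b := E.+2) pp) => /(_ (a + e + d)%N).
rewrite (dhomogM (dhomogM hB (dhomogXin _ t e)) hP) (mulf_neq0 (mulf_neq0 B0 (X0 e)) P0).
have hPs : P^`M(s) * 'X_t \is d.-homog.
  by have := dhomogM (dhomog_mderiv s hP) (dhomogXi k t); rewrite addn1 prednK.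
rewrite (dhomogM (dhomogM hA hF) hPs).
move=> /(_ isT isT isT) h; apply/(mult_ge _ pp Ps0).
have /(mult_ge _ pp) : edvd (p ^+ E.+2) (A * F * (P^`M(s) * 'X_t)).
  apply: h; apply/(mult_ge _ pp (mulf_neq0 (mulf_neq0 B0 (X0 e)) P0)).
  rewrite (multM pp (mulf_neq0 B0 (X0 e)) P0) (multM pp B0 (X0 e)) mX addn0 mP.
  by rewrite -add1n leq_add2r.
have Xt := X0 1%N; have mXt := mX 1%N; rewrite expr1 in Xt mXt.
rewrite (mulf_neq0 (mulf_neq0 A0 F00) (mulf_neq0 Ps0 Xt)) => /(_ isT).
rewrite (multM pp (mulf_neq0 A0 F00) (mulf_neq0 Ps0 Xt)) (multM pp A0 F00).
rewrite (multM pp Ps0 Xt) mXt mA add0n addn0 => h3.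
by have := leq_trans h3 (leq_add mF1 (leqnn _)); rewrite add1n ltnS.
Qed.

End PrimeLocal.

(** * Coordinate ring and canonical module over a chart *)

Section ChartModules.
Variables (k : closedFieldType) (K : fieldType) (cst : {rmorphism k -> K}).
Variables (n : nat) (y : 'I_n.+1 -> K).
Local Notation S := {mpoly k[n.+1]}.
Local Notation ev := (mmap cst y).
Local Notation F0 := (homfrac cst y).
Hypothesis y_generic : generic_coord cst y.
Variables (N m : nat) (w : 'I_N -> K) (l : 'I_N -> nat) (Phi : 'I_N -> S).
Hypothesis kf : kummer_forms cst y m w l Phi.
Variable t : 'I_n.+1.
Local Notation polyring := (polyring cst y t).
Implicit Types (f g b r : K).

Definition kf_W i := w i / y t ^+ l i.
Local Notation W := kf_W.

Lemma kf_W_neq0 i : W i != 0. Proof. exact: (kf_W0 y_generic kf). Qed.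

Lemma kf_ratio i j f : F0 f -> W i = f * W j -> i = j.
Proof.
move=> Ff e; apply/eqP/negPn/negP => ij.
pose r h : K := (h == i)%:R - f * (h == j)%:R.
have rF h : F0 (r h).
  have b (x : bool) : F0 (x%:R : K) by case: x; [apply: homfrac1 | apply: homfrac0].
  by apply: homfracD => //; apply/homfracN/homfracM.
have := kf_free kf (t := t) rF; have -> : \sum_h r h * (w h / y t ^+ l h) = 0.
  rewrite /r; under eq_bigr do rewrite mulrBl.
  rewrite sumrB (bigD1 i) //= eqxx mul1r big1 ?addr0 => [|h /negPf->]; last exact: mul0r.
  rewrite (bigD1 j) //= eqxx mulr1 big1 ?addr0 => [|h /negPf->]; last by rewrite mulr0 mul0r.
  by apply/eqP; rewrite subr_eq0 -/(W i) e.
move=> /(_ erefl i); rewrite /r eqxx (negPf ij) mulr0 subr0.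
by move/eqP; rewrite oner_eq0.
Qed.

Lemma kf_W_prod i j : exists h c, polyring c /\ W i * W j = c * W h.
Proof.
have [h [C [e [hC _ le wC _]]]] := kf_prodC y_generic kf i j.
exists h, (ev C / y t ^+ e); split; first by exists e, C.
by rewrite /W !mulf_div -!exprD wC le.
Qed.

Lemma kf_W_div i j : exists h C e, [/\ C \is e.-homog, C != 0,
  W h * W j = ev C / y t ^+ e * W i & Phi h * Phi j = C ^+ m * Phi i].
Proof.
have [h [C [e [hC C0 le wC PC]]]] := kf_divC y_generic kf i j.
by exists h, C, e; split=> //; rewrite /W !mulf_div -!exprD wC le.
Qed.

(** The coordinate ring of the preimage of the chart; [Bring_regular] and [regular_Bring] identify
    the two. *)
Definition Bring f := exists r : 'I_N -> K,
  (forall i, polyring (r i)) /\ f = \sum_i r i * W i.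

(** For n = 2, the coefficients h of the 2-forms h dx_a /\ dx_b regular over the chart;
    [theta_regular] and [form_regular_polyring] give the two inclusions, component by component. *)
Definition Mmod f := exists r : 'I_N -> K,
  (forall i, polyring (r i)) /\ f = \sum_i r i / W i.

Lemma sum_delta (i : 'I_N) r (u : 'I_N -> K) :
  r * u i = \sum_j (if j == i then r else 0) * u j.
Proof.
rewrite (bigD1 i) //= eqxx big1 ?addr0 // => j /negPf->.
by rewrite mul0r.
Qed.

Lemma Bring_mon r i : polyring r -> Bring (r * W i).
Proof.
move=> rA; exists (fun j => if j == i then r else 0); split; last exact: sum_delta.
by move=> j; case: ifP => // _; apply: polyring0.
Qed.

Lemma Mmod_mon r i : polyring r -> Mmod (r / W i).
Proof.
move=> rA; exists (fun j => if j == i then r else 0); split.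
  by move=> j; case: ifP => // _; apply: polyring0.
exact: (sum_delta i r (fun j => (W j)^-1)).
Qed.

Lemma BringD f g : Bring f -> Bring g -> Bring (f + g).
Proof.
move=> [r [rA ->]] [s [sA ->]]; exists (fun i => r i + s i); split.
  by move=> i; apply: (polyringD y_generic).
by rewrite -big_split; apply: eq_bigr => i _; rewrite mulrDl.
Qed.

Lemma MmodD f g : Mmod f -> Mmod g -> Mmod (f + g).
Proof.
move=> [r [rA ->]] [s [sA ->]]; exists (fun i => r i + s i); split.
  by move=> i; apply: (polyringD y_generic).
by rewrite -big_split; apply: eq_bigr => i _; rewrite mulrDl.
Qed.

Lemma Bring0 : Bring 0.
Proof.
exists (fun=> 0); split; first by move=> _; apply: polyring0.
by rewrite big1 // => i _; rewrite mul0r.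
Qed.

Lemma Mmod0 : Mmod 0.
Proof.
exists (fun=> 0); split; first by move=> _; apply: polyring0.
by rewrite big1 // => i _; rewrite mul0r.
Qed.

Lemma Bring_sum (I : Type) (s : seq I) (A : pred I) (F : I -> K) :
  (forall i, A i -> Bring (F i)) -> Bring (\sum_(i <- s | A i) F i).
Proof. by move=> h; elim/big_ind: _ => //; [exact: Bring0 | exact: BringD]. Qed.

Lemma Mmod_sum (I : Type) (s : seq I) (A : pred I) (F : I -> K) :
  (forall i, A i -> Mmod (F i)) -> Mmod (\sum_(i <- s | A i) F i).
Proof. by move=> h; elim/big_ind: _ => //; [exact: Mmod0 | exact: MmodD]. Qed.

Lemma BringM f g : Bring f -> Bring g -> Bring (f * g).
Proof.
move=> [r [rA ->]] [s [sA ->]]; rewrite mulr_suml; apply: Bring_sum => i _.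
rewrite mulr_sumr; apply: Bring_sum => j _; have [h [c [cA e]]] := kf_W_prod i j.
by rewrite mulrACA e mulrA; apply: Bring_mon; do !apply: polyringM => //.
Qed.

Lemma Bring_Mmod b f : Bring b -> Mmod f -> Mmod (b * f).
Proof.
move=> [r [rA ->]] [s [sA ->]]; rewrite mulr_suml; apply: Mmod_sum => j _.
rewrite mulr_sumr; apply: Mmod_sum => i _; have [h [C [e [hC C0 eW _]]]] := kf_W_div i j.
have -> : r j * W j * (s i / W i) = r j * s i * (ev C / y t ^+ e) / W h.
  have [hi hh] := (kf_W_neq0 i, kf_W_neq0 h).
  apply: (mulIf (mulf_neq0 hi hh)); transitivity (r j * s i * (W h * W j)).
    by field; exact: hi.
  by rewrite eW; set c := ev C / y t ^+ e; field; exact: hh.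
apply: Mmod_mon; apply: polyringM; first exact: polyringM.
by exists e, C.
Qed.

Lemma Bring_polyring r : polyring r -> Bring r.
Proof.
move=> rA; have [h [c [c0 lh wh]]] := kf_unit y_generic kf.
have -> : r = r * cst c^-1 * W h.
  by rewrite /W wh lh expr0 divr1 -mulrA -rmorphM mulVf // rmorph1 mulr1.
by apply: Bring_mon; apply: polyringM => //; apply: polyringC.
Qed.

Lemma Bring_W i : Bring (W i).
Proof. by rewrite -[W i]mul1r; apply: Bring_mon; apply: polyring1. Qed.

Lemma MmodN f : Mmod f -> Mmod (- f).
Proof.
move=> h; rewrite -mulN1r -(rmorphN1 cst); apply: Bring_Mmod h.
by apply: Bring_polyring; apply: polyringC.
Qed.

(** Up to F0 the inverses of the [W i] are the eigenvectors of the inverse classes, so their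
    independence is that of the [W i]. *)
Lemma dual_free (u : 'I_N -> 'I_N) (x : 'I_N -> K) : injective u ->
  (forall j, F0 (x j)) -> \sum_j x j / W (u j) = 0 -> forall j, x j = 0.
Proof.
move=> u_inj xF.
have /choice[v vE] : forall i, exists j, F0 (W i * W j).
  by move=> i; have [j hj] := kf_inv kf t i; exists j.
have v_inj : injective v.
  move=> i j e; have := vE i; have := vE j; rewrite e => hj hi.
  apply: kf_ratio (homfrac_div hi hj) _.
  have [h1 h2] := (kf_W_neq0 j, kf_W_neq0 (v j)).
  by field; rewrite h1 h2.
have [z zK Kz] := injF_bij (inj_comp v_inj u_inj).
pose c j := x j / (W (u j) * W (v (u j))).
have cF i : F0 (c (z i)) by apply: homfrac_div.
move=> e j; have e0 : \sum_i c (z i) * (w i / y t ^+ l i) = 0.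
  rewrite (reindex_inj (inj_comp v_inj u_inj)) -[RHS]e; apply: eq_bigr => i _.
  rewrite zK /c -/(W _) /=.
  have [h1 h2] := (kf_W_neq0 (u i), kf_W_neq0 (v (u i))).
  by field; rewrite h1 h2.
have := kf_free kf cF e0 ((v \o u) j); rewrite zK /c => /eqP.
have [h1 h2] := (kf_W_neq0 (u j), kf_W_neq0 (v (u j))).
by rewrite mulf_eq0 invr_eq0 mulf_eq0 (negPf h1) (negPf h2) !orbF => /eqP.
Qed.

(** Each W_j / W_i equals C_j / W_(h j) with pairwise distinct h j, so coefficients can be compared
    by [dual_free]. *)
Lemma Mmod_component (s : 'I_N -> K) r i :
  (forall j, polyring (s j)) -> F0 r -> Mmod ((\sum_j s j * W j) * (r / W i)) ->
  forall j, exists h C e, [/\ C \is e.-homog, C != 0, Phi h * Phi j = C ^+ m * Phi i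
    & polyring (s j * r * (ev C / y t ^+ e))].
Proof.
move=> sA Fr [c [cA e]].
have /choice[q qE] : forall j, exists q : 'I_N * (S * nat), [/\ q.2.1 \is (q.2.2).-homog,
    q.2.1 != 0, W q.1 * W j = ev q.2.1 / y t ^+ q.2.2 * W i
    & Phi q.1 * Phi j = q.2.1 ^+ m * Phi i].
  by move=> j; have [h [C [d ?]]] := kf_W_div i j; exists (h, (C, d)).
pose h j := (q j).1; pose C j := ev (q j).2.1 / y t ^+ (q j).2.2.
have CA j : polyring (C j) by have [hq _ _ _] := qE j; exists (q j).2.2, (q j).2.1.
have CE j : W (h j) * W j = C j * W i by case: (qE j).
have C0 j : C j != 0.
  by apply: contraNneq (mulf_neq0 (kf_W_neq0 (h j)) (kf_W_neq0 j)) => z; rewrite CE z mul0r.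
have CF j : F0 (C j) by apply: (polyring_homfrac y_generic (CA j)).
have h_inj : injective h.
  move=> a b ab; apply: kf_ratio (homfrac_div (CF a) (CF b)) _.
  apply: (mulfI (kf_W_neq0 (h a))); rewrite CE ab.
  have := CE b; have := C0 b; have := kf_W_neq0 i => hi hb eb.
  transitivity (C a / C b * (W (h b) * W b)); last by ring.
  by rewrite eb mulrA divfK.
have : \sum_j (s j * r * C j - c (h j)) / W (h j) = 0.
  under eq_bigr do rewrite mulrBl.
  rewrite sumrB.
  have -> : \sum_j c (h j) / W (h j) = \sum_j c j / W j by rewrite [RHS](reindex_inj h_inj).
  rewrite -e mulr_suml -sumrB big1 // => j _; apply/eqP; rewrite subr_eq0; apply/eqP.
  have := CE j; have := kf_W_neq0 i; have := kf_W_neq0 (h j) => hh hi ej.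
  apply: (mulIf (mulf_neq0 hi hh)); transitivity (s j * r * (C j * W i)).
    by field; exact: hh.
  by rewrite -ej; field; exact: hi.
move/dual_free => /(_ h_inj) z j; have [h1 h2 _ h4] := qE j.
exists (h j), (q j).2.1, (q j).2.2; split=> //.
have -> : s j * r * (ev (q j).2.1 / y t ^+ (q j).2.2) = c (h j); last exact: cA.
apply/eqP; rewrite -subr_eq0; apply/eqP; apply: z => j'.
apply: homfracD; last by apply/homfracN/(polyring_homfrac y_generic (cA _)).
by do 2!apply: homfracM => //; apply: (polyring_homfrac y_generic (sA _)).
Qed.

End ChartModules.

(** * Coordinate rings of a finite Kummer cover *)

Section CharPolyCoef.
Variables (K : fieldType) (A : K -> Prop).
Hypotheses (A0 : A 0) (A1 : A 1) (AN : forall f, A f -> A (- f)).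
Hypotheses (AD : forall f g, A f -> A g -> A (f + g)).
Hypotheses (AM : forall f g, A f -> A g -> A (f * g)).
Let polyA (q : {poly K}) := forall i : nat, A q`_i.

Let sumA (I : Type) (s : seq I) (P : pred I) (F : I -> K) :
  (forall i, P i -> A (F i)) -> A (\sum_(i <- s | P i) F i).
Proof. by move=> h; elim/big_ind: _. Qed.

Let polyAC c : A c -> polyA c%:P.
Proof. by move=> cA i; rewrite coefC; case: ifP. Qed.

Let polyAM p q : polyA p -> polyA q -> polyA (p * q).
Proof. by move=> pA qA i; rewrite coefM; apply: sumA => j _; apply: AM. Qed.

Let polyAD p q : polyA p -> polyA q -> polyA (p + q).
Proof. by move=> pA qA i; rewrite coefD; apply: AD. Qed.

Lemma char_poly_coef n (M : 'M[K]_n) :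
  (forall i j, A (M i j)) -> forall i : nat, A (char_poly M)`_i.
Proof.
move=> MA; rewrite -/(polyA (char_poly M)) /char_poly /determinant.
elim/big_ind: _ => [|p q pA qA|s _]; [exact: (polyAC A0) | exact: polyAD |].
apply: polyAM.
  by rewrite -(rmorph_sign (@polyC K)); apply: polyAC; case: (odd_perm s); rewrite ?expr1 ?expr0; auto.
elim/big_ind: _ => [|p q pA qA|i _]; [exact: (polyAC A1) | exact: polyAM |].
rewrite !mxE; apply: polyAD.
  by case: (_ == _) => j; rewrite ?mulr1n ?mulr0n ?coef0 // coefX; case: eqP.
by rewrite -polyCN; apply/polyAC/AN.
Qed.

End CharPolyCoef.

Section Cover.
Variables (k : closedFieldType) (X : projVariety k).
Local Notation K := (funField X).
Local Notation cstX := (@Defs.cst k X).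
Variables (n : nat) (y : 'I_n.+1 -> K).
Local Notation S := {mpoly k[n.+1]}.
Local Notation ev := (mmap cstX y).
Local Notation F0 := (homfrac cstX y).
Implicit Types (P Q : S) (f g : K) (t : 'I_n.+1) (p : 'I_(ambient X).+1 -> k).

Lemma value_at_form p (z : 'I_n.+1 -> k) (a : K) d P :
  point p -> (forall i, value_at p (a * y i) (z i)) -> P \is d.-homog ->
  value_at p (a ^+ d * ev P) P.@[z].
Proof.
by move=> Xp az hP; rewrite -(mmap_scale cstX y a hP); apply: value_at_mmap.
Qed.

(** A form that vanishes at y vanishes at every value of the map, hence on all of projective
    space. *)
Lemma surjective_generic : surjective_map y -> generic_coord cstX y.
Proof.
move=> surj d P hP P0.
have h z : (exists i, z i != 0) -> P.@[z] = 0.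
  move=> /surj[p Xp [_ [a a0 az]]]; have := value_at_form Xp az hP.
  by rewrite P0 mulr0 => /(value_at_uniq Xp); apply; apply: value_at0.
(* The factor X_0 disposes of the vectors with z_0 = 0, among them the zero vector, which is no
   point. *)
have : 'X_ord0 * P = 0.
  apply: meval_eq0 => z; rewrite mevalM mevalXU.
  have [->|z0] := eqVneq (z ord0) 0; first by rewrite mul0r.
  by rewrite h ?mulr0 //; exists ord0.
by move/eqP; rewrite mulf_eq0 (negPf (Xi_neq0 _ _)) => /eqP.
Qed.

Section Chart.
Variable t : 'I_n.+1.
Local Notation U := (chart_preim y t).
Local Notation polyring := (polyring cstX y t).

Lemma chart_point p : U p -> point p. Proof. by case. Qed.

Lemma chart_value p z : point p -> map_value y p z -> z t != 0 -> U p.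
Proof. by move=> Xp yz zt; split=> //; exists z. Qed.

Lemma polyring_value p z d P : point p -> map_value y p z -> z t != 0 ->
  P \is d.-homog -> value_at p (ev P / y t ^+ d) (P.@[z] / z t ^+ d).
Proof.
move=> Xp [_ [a a0 az]] zt hP.
have -> : ev P / y t ^+ d = a ^+ d * ev P / (a * y t) ^+ d.
  by rewrite exprMn -mulf_div divff ?mul1r // expf_neq0.
apply: value_at_div => //; first by rewrite expf_neq0.
  exact: value_at_form.
exact: value_atX.
Qed.

Lemma polyring_regular f : polyring f -> regular_on U f.
Proof.
move=> [d [P [hP ->]]] p [Xp [z yz zt]].
by exists (P.@[z] / z t ^+ d); apply: polyring_value.
Qed.

Lemma regular_onD f g : regular_on U f -> regular_on U g -> regular_on U (f + g).
Proof. by move=> hf hg p Up; apply: regular_atD (hf p Up) (hg p Up); case: Up. Qed.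

Lemma regular_onM f g : regular_on U f -> regular_on U g -> regular_on U (f * g).
Proof. by move=> hf hg p Up; apply: regular_atM (hf p Up) (hg p Up). Qed.

Hypothesis y_generic : generic_coord cstX y.
Hypothesis y_finite : finite_morphism y.
Hypothesis X_normal : normal_variety X.

Lemma regular_on_integral f (q : {poly K}) : q \is monic ->
  (forall i : nat, polyring q`_i) -> root q f -> regular_on U f.
Proof.
move=> qm qA qf p Up; apply: (X_normal (chart_point Up) qm) qf => i.
exact: polyring_regular (qA i) p Up.
Qed.

(** Multiplication by f on the module generators has a matrix over the chart ring. The generators
    form an eigenvector for f, nonzero because 1 is in their span, so f is a root of the
    characteristic polynomial. *)
Lemma integral_regular_on f : regular_on U f -> exists q : {poly K},
  [/\ q \is monic, forall i : nat, polyring q`_i & root q f].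
Proof.
move=> fU; have [_ /(_ t (coord_neq0 y_generic t))[_ [r [e [eU gen]]]]] := y_finite.
have /choice[b bE] : forall i, exists b : 'I_r -> K,
    (forall j, polyring (b j)) /\ f * e i = \sum_j b j * e j.
  by move=> i; apply: gen; apply: regular_onM.
pose M := \matrix_(i, j) b j i.
exists (char_poly M); split; first exact: char_poly_monic.
  apply: char_poly_coef.
  - exact: polyring0.
  - exact: polyring1.
  - exact: polyringN.
  - exact: polyringD.
  - exact: polyringM.
  - by move=> i j; rewrite mxE; apply: (bE j).1.
rewrite -eigenvalue_root_char; apply/eigenvalueP.
exists (\row_i e i).
  apply/rowP => i; rewrite !mxE (bE i).2; apply: eq_bigr => j _.
  by rewrite !mxE mulrC.
apply/eqP => /rowP e0; have [|c [_ e1]] := gen 1.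
  exact: (polyring_regular (polyring1 _ _ _)).
move/eqP: e1; rewrite big1 ?oner_eq0 // => i _.
by have := e0 i; rewrite !mxE => ->; rewrite mulr0.
Qed.

Variables (N m : nat) (w : 'I_N -> K) (l : 'I_N -> nat) (Phi : 'I_N -> S).
Hypothesis kf : kummer_forms cstX y m w l Phi.
Local Notation W := (kf_W y w l t).

(* A family of automorphisms over [F0] diagonalised by the [w i]. *)
Record kummer_action (Aut : {rmorphism K -> K} -> Prop) : Prop := KummerAction {
  ka_fix : forall s, Aut s -> forall f, F0 f -> s f = f;
  ka_W : forall s, Aut s -> forall i t, exists c, s (kf_W y w l t i) = cstX c * kf_W y w l t i;
  ka_proj : forall T : K -> Prop, T 0 -> (forall f g, T f -> T g -> T (f + g)) ->
    (forall c f, T f -> T (cstX c * f)) -> (forall s f, Aut s -> T f -> T (s f)) ->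
    forall t r i, (forall j, F0 (r j)) -> T (\sum_j r j * kf_W y w l t j) ->
      T (r i * kf_W y w l t i)
}.
Variable Aut : {rmorphism K -> K} -> Prop.
Hypothesis ka : kummer_action Aut.

Lemma Bring_regular f : Bring cstX y w l t f -> regular_on U f.
Proof.
move=> [r [rA ->]] p Up; have Xp := chart_point Up.
apply: regular_at_sum => // i _; apply: regular_atM; first exact: polyring_regular (rA i) p Up.
apply: (@regular_on_integral (W i) ('X^m - (W i ^+ m)%:P)) Up.
- by apply: monicXnsubC; apply: (kf_m kf).
- move=> j; rewrite coefB coefXn coefC; apply: polyringB => //.
    by case: eqP => _; [apply: polyring1 | apply: polyring0].
  case: eqP => _; last exact: polyring0.
  exists (m * l i)%N, (Phi i); split; first exact: (kf_homog kf).
  by rewrite /kf_W expr_div_n (kf_pow kf) -exprM mulnC.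
- by rewrite rootE !hornerE ?hornerXn subrr.
Qed.

(** The automorphisms preserve integrality over the chart, so [ka_proj] makes each component r_i W_i
    regular. Its m-th power lies in F0 and is integral, hence in the chart ring, and
    [power_free_integral] concludes for r_i. *)
Lemma regular_Bring f : regular_on U f -> Bring cstX y w l t f.
Proof.
move=> fU; have [r [rF fE]] := kf_span kf t f; exists r; split=> // i.
rewrite fE in fU; have : regular_on U (r i * W i).
  apply: (ka_proj ka (T := regular_on U)) rF fU.
  - by move=> p Up; apply: regular_at0.
  - exact: regular_onD.
  - move=> c g gU p Up; apply: regular_atM (gU p Up) => //.
    exact: regular_atC.
  - move=> s g sA /integral_regular_on[q [qm qA qg]].
    apply: (regular_on_integral qm qA).
    have sq : map_poly s q = q.
      apply/polyP => j; rewrite coef_map /= (ka_fix ka sA) //.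
      exact: (polyring_homfrac y_generic (qA j)).
    by rewrite -sq; rewrite fmorph_root.
move=> rW; have : regular_on U ((r i * W i) ^+ m).
  by move=> p Up; apply: regular_atX => //; [apply: rW].
move/integral_regular_on => [q [qm qA qr]].
apply: (power_free_integral y_generic (kf_m kf) (kf_form kf i)) => //.
apply: (integrally_closed y_generic _ qm qA qr).
rewrite exprMn; apply: homfracM; first exact: homfracX.
rewrite /kf_W expr_div_n (kf_pow kf) -exprM mulnC.
by apply: (@polyring_homfrac _ _ _ _ _ y_generic t); exists (m * l i)%N, (Phi i); rewrite (kf_homog kf).
Qed.

Lemma Bring_mmap q (a : 'I_q -> K) (F : {mpoly k[q]}) :
  (forall i, Bring cstX y w l t (a i)) -> Bring cstX y w l t (mmap cstX a F).
Proof.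
move=> aB; have BC c : Bring cstX y w l t (cstX c).
  exact: (Bring_polyring y_generic kf (polyringC _ _ _ _)).
apply: Bring_sum => // s _; apply: (BringM y_generic kf) => //.
rewrite /mmap1; elim/big_ind: _ => [|f g fB gB|i _].
- by rewrite -(rmorph1 cstX).
- exact: (BringM y_generic kf).
- elim: (s i) => [|j IHj]; first by rewrite expr0 -(rmorph1 cstX).
  by rewrite exprS; apply: (BringM y_generic kf).
Qed.

(* The local rings at the points over the chart are localisations of [Bring], *)
(* and the automorphisms of the cover act on these points.                     *)
Lemma local_fraction p f : U p -> regular_at p f -> exists b s c,
  [/\ Bring cstX y w l t b, Bring cstX y w l t s, value_at p s c, c != 0 & f = b / s].
Proof.
move=> Up fp.
have [_ /(_ t (coord_neq0 y_generic t))[[q [a [aU _ loc]]] _]] := y_finite.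
have aB i : Bring cstX y w l t (a i) by apply: regular_Bring => p' Up'; apply: aU.
have [F [G [z [az Gz ->]]]] := loc p Up f fp.
exists (mmap cstX a F), (mmap cstX a G), G.@[z]; split=> //; try exact: Bring_mmap.
by apply: value_at_mmap => //; apply: chart_point Up.
Qed.

(** The coordinates of p' are the values at p of the s (a i). They satisfy every relation between
    the a i, because s fixes constants, so they belong to a point of the affine open set. *)
Lemma moved_point s p : Aut s -> U p -> exists2 p', U p' &
  forall f, regular_at p' f -> regular_at p (s f).
Proof.
move=> sA Up; have Xp := chart_point Up.
have [_ /(_ t (coord_neq0 y_generic t))[[q [a [aU sur loc]]] _]] := y_finite.
have aB i : Bring cstX y w l t (a i) by apply: regular_Bring => p' Up'; apply: aU.
have s_cst c : s (cstX c) = cstX c by apply: (ka_fix ka sA); apply: homfracC.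
have s_mmap (F : {mpoly k[q]}) : s (mmap cstX a F) = mmap cstX (s \o a) F.
  apply: (@mpoly_rmorph_ext _ _ _ (s \o mmap cstX a) (mmap cstX (s \o a))) => [c|i] /=.
    by rewrite !mmapC s_cst.
  by rewrite !mmapX !mmap1U.
have sB f : Bring cstX y w l t f -> regular_at p (s f).
  move=> [r [rA ->]]; apply: (Bring_regular (f := s _)) Up.
  rewrite rmorph_sum; apply: Bring_sum => // i _; rewrite rmorphM.
  rewrite (ka_fix ka sA); last exact: (polyring_homfrac y_generic (rA i)).
  have [c ->] := ka_W ka sA i t; rewrite mulrA; apply: Bring_mon.
  by apply: polyringM => //; apply: polyringC.
have /choice[z sz] : forall i, exists c, value_at p (s (a i)) c by move=> i; apply: sB.
have [|p' Up' az] := sur z.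
  move=> F F_0; apply: (value_at_uniq Xp (f := s (mmap cstX a F))).
    by rewrite s_mmap; apply: value_at_mmap.
  by rewrite F_0 rmorph0; apply: value_at0.
exists p' => // f fp'; have [F [G [z' [az' Gz' ->]]]] := loc p' Up' f fp'.
have zz : G.@[z'] = G.@[z].
  by apply: meval_eq => i; apply: value_at_uniq (az' i) (az i); apply: chart_point Up'.
rewrite zz in Gz'; rewrite fmorph_div !s_mmap; exists (F.@[z] / G.@[z]).
by apply: value_at_div => //; apply: value_at_mmap.
Qed.

End Chart.
End Cover.

(** * Derivations and 2-forms *)

Section DerivationRules.
Variables (k : closedFieldType) (X : projVariety k).
Local Notation K := (funField X).
Local Notation cstX := (@Defs.cst k X).
Implicit Types (D E : derivation X) (f g : K).

Lemma derC D c : D (cstX c) = 0. Proof. exact: der_cst. Qed.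

Lemma derD D f g : D (f + g) = D f + D g. Proof. exact: der_add. Qed.

Lemma derM D f g : D (f * g) = D f * g + f * D g. Proof. exact: der_mul. Qed.

Lemma der0 D : D 0 = 0. Proof. by have := derC D 0; rewrite rmorph0. Qed.

Lemma der1 D : D 1 = 0. Proof. by have := derC D 1; rewrite rmorph1. Qed.

Lemma der_sum D (I : Type) (r : seq I) (P : pred I) (F : I -> K) :
  D (\sum_(i <- r | P i) F i) = \sum_(i <- r | P i) D (F i).
Proof. by apply: (big_morph _ (derD D) (der0 D)). Qed.

(** Multiplied by f so that the exponent n - 1 does not appear. *)
Lemma derX D f n : f * D (f ^+ n) = n%:R * f ^+ n * D f.
Proof.
elim: n => [|n IHn]; first by rewrite expr0 der1 mulr0 !mul0r.
by rewrite exprS derM IHn -natr1; ring.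
Qed.

Lemma der_div D f g : g != 0 -> D (f / g) = (D f * g - f * D g) / g ^+ 2.
Proof.
move=> g0; have : D (f / g * g) = D f by rewrite divfK.
rewrite derM => e; apply: (mulIf g0); have -> : D (f / g) * g = D f - f / g * D g.
  by rewrite -e addrK.
by field.
Qed.

Lemma der_mmap D n (a : 'I_n -> K) (F : {mpoly k[n]}) :
  D (mmap cstX a F) = \sum_j mmap cstX a F^`M(j) * D (a j).
Proof.
pose T (G : {mpoly k[n]}) := D (mmap cstX a G) = \sum_j mmap cstX a G^`M(j) * D (a j).
have TC c : T c%:MP.
  rewrite /T mmapC derC big1 // => j _.
  by rewrite mderivC rmorph0 mul0r.
have TD G H : T G -> T H -> T (G + H).
  rewrite /T => hG hH; rewrite rmorphD derD hG hH -big_split; apply: eq_bigr => j _.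
  by rewrite mderivD rmorphD mulrDl.
have TM G H : T G -> T H -> T (G * H).
  rewrite /T => hG hH; rewrite rmorphM derM hG hH mulr_suml mulr_sumr -big_split.
  by apply: eq_bigr => j _; rewrite mderivM rmorphD !rmorphM /=; ring.
have TX i : T 'X_i.
  rewrite /T mmapX mmap1U (bigD1 i) //= big1 ?addr0 => [|j /negPf ji]; last first.
    by rewrite mderivX mnm1E eq_sym ji scale0r rmorph0 mul0r.
  rewrite mderivX mnm1E eqxx scale1r (_ : U_(i) - U_(i) = 0)%MM.
    by rewrite mpolyX0 rmorph1 mul1r.
  by apply/mnmP => h; rewrite mnmBE mnm0E subnn.
rewrite -/(T F) [F]mpolyE; elim/big_ind: _ => [||m _]; [|exact: TD|].
  by rewrite -(mpolyC0 n); apply: TC.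
rewrite -mul_mpolyC; apply: (TM _ _ (TC _)).
rewrite mpolyXE_id; elim/big_ind: _ => [||i _]; [|exact: TM|].
  by rewrite -mpolyC1; apply: TC.
elim: (m i) => [|e IHe]; first by rewrite expr0 -mpolyC1; apply: TC.
by rewrite exprS; apply: TM.
Qed.

Lemma der_comb D E (u v : K) : exists D' : derivation X, forall f, D' f = u * D f + v * E f.
Proof.
have h1 f g : u * D (f + g) + v * E (f + g) = (u * D f + v * E f) + (u * D g + v * E g).
  by rewrite !derD; ring.
have h2 f g : u * D (f * g) + v * E (f * g) =
    (u * D f + v * E f) * g + f * (u * D g + v * E g).
  by rewrite !derM; ring.
have h3 c : u * D (cstX c) + v * E (cstX c) = 0 by rewrite !derC !mulr0 addr0.
by exists (Defs.Derivation h1 h2 h3).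
Qed.

(* Nakayama: the differentials of local parameters generate all differentials. *)
Lemma cotangent (U : ('I_(ambient X).+1 -> k) -> Prop) (p : 'I_(ambient X).+1 -> k) :
  point p -> affine_open U -> U p -> smooth_at p ->
  exists tt : 'I_2 -> K, (forall i, regular_at p (tt i)) /\
    forall u, regular_at p u -> exists al : 'I_2 -> K, (forall i, regular_at p (al i)) /\
      forall D, D u = \sum_i al i * D (tt i).
Proof.
move=> Xp [q [a [aU _ loc]]] Up [tt [tt0 gen]]; exists tt.
split; first by move=> i; exists 0.
have [z az] : exists z : 'I_q -> k, forall i, value_at p (a i) (z i).
  have /choice[z az] : forall i, exists c, value_at p (a i) c by move=> i; apply: aU.
  by exists z.
have reg_der f : regular_at p f -> exists be : 'I_q -> K, (forall j, regular_at p (be j)) /\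
    forall D, D f = \sum_j be j * D (a j).
  move=> fp; have [F [G [z' [az' Gz fE]]]] := loc p Up f fp.
  have rm (H : {mpoly k[q]}) : regular_at p (mmap cstX a H).
    by exists H.@[z]; apply: value_at_mmap.
  have Gv : value_at p (mmap cstX a G) G.@[z'] by apply: value_at_mmap.
  have G0 := value_at_neq0 Xp Gz Gv; set A := mmap cstX a F in fE *; set B := mmap cstX a G in fE G0 Gv.
  exists (fun j => (mmap cstX a F^`M(j) * B - A * mmap cstX a G^`M(j)) / B ^+ 2); split.
    move=> j; apply: regular_atM => //; first by apply: regular_atB => //; apply: regular_atM => //; apply: rm.
    by rewrite -exprVn; apply: regular_atX; exists (G.@[z'])^-1; apply: value_atV.
  move=> D; rewrite fE der_div //; have eA := der_mmap D a F; have eB := der_mmap D a G.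
  rewrite -/A in eA; rewrite -/B in eB; rewrite eA eB; clearbody A B.
  rewrite [in X in X - _]mulr_suml mulr_sumr -sumrB mulr_suml.
  by apply: eq_bigr => j _; field.
have /choice[al alE] : forall i, exists al : 'I_2 -> K, (forall l, regular_at p (al l)) /\
    a i - cstX (z i) = \sum_(l < 2) al l * tt l.
  move=> i; apply: gen; rewrite -[X in value_at _ _ X](subrr (z i)).
  by apply: value_atB => //; apply: value_atC.
have /choice[be beE] : forall il : 'I_q * 'I_2, exists be : 'I_q -> K,
    (forall j, regular_at p (be j)) /\ forall D, D (al il.1 il.2) = \sum_j be j * D (a j).
  by move=> [i l]; apply: reg_der; apply: (alE i).1.
(* M is the identity matrix modulo the maximal ideal of p, so its determinant is a unit and the
   linear system for the D (a i) can be solved in the local ring. *)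
pose M : 'M[K]_q := \matrix_(i, j) ((i == j)%:R - \sum_l tt l * be (i, l) j).
have M_val i j : value_at p (M i j) ((1%:M : 'M[k]_q) i j).
  rewrite !mxE -[(i == j)%:R in X in value_at _ _ X]subr0; apply: value_atB => //.
    by case: eqP => _; [apply: value_at1 | apply: value_at0].
  rewrite -[0 in X in value_at _ _ X](_ : \sum_(l < 2) 0 = 0); last by rewrite big1.
  apply: value_at_sum => // l _; have [c hc] := (beE (i, l)).1 j.
  by rewrite -[0 in X in value_at _ _ X](mul0r c); apply: value_atM.
have M_reg i j : regular_at p (M i j) by exists ((1%:M : 'M[k]_q) i j).
have dM : value_at p (\det M) 1 by rewrite -(det1 k q); apply: value_at_det.
have dM0 := value_at_neq0 Xp (oner_neq0 _) dM.
pose ga j l := \sum_i \adj M j i * al i l / \det M.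
have gaE D j : D (a j) = \sum_l ga j l * D (tt l).
  pose v := \col_j D (a j); pose r := \col_i \sum_l al i l * D (tt l).
  have Mv : M *m v = r.
    apply/colP => i; rewrite !mxE; under eq_bigr do rewrite !mxE mulrBl.
    rewrite sumrB (bigD1 i) //= eqxx mul1r big1 ?addr0 => [|j' /negPf ij]; last first.
      by rewrite eq_sym ij mul0r.
    have -> : D (a i) = \sum_l (D (al i l) * tt l + al i l * D (tt l)).
      transitivity (D (a i - cstX (z i) + cstX (z i))); first by rewrite subrK.
      by rewrite derD derC addr0 (alE i).2 der_sum; apply: eq_bigr => l _; rewrite derM.
    rewrite big_split /= [X in X + _ - _](_ : _ = \sum_j (\sum_l tt l * be (i, l) j) * D (a j)).
      by rewrite addrAC subrr add0r.
    under [RHS]eq_bigr do rewrite mulr_suml.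
    rewrite exchange_big; apply: eq_bigr => l _ /=; rewrite (beE (i, l)).2 mulr_suml.
    by apply: eq_bigr => j' _; ring.
  have := congr1 (mulmx (\adj M)) Mv; rewrite mulmxA mul_adj_mx mul_scalar_mx.
  move/colP/(_ j); rewrite [LHS]mxE [X in _ * X]mxE [RHS]mxE => e; apply: (mulfI dM0).
  rewrite e mulr_sumr; under eq_bigr do rewrite [r _ _]mxE mulr_sumr.
  rewrite exchange_big; apply: eq_bigr => l _; rewrite /ga mulr_suml mulr_sumr.
  by apply: eq_bigr => i _; field.
have ga_reg j l : regular_at p (ga j l).
  apply: regular_at_sum => // i _; apply: regular_atM => //; last first.
    by exists 1^-1; apply: value_atV (oner_neq0 _) dM.
  apply: regular_atM => //; last exact: (alE i).1.
  rewrite mxE /cofactor; apply: regular_atM => //.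
    by rewrite -(rmorph_sign cstX); apply: regular_atC.
  by apply: regular_at_det => // i' j'; have := M_reg (lift i i') (lift j j'); rewrite !mxE.
move=> u /reg_der[b [b_reg bE]]; exists (fun l => \sum_j b j * ga j l); split.
  by move=> l; apply: regular_at_sum => // j _; apply: regular_atM.
move=> D; rewrite bE; under eq_bigr do rewrite gaE mulr_sumr.
rewrite exchange_big; apply: eq_bigr => l _; rewrite mulr_suml.
by apply: eq_bigr => j _; rewrite mulrA.
Qed.

End DerivationRules.

(** * Coordinate derivations and 2-forms on a chart *)

Section ChartCalculus.
Variables (k : closedFieldType) (X : projVariety k).
Local Notation K := (funField X).
Local Notation cstX := (@Defs.cst k X).
Hypothesis k_char0 : [pchar k] =i pred0.
Variables (y : 'I_3 -> K).
Local Notation S := {mpoly k[3]}.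
Local Notation ev := (mmap cstX y).
Local Notation F0 := (homfrac cstX y).
Implicit Types (P Q : S) (f g u v : K) (s t : 'I_3) (D E : derivation X).
Hypothesis y_generic : generic_coord cstX y.

Let y0 t : y t != 0. Proof. exact: coord_neq0 y_generic t. Qed.

Definition chart_coord t s : K := (y t)^-1 * y s.
Local Notation x := chart_coord.

(* [Omega = sum y_t dy_a /\ dy_b] over cyclic [(t, a, b)]; on the chart [t] it *)
(* is [y_t^3 d(y_a/y_t) /\ d(y_b/y_t)].                                        *)
Let Om t D E : K :=
  y t * (D (y (ordS t)) * E (y (ordS (ordS t))) - D (y (ordS (ordS t))) * E (y (ordS t)))
  + y (ordS t) * (D (y (ordS (ordS t))) * E (y t) - D (y t) * E (y (ordS (ordS t))))
  + y (ordS (ordS t)) * (D (y t) * E (y (ordS t)) - D (y (ordS t)) * E (y t)).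

Definition Omega D E : K := Om ord0 D E.

Definition delta t D E : K :=
  D (x t (ordS t)) * E (x t (ordS (ordS t))) - D (x t (ordS (ordS t))) * E (x t (ordS t)).

Lemma ordS3 t : ordS (ordS (ordS t)) = t.
Proof. by apply/val_inj; case: t => [[|[|[|]]]]. Qed.

Lemma ord3_cases t s : [\/ s = t, s = ordS t | s = ordS (ordS t)].
Proof.
case: t s => [[|[|[|]]]] // ht [[|[|[|]]]] // hs;
  first [ by apply: Or31; apply: val_inj | by apply: Or32; apply: val_inj
        | by apply: Or33; apply: val_inj ].
Qed.

Lemma ordS_neq t : (ordS t == t = false) * (ordS (ordS t) == t = false)
  * (ordS (ordS t) == ordS t = false) * (ordS t == ordS (ordS t) = false).
Proof. by case: t => [[|[|[|]]]]. Qed.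

Lemma Omega_chart t D E : Omega D E = y t ^+ 3 * delta t D E.
Proof.
have cyc s : Om (ordS s) D E = Om s D E by rewrite /Om !ordS3; ring.
have -> : Omega D E = Om t D E.
  have [->|->|->] := ord3_cases ord0 t; rewrite /Omega ?cyc //.
have dx D' s : D' (x t s) = (D' (y s) * y t - y s * D' (y t)) / y t ^+ 2.
  by rewrite /x mulrC der_div.
by rewrite /delta !dx /Om; field; apply: y0.
Qed.

Lemma evx t d P : P \is d.-homog -> mmap cstX (x t) P = ev P / y t ^+ d.
Proof. by move=> hP; rewrite (mmap_scale cstX y _ hP) exprVn mulrC. Qed.

Variables (N m : nat) (w : 'I_N -> K) (l : 'I_N -> nat) (Phi : 'I_N -> S).
Hypothesis kf : kummer_forms cstX y m w l Phi.

Let m_neq0 : m%:R != 0 :> K.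
Proof.
rewrite -(rmorph_nat cstX) fmorph_eq0; move/pcharf0P: k_char0 => ->.
by have := kf_m kf; rewrite lt0n.
Qed.

Section Chart.
Variable t : 'I_3.
Local Notation W := (kf_W y w l t).
Local Notation polyring := (polyring cstX y t).
Local Notation a := (ordS t).
Local Notation b := (ordS (ordS t)).

Lemma x_tt : x t t = 1. Proof. by rewrite /x mulVf. Qed.

Lemma W_pow i : W i ^+ m = ev (Phi i) / y t ^+ (m * l i).
Proof. by rewrite /kf_W expr_div_n (kf_pow kf) -exprM mulnC. Qed.

(** D kills F0, which is generated by the affine coordinates, and then each [W i], whose m-th power
    lies in F0; these span K. *)
Lemma der_eq0 D : D (x t a) = 0 -> D (x t b) = 0 -> forall f, D f = 0.
Proof.
move=> Da Db; have Dx s : D (x t s) = 0.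
  by have [->|->|->//] := ord3_cases t s; rewrite // x_tt der1.
have DF f : F0 f -> D f = 0.
  move=> [d [P [Q [hP hQ Q0 ->]]]].
  have yd : y t ^+ d != 0 by rewrite expf_neq0.
  have -> : ev P / ev Q = mmap cstX (x t) P / mmap cstX (x t) Q.
    by rewrite !(evx t (d := d)) // invf_div mulrA divfK.
  have D0 (R : S) : D (mmap cstX (x t) R) = 0.
    by rewrite der_mmap big1 // => s _; rewrite Dx mulr0.
  by rewrite der_div ?D0 ?mul0r ?mulr0 ?subrr ?mul0r // (evx t hQ) mulf_neq0 ?invr_neq0.
have DW i : D (W i) = 0.
  have := derX D (W i) m; rewrite W_pow DF ?mulr0; last first.
    by apply: (@polyring_homfrac _ _ _ _ _ y_generic t); exists (m * l i)%N, (Phi i); rewrite (kf_homog kf).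
  move/esym/eqP; rewrite -W_pow mulf_eq0 mulf_eq0 (negPf m_neq0) /=.
  by rewrite expf_eq0 (negPf (kf_W_neq0 y_generic kf t i)) andbF => /eqP.
move=> f; have [r [rF ->]] := kf_span kf t f.
rewrite der_sum big1 // => i _; rewrite derM (DF _ (rF i)) -/(W i) DW.
by rewrite mul0r mulr0 addr0.
Qed.

Section Direction.
Variables (D : derivation X) (s0 : 'I_3).
Hypothesis Dx : forall s, D (x t s) = (s == s0)%:R.

Lemma der_form d P : P \is d.-homog -> D (ev P / y t ^+ d) = ev P^`M(s0) * y t / y t ^+ d.
Proof.
move=> hP; rewrite -(evx t hP) der_mmap (bigD1 s0) //= Dx eqxx mulr1 big1 ?addr0; last first.
  by move=> s /negPf; rewrite Dx => ->; rewrite mulr0.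
rewrite (evx t (dhomog_mderiv s0 hP)); case: d hP => [|d] hP.
  by rewrite (dhomog0_const hP) mderivC rmorph0 !mul0r.
have yd : y t ^+ d != 0 by rewrite expf_neq0.
by rewrite /= exprS; field; rewrite yd y0.
Qed.

Lemma der_polyring f : polyring f -> polyring (D f).
Proof.
move=> [d [P [hP ->]]]; rewrite (der_form hP); exists (d.-1 + 1)%N, (P^`M(s0) * 'X_t).
case: d hP => [|d] hP.
  by rewrite (dhomog0_const hP) mderivC !mul0r rmorph0 !mul0r rpred0.
by rewrite dhomogM ?dhomogXi ?(dhomog_mderiv s0 hP) // rmorphM /= evX addn1.
Qed.

Lemma der_homfrac f : F0 f -> F0 (D f).
Proof.
move=> [d [P [Q [hP hQ Q0 ->]]]]; have yd : y t ^+ d != 0 by rewrite expf_neq0.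
have -> : ev P / ev Q = (ev P / y t ^+ d) / (ev Q / y t ^+ d) by rewrite invf_div mulrA divfK.
rewrite der_div ?mulf_neq0 ?invr_neq0 //.
have hp (R : S) : R \is d.-homog -> F0 (ev R / y t ^+ d) /\ F0 (D (ev R / y t ^+ d)).
  move=> hR; have pR : polyring (ev R / y t ^+ d) by exists d, R.
  by split; apply: (polyring_homfrac y_generic (t := t)) => //; apply: der_polyring.
have [[p1 p2] [q1 q2]] := (hp P hP, hp Q hQ).
apply: homfrac_div; last exact: homfracX.
by apply: homfracD; [apply: homfracM | apply/homfracN/homfracM].
Qed.

(** The logarithmic derivative of [W i] in the direction s0, see [der_W]. *)
Definition logder i : K := ev (Phi i)^`M(s0) * y t / (m%:R * ev (Phi i)).

Lemma logder_homfrac i : F0 (logder i).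
Proof.
have hP := kf_homog kf i; have P0 := ev_neq0 y_generic hP (kf_Phi0 kf i).
have -> : logder i = cstX m%:R^-1 * (D (ev (Phi i) / y t ^+ (m * l i))
    / (ev (Phi i) / y t ^+ (m * l i))).
  rewrite (der_form hP) fmorphV rmorph_nat /logder.
  have yd : y t ^+ (m * l i) != 0 by rewrite expf_neq0.
  by field; rewrite P0 yd m_neq0.
have pR : polyring (ev (Phi i) / y t ^+ (m * l i)) by exists (m * l i)%N, (Phi i).
apply: homfracM; first exact: homfracC.
apply: homfrac_div; last exact: (polyring_homfrac y_generic pR).
exact/(polyring_homfrac y_generic (t := t))/der_polyring.
Qed.

Lemma der_W i : D (W i) = W i * logder i.
Proof.
have hP := kf_homog kf i; have P0 := ev_neq0 y_generic hP (kf_Phi0 kf i).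
have W0 := kf_W_neq0 y_generic kf t i; have Wm0 := expf_neq0 m W0.
have yd : y t ^+ (m * l i) != 0 by rewrite expf_neq0.
apply: (mulfI (mulf_neq0 m_neq0 Wm0)); rewrite -derX W_pow (der_form hP) /logder.
by field; rewrite P0 yd m_neq0.
Qed.

Variables (Aut : {rmorphism K -> K} -> Prop).
Hypothesis ka : kummer_action y w l Aut.

(** D multiplies [W i] by an element of F0, while an automorphism scales it by a constant and fixes
    F0. *)
Lemma der_aut (sg : {rmorphism K -> K}) f : Aut sg -> sg (D f) = D (sg f).
Proof.
move=> sA; have [r [rF ->]] := kf_span kf t f.
rewrite der_sum !rmorph_sum der_sum; apply: eq_bigr => i _; rewrite -/(W i).
have [c cE] := ka_W ka sA i t; have fx := ka_fix ka sA; have DW := der_W i.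
move: (W i) DW cE => V DW cE; rewrite derM rmorphD !rmorphM DW rmorphM (fx _ (rF i)).
by rewrite (fx _ (logder_homfrac i)) (fx _ (der_homfrac (rF i))) cE !derM derC DW; ring.
Qed.

End Direction.

Variables (da db : derivation X).
Hypothesis dax : forall s, da (x t s) = (s == a)%:R.
Hypothesis dbx : forall s, db (x t s) = (s == b)%:R.

Lemma der_decomp D f : D f = D (x t a) * da f + D (x t b) * db f.
Proof.
have [D1 D1E] := der_comb da db (D (x t a)) (D (x t b)).
have [D2 D2E] := der_comb D D1 1 (-1).
apply/eqP; rewrite -D1E -subr_eq0 -[D f]mul1r -mulN1r -D2E; apply/eqP/der_eq0.
  by rewrite D2E D1E dax dbx eqxx !ordS_neq /=; ring.
by rewrite D2E D1E dax dbx eqxx !ordS_neq /=; ring.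
Qed.

Definition jacobian u v : K := da u * db v - db u * da v.

Lemma wedge u v D E : D u * E v - D v * E u = jacobian u v * delta t D E.
Proof.
rewrite (der_decomp D u) (der_decomp D v) (der_decomp E u) (der_decomp E v).
by rewrite /jacobian /delta; ring.
Qed.

Lemma jacobian_coord : jacobian (x t a) (x t b) = 1.
Proof. by rewrite /jacobian !dax !dbx !eqxx !ordS_neq /=; ring. Qed.

Lemma jacobian_xb u : jacobian u (x t b) = da u.
Proof. by rewrite /jacobian dax dbx eqxx !ordS_neq /=; ring. Qed.

Lemma jacobian_xa u : jacobian (x t a) u = db u.
Proof. by rewrite /jacobian dax dbx eqxx !ordS_neq /=; ring. Qed.

End Chart.

(** The partial derivatives arise by inverting the 2 x 2 matrix of the values of D and E on the
    affine coordinates, whose determinant is [delta]. *)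
Lemma chart_derivations t D E : Omega D E != 0 -> exists da db : derivation X,
  (forall s, da (x t s) = (s == ordS t)%:R) /\ (forall s, db (x t s) = (s == ordS (ordS t))%:R).
Proof.
rewrite (Omega_chart t) => O0; have {O0} : delta t D E != 0.
  by apply: contraNneq O0 => ->; rewrite mulr0.
rewrite /delta; set A := D (x t (ordS t)); set B := D (x t (ordS (ordS t))).
set A' := E (x t (ordS t)); set B' := E (x t (ordS (ordS t))) => d0.
have [da daE] := der_comb D E (B' / (A * B' - B * A')) (- B / (A * B' - B * A')).
have [db dbE] := der_comb D E (- A' / (A * B' - B * A')) (A / (A * B' - B * A')).
have tt D' : D' (x t t) = 0 by rewrite x_tt der1.
exists da, db; split=> s; rewrite ?daE ?dbE.
  have [->|->|->] := ord3_cases t s; rewrite ?tt ?ordS_neq ?eqxx -/A -/B -/A' -/B'.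
  - by rewrite eq_sym ordS_neq /=; ring.
  - by rewrite /=; field.
  - by rewrite /=; field.
have [->|->|->] := ord3_cases t s; rewrite ?tt ?ordS_neq ?eqxx -/A -/B -/A' -/B'.
- by rewrite eq_sym ordS_neq /=; ring.
- by rewrite /=; field.
- by rewrite /=; field.
Qed.

End ChartCalculus.

(** * The forms dx_a /\ dx_b / W_i are regular *)

Section CanonicalForms.
Variables (k : closedFieldType) (X : projVariety k).
Local Notation K := (funField X).
Local Notation cstX := (@Defs.cst k X).
Hypothesis k_char0 : [pchar k] =i pred0.
Variables (y : 'I_3 -> K).
Local Notation S := {mpoly k[3]}.
Local Notation ev := (mmap cstX y).
Local Notation F0 := (homfrac cstX y).
Implicit Types (P Q : S) (f g u v : K) (t s : 'I_3) (D E : derivation X)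
  (p : 'I_(ambient X).+1 -> k).
Hypothesis y_generic : generic_coord cstX y.
Hypothesis y_finite : finite_morphism y.
Hypothesis X_normal : normal_variety X.
Hypothesis X_smooth : forall p, point p -> smooth_at p.
Variables (N m : nat) (w : 'I_N -> K) (l : 'I_N -> nat) (Phi : 'I_N -> S).
Hypothesis kf : kummer_forms cstX y m w l Phi.
Variable Aut : {rmorphism K -> K} -> Prop.
Hypothesis ka : kummer_action y w l Aut.

Let y0 t : y t != 0. Proof. exact: coord_neq0 y_generic t. Qed.

Let m_neq0 : m%:R != 0 :> k.
Proof. by move/pcharf0P: k_char0 => ->; have := kf_m kf; rewrite lt0n. Qed.

Section Chart.
Variable t : 'I_3.
Local Notation W := (kf_W y w l t).
Local Notation polyring := (polyring cstX y t).
Local Notation Bring := (Bring cstX y w l t).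
Local Notation U := (chart_preim y t).
Local Notation a := (ordS t).
Local Notation b := (ordS (ordS t)).
Local Notation x := (chart_coord y t).

Lemma Bring_coef r : (forall i, F0 (r i)) -> Bring (\sum_i r i * W i) ->
  forall i, polyring (r i).
Proof.
move=> rF [q [qA e]] i; suff /eqP : r i - q i = 0 by rewrite subr_eq0 => /eqP ->.
have qF j : F0 (q j) := polyring_homfrac y_generic (qA j).
apply: (kf_free kf (t := t) (r := fun j => r j - q j)).
  by move=> j; apply: homfracD => //; apply: homfracN.
under eq_bigr do rewrite mulrBl.
by rewrite sumrB; apply/eqP; rewrite subr_eq0; apply/eqP.
Qed.

(** [log_derivative_test] with Phi_j for P and C for F: since the exponents of Phi_i and Phi_j are
    below m, C has exponent at most 1 at every prime, and 0 at those not dividing Phi_j. *)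
Lemma polyring_of_logder i j C e r :
  C \is e.-homog -> C != 0 -> Phi i * Phi j = C ^+ m -> F0 r ->
  polyring (r * (ev C / y t ^+ e)) ->
  (forall s, s != t -> polyring (r * (ev C / y t ^+ e) * logder y m Phi t s j)) ->
  polyring r.
Proof.
move=> hC C0 ijC rF h1 h2; apply: (vint_polyring y_generic rF) => p pp nX.
have mu : (m * mult p C = mult p (Phi i) + mult p (Phi j))%N.
  by rewrite -multX // -ijC multM // (kf_Phi0 kf).
have [mi mj] := (kf_mult kf i pp, kf_mult kf j pp).
apply: (log_derivative_test k_char0 y_generic pp nX (kf_homog kf j) (kf_Phi0 kf j) hC C0 _ _ rF).
- by move=> e0; move: mu mi; rewrite e0; clear; nia.
- by move: mu mi mj; clear; nia.
- exact: (polyring_vint pp nX h1).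
move=> s st; set A := r * _ in h1 h2 *.
have -> : A * (ev (Phi j)^`M(s) * y t / ev (Phi j)) = cstX m%:R * (A * logder y m Phi t s j).
  have P0 := ev_neq0 y_generic (kf_homog kf j) (kf_Phi0 kf j).
  have mK : m%:R != 0 :> K by rewrite -(rmorph_nat cstX) fmorph_eq0.
  by rewrite rmorph_nat /logder; field; rewrite P0 mK.
by apply: (vintM pp); [apply: vintC | apply: (polyring_vint pp nX); apply: h2].
Qed.

Variables (da db : derivation X).
Hypothesis dax : forall s, da (x s) = (s == a)%:R.
Hypothesis dbx : forall s, db (x s) = (s == b)%:R.
Local Notation Jac := (jacobian da db).

Lemma coord_regular p s : U p -> regular_at p (x s).
Proof.
move=> Up; apply: (polyring_regular (t := t) (y := y)) => //; exists 1%N, 'X_s; split.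
  exact: dhomogXi.
by rewrite evX expr1 mulrC.
Qed.

(** For local parameters u, v at p, [cotangent] shows that du /\ dv generates the regular 2-forms;
    [ga] is the coefficient of dx_a /\ dx_b with respect to it. *)
Lemma canonical_generator p : U p -> exists u v ga, [/\ regular_at p u, regular_at p v,
  regular_at p ga, ga * Jac u v = 1
  & forall u' v', regular_at p u' -> regular_at p v' -> regular_at p (ga * Jac u' v')].
Proof.
move=> Up; have Xp := chart_point Up.
have [_ /(_ t (y0 t))[aU _]] := y_finite.
have [tt [ttr gen]] := cotangent Xp aU Up (X_smooth Xp).
exists (tt ord0), (tt ord_max).
have JE u v : regular_at p u -> regular_at p v ->
    exists2 c, regular_at p c & Jac u v = c * Jac (tt ord0) (tt ord_max).
  move=> /gen[al [alr alE]] /gen[be [ber beE]].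
  exists (al ord0 * be ord_max - al ord_max * be ord0).
    by apply: regular_atB => //; apply: regular_atM.
  rewrite /jacobian !alE !beE !big_ord_recl !big_ord0 !addr0.
  by rewrite (_ : lift ord0 ord0 = ord_max); [ring | apply: val_inj].
have [ga gar] := JE _ _ (coord_regular a Up) (coord_regular b Up).
rewrite (jacobian_coord dax dbx) => /esym gaE; exists ga; split=> //.
move=> u v /JE h /h[c cr ->]; rewrite [_ * (c * _)]mulrCA gaE mulr1 //.
Qed.

(** For [ga] from [canonical_generator], this is the regularity of dx_a /\ dx_b / W_i at p. With j
    the inverse class of i, the products of [ga] with W_j and with its partial derivatives are
    regular. After multiplication by functions s1, s2 that do not vanish at p they lie in [Bring],
    and the components of s1 * s2 * ga / W_i pass [polyring_of_logder]. *)
Lemma theta_regular p ga i : U p -> regular_at p ga ->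
  (forall u v, regular_at p u -> regular_at p v -> regular_at p (ga * Jac u v)) ->
  regular_at p (ga / W i).
Proof.
move=> Up gar gaJ; have Xp := chart_point Up.
have [j [C [e [hC C0 le wE PE]]]] := kf_invC y_generic kf i.
have W0 h : W h != 0 := kf_W_neq0 y_generic kf t h.
have Wr h : regular_at p (W h) := Bring_regular y_generic X_normal kf (Bring_W _ _ _ _ _ h) Up.
have WW : W i * W j = ev C / y t ^+ e by rewrite /kf_W mulf_div -exprD le wE.
have dr s : s != t -> regular_at p (ga * (W j * logder y m Phi t s j)).
  have [->|->|->] := ord3_cases t s; rewrite ?eqxx // => _.
    rewrite -(der_W k_char0 y_generic kf dax) -(jacobian_xb dax dbx).
    by apply: gaJ => //; apply: coord_regular.
  rewrite -(der_W k_char0 y_generic kf dbx) -(jacobian_xa dax dbx).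
  by apply: gaJ => //; apply: coord_regular.
have frac f : regular_at p f -> exists g c, [/\ Bring g, value_at p g c, c != 0 & Bring (g * f)].
  move=> /(local_fraction y_generic y_finite X_normal kf ka Up)[f1 [g [c [f1B gB gc c0 ->]]]].
  by exists g, c; split=> //; rewrite mulrC divfK //; apply: value_at_neq0 gc.
have [s1 [c1 [s1B s1c c10 B1]]] := frac _ (regular_atM gar (Wr j)).
have [s2 [c2 [s2B s2c c20 B2]]] : exists g c, [/\ Bring g, value_at p g c, c != 0
    & forall q, q != t -> Bring (g * (ga * (W j * logder y m Phi t q j)))].
  have at_ : a != t by rewrite ordS_neq.
  have bt_ : b != t by rewrite ordS_neq.
  have [s2 [c2 [s2B s2c c20 B2]]] := frac _ (dr a at_).
  have [s3 [c3 [s3B s3c c30 B3]]] := frac _ (dr b bt_).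
  exists (s2 * s3), (c2 * c3); split; rewrite ?mulf_neq0 //.
  - exact: (BringM y_generic kf).
  - exact: value_atM.
  move=> q; have [->|->|->] := ord3_cases t q; rewrite ?eqxx // => _.
    by rewrite mulrAC [s2 * _ * s3]mulrC; apply: (BringM y_generic kf).
  by rewrite -mulrA; apply: (BringM y_generic kf).
have s0 : s1 * s2 != 0 by rewrite mulf_neq0 ?(value_at_neq0 Xp _ s1c) ?(value_at_neq0 Xp _ s2c).
suff Bth : Bring (s1 * s2 * (ga / W i)).
  rewrite -[ga / W i](mulfK s0) [_ * (s1 * s2)]mulrC.
  apply: regular_atM; first exact: (Bring_regular y_generic X_normal kf Bth Up).
  by exists (c1 * c2)^-1; apply: value_atV; [rewrite mulf_neq0 | apply: value_atM].
have [r [rF rE]] := kf_span kf t (s1 * s2 * (ga / W i)).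
exists r; split=> // q.
have Ft : F0 (ev C / y t ^+ e).
  by apply: (polyring_homfrac y_generic (t := t)); exists e, C.
have FC q' : F0 (r q' * (ev C / y t ^+ e)) by apply: homfracM.
have rew g : g * (s1 * s2 * (ga / W i)) = \sum_q' r q' * g * W q'.
  by rewrite rE mulr_sumr; apply: eq_bigr => q' _; rewrite /kf_W; ring.
apply: (polyring_of_logder hC C0 PE) => //.
  apply: (Bring_coef (r := fun q' => r q' * (ev C / y t ^+ e))) => //.
  rewrite -rew -WW (_ : _ * _ = s2 * (s1 * (ga * W j))); last by field.
  exact: (BringM y_generic kf).
move=> s st; apply: (Bring_coef (r := fun q' => r q' * (ev C / y t ^+ e) * logder y m Phi t s j)).
  move=> q'; apply: homfracM => //; have [e1|->|->] := ord3_cases t s.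
  - by rewrite e1 eqxx in st.
  - exact: (logder_homfrac k_char0 y_generic kf dax).
  - exact: (logder_homfrac k_char0 y_generic kf dbx).
under eq_bigr do rewrite -[r _ * _ * logder _ _ _ _ _ _]mulrA.
rewrite -rew -WW (_ : _ * _ = s1 * (s2 * (ga * (W j * logder y m Phi t s j)))); last by field.
by apply: (BringM y_generic kf) => //; apply: B2.
Qed.

End Chart.

Hypothesis Omega_neq0 : exists D E, Omega y D E != 0.

(* The adjunction [omega_X = (+)_i O(l_i - 3) w_i^-1]; this is its easy half. *)
Lemma canonical_section_of_form i d P : P \is d.-homog -> (d + 3 = l i)%N ->
  pluricanonical_section 1 (fun D E => ev P / w i * Omega y D E).
Proof.
move=> hP dl p Xp; have [z yz] := y_finite.1 p Xp; have [[t zt] _] := yz.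
have Up := chart_value Xp yz zt.
have [D0 [E0 O0]] := Omega_neq0.
have [da [db [dax dbx]]] := chart_derivations y_generic t O0.
have [u [v [ga [ur vr gar gaE gaJ]]]] := canonical_generator dax dbx Up.
have th := theta_regular dax dbx i Up gar gaJ.
exists 1%N, (fun=> ev P / y t ^+ d * (ga / kf_W y w l t i)), (fun _ _ => u), (fun _ _ => v).
split=> // [_|D E].
  by apply: regular_atM => //; apply: (polyring_regular (t := t)) Up; exists d, P.
rewrite !big_ord_recl !big_ord0 addr0 mulr1 (wedge k_char0 y_generic kf dax dbx).
rewrite (Omega_chart y_generic t) /kf_W -dl exprD; move: gaE; set J := jacobian _ _ _ _ => gaE.
rewrite [RHS](_ : _ = ev P / y t ^+ d / w i * (y t ^+ d * y t ^+ 3) * (ga * J) * delta y t D E); last first.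
  by rewrite !invf_div; ring.
have yd : y t ^+ d != 0 by rewrite expf_neq0.
by rewrite gaE; move: yd; move: (y t ^+ d) (kf_w0 kf i) => Y ? ?; field; apply/andP.
Qed.
End CanonicalForms.

(** * Zeros of primes and coprimality of coordinates *)

Section FormLemmas.
Variables (k : closedFieldType) (n : nat).
Local Notation S := {mpoly k[n.+1]}.
Implicit Types (P Q p : S) (s t : 'I_n.+1).

(* Restrict [p] to a line parallel to the hyperplane [X_t = 0] through the [t]-axis. *)
Lemma zero_off_coord p t : hprime p -> ~ edvd p 'X_t ->
  exists z : 'I_n.+1 -> k, p.@[z] = 0 /\ z t != 0.
Proof.
move=> pp nX; apply: contrapT => h.
have nz z : z t != 0 -> p.@[z] != 0 by move=> zt; apply/negP => /eqP e; apply: h; exists z.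
have [_ [d hp]] := pp; pose et : 'I_n.+1 -> k := fun j => (j == t)%:R.
have pE z : z t != 0 -> p.@[z] = z t ^+ d * p.@[et].
  move=> zt; pose L (x : k) j := (j == t)%:R * z t + x * ((j != t)%:R * z j).
  pose q : {poly k} := mmap (@polyC k)
    (fun j => ((j == t)%:R * z t)%:P + 'X * ((j != t)%:R * z j)%:P) p.
  have qE x : q.[x] = p.@[L x].
    apply: (@mpoly_rmorph_ext _ _ _ (horner_eval x \o
      mmap (@polyC k) (fun j => ((j == t)%:R * z t)%:P + 'X * ((j != t)%:R * z j)%:P))
      (meval (L x))) => [c|j] /=.
      by rewrite mmapC mevalC /horner_eval hornerC.
    by rewrite mmapX mmap1U mevalXU /horner_eval !hornerE /L mulrA.
  (* If p has no zero with z_t nonzero, its restriction to the line has no root and is constant.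
     Hence p agrees with a multiple of X_t^d wherever z_t is nonzero. *)
  have sq : size q == 1.
    apply/negPn/negP => /closed_rootP[x]; rewrite rootE qE; apply/negP/nz.
    by rewrite /L eqxx mul1r mul0r mulr0 addr0.
  have [c _ qc] : exists2 c, c != 0 & q = c%:P by apply/size_poly1P.
  have -> : p.@[z] = q.[1].
    rewrite qE; apply: meval_eq => j; rewrite /L mul1r.
    by have [->|_] := eqVneq j t; rewrite /= mul0r mul1r ?addr0 ?add0r.
  have -> : q.[1] = q.[0] by rewrite qc !hornerC.
  rewrite qE -[_ ^+ d * _](mmap_scale idfun _ _ hp).
  by apply: meval_eq => j; rewrite /L mul0r addr0 mulrC.
have e0 : 'X_t * (p - p.@[et] *: 'X_t ^+ d) = 0.
  apply: meval_eq0 => z; rewrite mevalM mevalB mevalZ rmorphXn /= mevalXU.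
  have [->|zt] := eqVneq (z t) 0; first by rewrite mul0r.
  by rewrite (pE z) //; ring.
move/eqP: e0; rewrite mulf_eq0 (negPf (Xi_neq0 _ _)) subr_eq0 => /eqP pX.
have c0 : p.@[et] != 0 by apply: contraTneq (hprime_neq0 pp) => c0; rewrite pX c0 scale0r eqxx.
apply: nX; have [pr _] := pp; apply: (prime_edvd_exp pr (n := d)).
exists (p.@[et]^-1)%:MP; rewrite mul_mpolyC [X in _ *: X]pX scalerA mulVf ?scale1r //.
Qed.

(** X_t^b divides the left side and is coprime to X_s, so it divides P, whose degree is too
    small. *)
Lemma coprime_coords s t P Q c a b : s != t -> P \is c.-homog -> (c < b)%N ->
  P * 'X_s ^+ a = Q * 'X_t ^+ b -> P = 0.
Proof.
move=> st hP cb e; apply/mpolyP => nu; rewrite mcoeff0.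
have [nc|nc] := eqVneq (mdeg nu) c; last exact: dhomog_nemf_coeff hP nc.
have := congr1 (fun R : S => R@_(U_(s) *+ a + nu)) e; rewrite !mpolyXn mcoeffMX => ->.
apply: memN_msupp_eq0; apply: contraL cb; rewrite (perm_mem (msuppMX _ _)) -leqNgt.
case/mapP => m' _ /mnmP/(_ t); rewrite !mnmDE !mulmnE !mnm1E eqxx (negPf st) mul0n add0n mul1n.
by move=> nut; rewrite -nc mdegE (bigD1 t) //= nut -addnA leq_addr.
Qed.

End FormLemmas.

(* The [k1 * k2] terms cancel. *)
Lemma wedge_poles (K : fieldType) (g c c' M w1 w2 k1 k2 r r' ma mb na nb a b a' b' : K) :
  w1 != 0 -> w2 != 0 -> M != 0 ->
  g * (((a * w1 + r * (w1 * (c / M * k1 + ma))) * (b' * w2 + r' * (w2 * (c' / M * k2 + nb)))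
      - (b * w1 + r * (w1 * (c / M * k2 + mb))) * (a' * w2 + r' * (w2 * (c' / M * k1 + na))))
    / (w1 * w2)) =
  g * ((a + r * ma) * (b' + r' * nb) - (b + r * mb) * (a' + r' * na))
  + r / M * (g * c * k1 * (b' + r' * nb) - g * c * k2 * (a' + r' * na))
  + r' / M * (g * c' * k2 * (a + r * ma) - g * c' * k1 * (b + r * mb)).
Proof. by move=> w10 w20 M0; field; rewrite w10 w20 M0. Qed.

(** * Jacobians of functions have no poles beyond those of 1 / W_i *)

Section JacobianPoles.
Variables (k : closedFieldType) (X : projVariety k).
Local Notation K := (funField X).
Local Notation cstX := (@Defs.cst k X).
Hypothesis k_char0 : [pchar k] =i pred0.
Variables (y : 'I_3 -> K).
Local Notation S := {mpoly k[3]}.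
Local Notation ev := (mmap cstX y).
Local Notation F0 := (homfrac cstX y).
Implicit Types (P Q : S) (f g u v : K) (s : 'I_3).
Hypothesis y_generic : generic_coord cstX y.
Variables (N m : nat) (w : 'I_N -> K) (l : 'I_N -> nat) (Phi : 'I_N -> S).
Hypothesis kf : kummer_forms cstX y m w l Phi.
Variable t : 'I_3.
Local Notation W := (kf_W y w l t).
Local Notation polyring := (polyring cstX y t).
Local Notation Bring := (Bring cstX y w l t).
Local Notation Mmod := (Mmod cstX y w l t).
Local Notation vint := (vint cstX y).
Local Notation a := (ordS t).
Local Notation b := (ordS (ordS t)).
Local Notation x := (chart_coord y t).

Let y0 : y t != 0. Proof. exact: coord_neq0 y_generic t. Qed.

Let m_neq0 : m%:R != 0 :> K.
Proof.
rewrite -(rmorph_nat cstX) fmorph_eq0; move/pcharf0P: k_char0 => ->.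
by have := kf_m kf; rewrite lt0n.
Qed.

Section AtPrime.
Variable p : S.
Hypotheses (pp : hprime p) (nX : ~ edvd p 'X_t).

Lemma vint_coordV d Q : Q \is d.-homog -> ~ edvd p Q -> vint p (ev Q / y t ^+ d)^-1.
Proof.
move=> hQ nQ; exists d, ('X_t ^+ d), Q; split=> //; first exact: dhomogXin.
by rewrite rmorphXn /= evX invf_div.
Qed.

Lemma vint_form d Q : Q \is d.-homog -> vint p (ev Q / y t ^+ d).
Proof. by move=> hQ; apply: (polyring_vint pp nX); exists d, Q. Qed.

Lemma vint_edvd_form d e P : P \is d.-homog -> p \is e.-homog -> edvd p P ->
  vint p (ev P / y t ^+ d / (ev p / y t ^+ e)).
Proof.
move=> hP hp [A PE]; have [P0|P0] := eqVneq P 0.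
  by rewrite P0 rmorph0 !mul0r; apply: vint0.
have := hP; rewrite PE => hAp; have [|i [j [hA hj ij]]] := dhomogM_inv _ hAp; first by rewrite -PE.
have je : j = e := dhomog_uniq (hprime_neq0 pp) hj hp.
have -> : ev (A * p) / y t ^+ d / (ev p / y t ^+ e) = ev A / y t ^+ i.
  have p0 := ev_neq0 y_generic hp (hprime_neq0 pp).
  have [yi ye] : y t ^+ i != 0 /\ y t ^+ e != 0 by rewrite !expf_neq0.
  by rewrite -ij je exprD rmorphM /=; field; rewrite p0 yi ye.
exact: vint_form.
Qed.

Section Direction.
Variables (D : derivation X) (s0 : 'I_3).
Hypothesis Dx : forall s, D (x s) = (s == s0)%:R.

Lemma vint_der f : vint p f -> vint p (D f).
Proof.
move=> [d [P [Q [hP hQ nQ ->]]]]; have yd : y t ^+ d != 0 by rewrite expf_neq0.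
have Q0 : ev Q / y t ^+ d != 0 by rewrite mulf_neq0 ?invr_neq0 // (vint_den y_generic hQ nQ).
have -> : ev P / ev Q = (ev P / y t ^+ d) / (ev Q / y t ^+ d) by rewrite invf_div mulrA divfK.
have Dv R : R \is d.-homog -> vint p (D (ev R / y t ^+ d)).
  move=> hR; apply: (polyring_vint pp nX); apply: (der_polyring y_generic Dx).
  by exists d, R.
rewrite der_div // -[X in _ * X]exprVn; apply: (vintM pp).
  by apply: (vintB y_generic pp); apply: (vintM pp) => //; [apply: Dv|apply: vint_form|apply: vint_form|apply: Dv].
exact/(vintX pp)/vint_coordV.
Qed.

(* Only the exponent of [p] in [Phi i] contributes to the polar part of [D W_i / W_i]. *)
Lemma log_pole i e : p \is e.-homog -> let pt := ev p / y t ^+ e in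
  exists2 mu, vint p mu &
    D (W i) = W i * ((mult p (Phi i))%:R / m%:R * (D pt / pt) + mu).
Proof.
move=> hp pt; have [Q [QE nQ]] := multE pp (kf_Phi0 kf i); set c := mult p _ in QE *.
have [||a' [d [ha hQ ad]]] := @dhomogM_inv _ _ (p ^+ c) Q (m * l i).
- by rewrite -QE (kf_Phi0 kf).
- by rewrite -QE (kf_homog kf).
have pc0 : p ^+ c != 0 by rewrite expf_neq0 ?hprime_neq0.
have ac : a' = (e * c)%N := dhomog_uniq pc0 ha (dhomogMn c hp).
pose q := ev Q / y t ^+ d.
have pt0 : pt != 0 by rewrite mulf_neq0 ?invr_neq0 ?expf_neq0 // (ev_neq0 y_generic hp) ?hprime_neq0.
have Q0 : Q != 0 by apply/eqP => Q0; apply: nQ; rewrite Q0; apply: edvd0.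
have q0 : q != 0 by rewrite mulf_neq0 ?invr_neq0 ?expf_neq0 // (ev_neq0 y_generic hQ).
have WE : W i ^+ m = pt ^+ c * q.
  rewrite (W_pow kf) /pt /q QE rmorphM rmorphXn /= -ad ac exprD expr_div_n -exprM.
  by rewrite mulf_div.
exists (D q / q / m%:R).
  apply: (vintM pp); last by rewrite -(rmorph_nat cstX) -fmorphV; apply: vintC.
  by apply: (vintM pp); [apply/vint_der/vint_form | apply: vint_coordV].
have W0 := kf_W_neq0 y_generic kf t i; have Wm0 := expf_neq0 m W0.
apply: (mulfI (mulf_neq0 m_neq0 Wm0)); rewrite -derX WE derM.
have /(canRL (mulKf pt0)) -> := derX D pt c.
by move: (pt ^+ c) WE => ptc _; field; rewrite q0 pt0 m_neq0.
Qed.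

End Direction.

Variables (da db : derivation X).
Hypothesis dax : forall s, da (x s) = (s == a)%:R.
Hypothesis dbx : forall s, db (x s) = (s == b)%:R.

(** By [log_pole] the polar parts of both logarithmic differentials are multiples of dp / p, whose
    wedge product is zero. A simple pole along p remains, and only if p divides Phi_i or Phi_j,
    where G absorbs it. *)
Lemma jacobian_vint i j r r' G d : polyring r -> polyring r' -> G \is d.-homog ->
  ((0 < mult p (Phi i))%N \/ (0 < mult p (Phi j))%N -> edvd p G) ->
  vint p (ev G / y t ^+ d * (jacobian da db (r * W i) (r' * W j) / (W i * W j))).
Proof.
move=> rA rA' hG pG; have [_ [e hp]] := pp; set pt := ev p / y t ^+ e.
have [ma vma aWi] := log_pole dax i hp; have [mb vmb bWi] := log_pole dbx i hp.
have [na vna aWj] := log_pole dax j hp; have [nb vnb bWj] := log_pole dbx j hp.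
rewrite -/pt in aWi bWi aWj bWj.
set c := mult p (Phi i) in pG aWi bWi; set c' := mult p (Phi j) in pG aWj bWj.
have vr := polyring_vint pp nX rA; have vr' := polyring_vint pp nX rA'.
set g := ev G / y t ^+ d; have vg : vint p g := vint_form hG.
have vm : vint p m%:R^-1 by rewrite -(rmorph_nat cstX) -fmorphV; apply: vintC.
have vpt : vint p pt := vint_form hp.
have W0 h := kf_W_neq0 y_generic kf t h.
pose A (D : derivation X) r mu := D r + r * mu.
have vA (D : derivation X) s0 f mu : (forall s, D (x s) = (s == s0)%:R) -> vint p f -> vint p mu ->
    vint p (A D f mu).
  by move=> Dx vf vmu; apply: (vintD y_generic pp); [apply: (vint_der Dx) | apply: (vintM pp)].
have pole (c0 : nat) (D : derivation X) s0 : (forall s, D (x s) = (s == s0)%:R) -> c0 = c \/ c0 = c' ->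
    vint p (g * c0%:R * (D pt / pt)).
  move=> Dx cE; have [->|c00] := posnP c0.
    by rewrite mulr0 mul0r; apply: vint0.
  have -> : g * c0%:R * (D pt / pt) = cstX c0%:R * (g / pt) * D pt.
    by rewrite rmorph_nat; ring.
  apply: (vintM pp); last exact: (vint_der Dx).
  apply: (vintM pp); first exact: vintC.
  apply: vint_edvd_form => //; apply: pG; case: cE => <-; by [left | right].
have -> : g * (jacobian da db (r * W i) (r' * W j) / (W i * W j)) =
    g * (A da r ma * A db r' nb - A db r mb * A da r' na)
    + r * m%:R^-1 * (g * c%:R * (da pt / pt) * A db r' nb - g * c%:R * (db pt / pt) * A da r' na)
    + r' * m%:R^-1 * (g * c'%:R * (db pt / pt) * A da r ma - g * c'%:R * (da pt / pt) * A db r mb).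
  move: (W i) (W j) (W0 i) (W0 j) aWi bWi aWj bWj => w1 w2 w10 w20 e1 e2 e3 e4.
  move: (da pt / pt) (db pt / pt) e1 e2 e3 e4 => k1 k2 e1 e2 e3 e4.
  rewrite /jacobian !derM e1 e2 e3 e4 /A.
  exact: wedge_poles.
have [va vb] := (vA _ _ _ _ dax vr vma, vA _ _ _ _ dbx vr vmb).
have [va' vb'] := (vA _ _ _ _ dax vr' vna, vA _ _ _ _ dbx vr' vnb).
apply: (vintD y_generic pp); [apply: (vintD y_generic pp)|]; apply: (vintM pp); rewrite //.
- by apply: (vintB y_generic pp); apply: (vintM pp).
- exact: (vintM pp).
- by apply: (vintB y_generic pp); apply: (vintM pp) => //; [apply: (pole c _ _ dax) | apply: (pole c _ _ dbx)]; left.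
- exact: (vintM pp).
by apply: (vintB y_generic pp); apply: (vintM pp) => //; [apply: (pole c' _ _ dbx) | apply: (pole c' _ _ dax)]; right.
Qed.

End AtPrime.

Variables (da db : derivation X).
Hypothesis dax : forall s, da (x s) = (s == a)%:R.
Hypothesis dbx : forall s, db (x s) = (s == b)%:R.
Local Notation Jac := (jacobian da db).

(** With w_i w_j = C w_h and w_h w_h' = C', the Jacobian is C C' / W_h' times a logarithmic one.
    Every prime dividing Phi_i or Phi_j divides C C', so [jacobian_vint] applies. *)
Lemma Jac_mon r r' i j : polyring r -> polyring r' -> Mmod (Jac (r * W i) (r' * W j)).
Proof.
move=> rA rA'; have [h [C [e [hC C0 le wE PE]]]] := kf_prodC y_generic kf i j.
have [h' [C' [e' [hC' C0' le' wE' PE']]]] := kf_invC y_generic kf h.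
have W0 q := kf_W_neq0 y_generic kf t q.
have WWW : W i * W j * W h' = ev (C * C') / y t ^+ (e + e').
  by rewrite /kf_W !mulf_div -!exprD le -addnA le' wE -[ev C * w h * w h']mulrA wE' rmorphM.
have JE : Jac (r * W i) (r' * W j) =
    ev (C * C') / y t ^+ (e + e') * (Jac (r * W i) (r' * W j) / (W i * W j)) / W h'.
  by rewrite -WWW; field; rewrite !W0.
rewrite JE; apply: Mmod_mon; apply: (vint_polyring y_generic) => [|p pp nX]; last first.
  apply: (jacobian_vint pp nX dax dbx) => // [|ij]; first exact: dhomogM.
  apply/(mult_gt0 pp); first by rewrite mulf_neq0.
  have Phi0 q : Phi q != 0 := kf_Phi0 kf q.
  have := congr1 (mult p) PE; have := congr1 (mult p) PE'.
  rewrite [mult p (C ^+ _ * _)]multM ?expf_neq0 // !(multX m pp) // !(multM pp) //.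
  move: ij; have := kf_m kf; clear; nia.
have DW (D : derivation X) s0 q f : (forall s, D (x s) = (s == s0)%:R) -> polyring f ->
    F0 (D (f * W q) / W q).
  move=> Dx fA; rewrite derM (der_W k_char0 y_generic kf Dx).
  rewrite (_ : _ / _ = D f + f * logder y m Phi t s0 q); last by field.
  apply: homfracD; first exact/(der_homfrac y_generic Dx)/(polyring_homfrac y_generic fA).
  apply: homfracM; first exact: (polyring_homfrac y_generic fA).
  exact: (logder_homfrac k_char0 y_generic kf Dx q).
apply: homfracM.
  by apply: (polyring_homfrac y_generic (t := t)); exists (e + e')%N, (C * C'); rewrite dhomogM.
have -> : Jac (r * W i) (r' * W j) / (W i * W j) =
    da (r * W i) / W i * (db (r' * W j) / W j) - db (r * W i) / W i * (da (r' * W j) / W j).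
  by rewrite /jacobian; field; rewrite !W0.
by apply: homfracD; [|apply: homfracN]; apply: homfracM; apply: DW => //; assumption.
Qed.

Lemma Jac_Bring f g : Bring f -> Bring g -> Mmod (Jac f g).
Proof.
move=> [r [rA ->]] [r' [rA' ->]].
have -> : Jac (\sum_i r i * W i) (\sum_i r' i * W i) =
    \sum_i \sum_j Jac (r i * W i) (r' j * W j).
  rewrite /jacobian !der_sum !mulr_suml -sumrB; apply: eq_bigr => i _.
  by rewrite !mulr_sumr -sumrB.
by do 2![apply: (Mmod_sum y_generic) => ? _]; apply: Jac_mon.
Qed.

(** The quotient rule, for functions in a local ring, which are fractions of elements of [Bring]. *)
Lemma Jac_denominators (f g h s1 s2 s3 : K) : Bring f -> Bring g -> Bring h ->
  Bring s1 -> Bring s2 -> Bring s3 -> s1 != 0 -> s2 != 0 -> s3 != 0 ->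
  Mmod (s1 * (s2 * s3) ^+ 2 * (f / s1 * Jac (g / s2) (h / s3))).
Proof.
move=> fB gB hB s1B s2B s3B s10 s20 s30.
have -> : s1 * (s2 * s3) ^+ 2 * (f / s1 * Jac (g / s2) (h / s3)) =
    f * ((s2 * s3 * Jac g h + g * h * Jac s2 s3) - (s2 * h * Jac g s3 + g * s3 * Jac s2 h)).
  by rewrite /jacobian !der_div //; field; rewrite s10 s20 s30.
have BM := BringM y_generic kf; have BMm := Bring_Mmod y_generic kf.
have JB := Jac_Bring; apply: (BMm) => //; apply: (MmodD y_generic).
  by apply: (MmodD y_generic); apply: BMm; auto.
by apply: (MmodN y_generic kf); apply: (MmodD y_generic); apply: BMm; auto.
Qed.

End JacobianPoles.

(** * Canonical sections, character by character *)

Section CanonicalSections.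
Variables (k : closedFieldType) (X : projVariety k).
Local Notation K := (funField X).
Local Notation cstX := (@Defs.cst k X).
Hypothesis k_char0 : [pchar k] =i pred0.
Variables (y : 'I_3 -> K).
Local Notation S := {mpoly k[3]}.
Local Notation ev := (mmap cstX y).
Local Notation F0 := (homfrac cstX y).
Implicit Types (P Q : S) (f g h u v : K) (t : 'I_3) (D E : derivation X)
  (p : 'I_(ambient X).+1 -> k).
Hypothesis y_generic : generic_coord cstX y.
Hypothesis y_finite : finite_morphism y.
Hypothesis y_surj : surjective_map y.
Hypothesis X_normal : normal_variety X.
Hypothesis X_smooth : forall p, point p -> smooth_at p.
Variables (N m : nat) (w : 'I_N -> K) (l : 'I_N -> nat) (Phi : 'I_N -> S).
Hypothesis kf : kummer_forms cstX y m w l Phi.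
Variable Aut : {rmorphism K -> K} -> Prop.
Hypothesis ka : kummer_action y w l Aut.
Hypothesis Omega_neq0 : exists D E, Omega y D E != 0.

Let y0 t : y t != 0. Proof. exact: coord_neq0 y_generic t. Qed.

Section Chart.
Variable t : 'I_3.
Local Notation W := (kf_W y w l t).
Local Notation polyring := (polyring cstX y t).
Local Notation Bring := (Bring cstX y w l t).
Local Notation Mmod := (Mmod cstX y w l t).
Local Notation U := (chart_preim y t).
Local Notation x := (chart_coord y t).
Variables (da db : derivation X).
Hypothesis dax : forall s, da (x s) = (s == ordS t)%:R.
Hypothesis dbx : forall s, db (x s) = (s == ordS (ordS t))%:R.
Local Notation Jac := (jacobian da db).

(* [h dx_a /\ dx_b] is a regular 2-form at [p]. *)
Definition form_regular p h := exists f u v,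
  [/\ regular_at p f, regular_at p u, regular_at p v & h = f * Jac u v].

(** Two terms combine into a single f du /\ dv because [canonical_generator] provides one generator
    for all regular 2-forms at p. *)
Lemma form_regularD p h h' : U p -> form_regular p h -> form_regular p h' ->
  form_regular p (h + h').
Proof.
move=> Up [f [u [v [fr ur vr ->]]]] [f' [u' [v' [fr' ur' vr' ->]]]].
have [u0 [v0 [ga [u0r v0r _ gaE gaJ]]]] :=
  canonical_generator y_generic y_finite X_smooth dax dbx Up.
exists (f * (ga * Jac u v) + f' * (ga * Jac u' v')), u0, v0; split=> //.
  by apply: (regular_atD (chart_point Up)); apply: regular_atM => //; apply: gaJ.
transitivity ((f * Jac u v + f' * Jac u' v') * (ga * Jac u0 v0)); first by rewrite gaE mulr1.
ring.
Qed.

Lemma section_form_regular p g : U p ->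
  pluricanonical_section 1 (fun D E => g * Omega y D E) -> form_regular p (y t ^+ 3 * g).
Proof.
move=> Up /(_ p (chart_point Up))[r [f [u [v [fr ur vr e]]]]].
have -> : y t ^+ 3 * g = \sum_(i < r) f i * Jac (u i ord0) (v i ord0).
  have d1 : delta y t da db = 1.
    by rewrite -(jacobian_coord dax dbx) /delta /jacobian; ring.
  have := e da db; rewrite (Omega_chart y_generic t) d1 mulr1 mulrC => ->.
  by apply: eq_bigr => i _; rewrite big_ord1 /jacobian [da (v i ord0) * _]mulrC.
elim/big_ind: _ => [|h h'|i _].
- by exists 0, 0, 0; rewrite mul0r; split=> //; apply: regular_at0.
- exact: form_regularD.
- by exists (f i), (u i ord0), (v i ord0).
Qed.

Lemma form_regular_den p h : U p -> form_regular p h -> exists g c,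
  [/\ Bring g, value_at p g c, c != 0 & Mmod (g * h)].
Proof.
move=> Up [f [u [v [fr ur vr ->]]]]; have Xp := chart_point Up.
have frac := local_fraction y_generic y_finite X_normal kf ka Up.
have [f1 [s1 [c1 [f1B s1B s1c c10 ->]]]] := frac _ fr.
have [f2 [s2 [c2 [f2B s2B s2c c20 ->]]]] := frac _ ur.
have [f3 [s3 [c3 [f3B s3B s3c c30 ->]]]] := frac _ vr.
exists (s1 * (s2 * s3) ^+ 2), (c1 * (c2 * c3) ^+ 2); split.
- by have BM := BringM y_generic kf; rewrite expr2; do !apply: (BM).
- by apply: value_atM => //; apply: value_atX => //; apply: value_atM.
- by rewrite mulf_neq0 ?expf_neq0 ?mulf_neq0.
apply: (Jac_denominators k_char0 y_generic kf dax dbx) => //.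
- exact: value_at_neq0 s1c.
- exact: value_at_neq0 s2c.
- exact: value_at_neq0 s3c.
Qed.

Lemma form_regular_aut p h (sg : {rmorphism K -> K}) : Aut sg ->
  (forall p', U p' -> form_regular p' h) -> U p -> form_regular p (sg h).
Proof.
move=> sA hT Up; have [p' Up' reg] := moved_point y_generic y_finite X_normal kf ka sA Up.
have [f [u [v [fr ur vr ->]]]] := hT p' Up'.
exists (sg f), (sg u), (sg v); split; try exact: reg.
rewrite rmorphM /jacobian rmorphB !rmorphM.
by rewrite !(der_aut k_char0 y_generic kf dax ka) // !(der_aut k_char0 y_generic kf dbx ka).
Qed.

Lemma form_regular_comp r i : (forall j, F0 (r j)) ->
  (forall p, U p -> form_regular p (\sum_j r j * W j)) ->
  forall p, U p -> form_regular p (r i * W i).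
Proof.
move=> rF hT; apply: (ka_proj ka (T := fun h => forall p, U p -> form_regular p h)) rF hT.
- by move=> p Up; exists 0, 0, 0; rewrite mul0r; split=> //; apply: regular_at0.
- by move=> f g hf hg p Up; apply: form_regularD; auto.
- move=> c f hf p Up; have [f' [u [v [fr ur vr ->]]]] := hf p Up.
  exists (cstX c * f'), u, v; rewrite mulrA; split=> //.
  by apply: regular_atM => //; apply: regular_atC.
- by move=> sg f sA hf p; apply: form_regular_aut.
Qed.

(** Suppose r has a pole along a prime q, and take a point p over a zero of q in the chart. Some g =
    sum s_i W_i with g(p) nonzero brings r / W_j into [Mmod]. By [Mmod_component], s_i r C is in the
    chart ring, where w_h w_i = C w_j for some h. If q divides C it divides Phi_i, so W_i vanishes
    at p; otherwise s_i r is integral at q, so q divides the numerator of s_i. Either way s_i W_i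
    vanishes at p, hence so does g. *)
Lemma form_regular_polyring r j : F0 r ->
  (forall p, U p -> form_regular p (r / W j)) -> polyring r.
Proof.
move=> rF hT; apply: (vint_polyring y_generic rF) => q qp nX; apply: contrapT => nr.
have [z [qz zt]] := zero_off_coord qp nX.
have [p Xp yz] := y_surj (ex_intro _ t zt).
have Up := chart_value Xp yz zt.
have [g [c [[s [sA ->]] gc c0 gM]]] := form_regular_den Up (hT p Up).
have val0 i : value_at p (s i * W i) 0.
  have [h [C [e [hC C0 PE Cr]]]] := Mmod_component y_generic kf sA rF gM i.
  have vCr := polyring_vint qp nX Cr.
  have Wr : regular_at p (W i) := Bring_regular y_generic X_normal kf (Bring_W _ _ _ _ _ i) Up.
  have [d [Q [hQ sE]]] := sA i.
  have sv : value_at p (s i) (Q.@[z] / z t ^+ d) by rewrite sE; apply: polyring_value.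
  have [qC|nC] := pselect (edvd q C).
    suff Wv : value_at p (W i) 0.
      by rewrite -[0 in X in value_at _ _ X](mulr0 (Q.@[z] / z t ^+ d)); apply: value_atM.
    have [c' Wc'] := Wr; suff -> : 0 = c' by [].
    have [A PA] : edvd q (Phi i).
      apply/(mult_gt0 qp); first exact: (kf_Phi0 kf).
      have := congr1 (mult q) PE; rewrite (multM qp) ?(kf_Phi0 kf) // (multM qp) ?expf_neq0 ?(kf_Phi0 kf) //.
      rewrite (multX m qp) //; have := kf_mult kf h qp.
      move/(mult_gt0 qp C0): qC; have := kf_m kf; clear; nia.
    have Wm : value_at p (W i ^+ m) 0.
      rewrite (W_pow kf) -[X in value_at _ _ X](_ : (Phi i).@[z] / z t ^+ (m * l i) = 0).
        by apply: polyring_value => //; apply: (kf_homog kf).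
      by rewrite PA mevalM qz mulr0 mul0r.
    have := value_at_uniq Xp Wm (value_atX m Wc'); move/esym/eqP.
    by rewrite expf_eq0 => /andP[_ /eqP].
  have vsr : vint cstX y q (s i * r).
    have -> : s i * r = s i * r * (ev C / y t ^+ e) * (ev C / y t ^+ e)^-1.
      by rewrite mulfK // mulf_neq0 ?invr_neq0 ?expf_neq0 // (ev_neq0 y_generic hC).
    by apply: (vintM qp) => //; apply: vint_coordV.
  have [A QA] : edvd q Q.
    apply: contrapT => nQ; apply: nr; have vs := vint_coordV y t hQ nQ.
    rewrite -sE in vs; have s0 : s i != 0.
      rewrite sE mulf_neq0 ?invr_neq0 ?expf_neq0 // (ev_neq0 y_generic hQ) //.
      by apply/eqP => Q0; apply: nQ; rewrite Q0; apply: edvd0.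
    by rewrite -(mulKf s0 r); apply: (vintM qp).
  have [c' Wc'] := Wr; rewrite -[X in value_at _ _ X](mul0r c'); apply: value_atM => //.
  by move: sv; rewrite QA mevalM qz mulr0 mul0r.
move/eqP: c0; apply; apply: (value_at_uniq Xp gc).
rewrite -[X in value_at _ _ X](_ : \sum_(i < N) 0 = 0); last by rewrite big1.
by apply: value_at_sum => // i _; apply: val0.
Qed.

End Chart.

(** The exponent 4 is 3 from [Omega_chart] plus 1 from the section y_t g Omega. As i' is the inverse
    class of i, r_i W_i is r_i C / y_t^e divided by W_i', and [form_regular_polyring] applies. *)
Lemma canonical_section_chart t g r i : (forall a, pluricanonical_section 1 (fun D E => y a * g * Omega y D E)) ->
  (forall j, F0 (r j)) -> y t ^+ 4 * g = \sum_j r j * kf_W y w l t j ->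
  forall i' C e, C \is e.-homog -> C != 0 -> w i * w i' = ev C -> (l i + l i')%N = e ->
  polyring cstX y t (r i * (ev C / y t ^+ e)).
Proof.
move=> sec rF gE i' C e hC C0 wE le; have [D [E O0]] := Omega_neq0.
have [da [db [dax dbx]]] := chart_derivations y_generic t O0.
apply: (form_regular_polyring (j := i') dax dbx).
  apply: homfracM => //; apply: (polyring_homfrac y_generic (t := t)); by exists e, C.
move=> p Up; have -> : r i * (ev C / y t ^+ e) / kf_W y w l t i' = r i * kf_W y w l t i.
  have [w1 w2] := (kf_w0 kf i, kf_w0 kf i').
  by rewrite /kf_W -wE -le exprD; field; rewrite w2 !expf_neq0.
move: p Up; apply: (form_regular_comp dax dbx i rF) => p' Up'; rewrite -gE.
by have := section_form_regular dax dbx Up' (sec t); rewrite mulrA -exprSr.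
Qed.

(* The other half of [omega_X = (+)_i O(l_i - 3) w_i^-1]: as [y_a g Omega] is  *)
(* regular for all [a], [omega_X] has a summand [O(l - 3)] with [l >= 4].      *)
Lemma canonical_degree g : g != 0 ->
  (forall a, pluricanonical_section 1 (fun D E => y a * g * Omega y D E)) ->
  exists i, (4 <= l i)%N.
Proof.
move=> g0 sec; pose t0 : 'I_3 := ord0; pose t1 : 'I_3 := ordS ord0.
have [r0 [r0F r0E]] := kf_span kf t0 (y t0 ^+ 4 * g).
have [r1 [r1F r1E]] := kf_span kf t1 (y t1 ^+ 4 * g).
(* Both families expand the same g, so uniqueness of coefficients gives the change of chart. *)
have r1E' i : r1 i = (y t1 / y t0) ^+ (4 + l i) * r0 i.
  apply/eqP; rewrite -subr_eq0; apply/eqP; move: i.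
  apply: (kf_free kf (t := t1) (r := fun i => r1 i - (y t1 / y t0) ^+ (4 + l i) * r0 i)).
    move=> i; apply: homfracD => //; apply/homfracN/homfracM => //.
    by apply: homfracX; apply: homfrac_coord.
  under eq_bigr do rewrite mulrBl.
  rewrite sumrB -r1E; apply/eqP; rewrite subr_eq0; apply/eqP.
  transitivity ((y t1 / y t0) ^+ 4 * (y t0 ^+ 4 * g)).
    by rewrite expr_div_n mulrA divfK // expf_neq0.
  rewrite r0E mulr_sumr; apply: eq_bigr => i _; rewrite exprD !expr_div_n.
  move: (y t1 ^+ l i) (y t0 ^+ l i) (expf_neq0 (l i) (y0 t1)) (expf_neq0 (l i) (y0 t0)).
  by move=> Y1 Y0 h1 h0; field; rewrite h1 h0 y0.
have [i ri] : exists i, r0 i != 0.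
  apply: contrapT => h; have /eqP := r0E; rewrite big1 => [|i _].
    by rewrite mulf_eq0 (negPf g0) expf_eq0 (negPf (y0 t0)).
  have [->|ri] := eqVneq (r0 i) 0; first by rewrite mul0r.
  by case: h; exists i.
have [i' [C [e [hC C0 le wE PE]]]] := kf_invC y_generic kf i.
exists i'; rewrite leqNgt; apply/negP => li'.
have [b [N0 [hN0 e0]]] := canonical_section_chart sec r0F r0E hC C0 wE le.
have [c [N1 [hN1 e1]]] := canonical_section_chart sec r1F r1E hC C0 wE le.
have eC := ev_neq0 y_generic hC C0.
(* If l i' were below 4, the two local descriptions would glue to a section of O(-a) with a > 0,
   which must be zero. *)
pose a := (4 - l i')%N; have a0 : (0 < a)%N by rewrite subn_gt0.
have N10 : N1 = 0.
  apply: (@coprime_coords _ _ t0 t1 N1 N0 c (b + a) (c + a)) => //.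
    by rewrite -[X in (X < _)%N]addn0 ltn_add2l.
  apply: (@ev_inj _ _ cstX _ y y_generic (c + (b + a))).
  - by apply: dhomogM => //; apply: dhomogXin.
  - by rewrite addnCA; apply: dhomogM => //; apply: dhomogXin.
  have yn t j : y t ^+ j != 0 by rewrite expf_neq0.
  have E0 : ev N0 = r0 i * ev C * y t0 ^+ b / y t0 ^+ e.
    transitivity (r0 i * (ev C / y t0 ^+ e) * y t0 ^+ b); [by rewrite e0 divfK | ring].
  have E1 : ev N1 = r1 i * ev C * y t1 ^+ c / y t1 ^+ e.
    transitivity (r1 i * (ev C / y t1 ^+ e) * y t1 ^+ c); [by rewrite e1 divfK | ring].
  rewrite !rmorphM !rmorphXn /= !evX E0 E1 r1E'.
  have ea : (4 + l i = a + e)%N by rewrite -le /a; lia.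
  rewrite ea expr_div_n !exprD.
  by move: (yn t0 e) (yn t1 e) (yn t0 a); move: (y t0 ^+ e) (y t1 ^+ e) (y t0 ^+ a) => Y1 Y2 Y3 ? ? ?; field; apply/and3P.
have yy : (y t1 / y t0) ^+ (4 + l i) != 0 by rewrite expf_neq0 ?mulf_neq0 ?invr_neq0 ?y0.
move/eqP: e1; apply/negP; rewrite N10 rmorph0 mul0r r1E'.
apply: mulf_neq0; first exact: (mulf_neq0 yy ri).
by apply: (mulf_neq0 eC); rewrite invr_neq0 ?expf_neq0 ?y0.
Qed.

Lemma canonical_form_multiple (s : pluriform X) : pluricanonical_section 1 s ->
  exists g, forall D E, s D E = g * Omega y D E.
Proof.
have [D0 [E0 O0]] := Omega_neq0; pose t : 'I_3 := ord0.
have [da [db [dax dbx]]] := chart_derivations y_generic t O0.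
have [p Xp _] : exists2 p, point p & map_value y p (fun=> 1).
  by apply: y_surj; exists ord0; apply: oner_neq0.
move=> /(_ p Xp)[r [f [u [v [_ _ _ e]]]]].
exists ((\sum_(i < r) f i * jacobian da db (u i ord0) (v i ord0)) / y t ^+ 3) => D E.
rewrite e (Omega_chart y_generic t) mulrA divfK ?expf_neq0 // mulr_suml; apply: eq_bigr => i _.
by rewrite big_ord1 (wedge k_char0 y_generic kf dax dbx) mulrA.
Qed.

End CanonicalSections.

(** * Normalised Kummer basis of an abelian cover *)

Section KummerNormalisation.
Variables (k : closedFieldType) (X : projVariety k).
Local Notation K := (funField X).
Local Notation cstX := (@Defs.cst k X).
Hypothesis k_char0 : [pchar k] =i pred0.
Variables (n : nat) (y : 'I_n.+1 -> K).
Local Notation F0 := (homfrac cstX y).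
Hypothesis y_generic : generic_coord cstX y.
Variables (gT : finGroupType) (A : {group gT}) (sg : gT -> {rmorphism K -> K}).
Variables (N : nat) (v : 'I_N -> K) (lam : 'I_N -> gT -> k).
Hypothesis v_neq0 : forall i, v i != 0.
Hypothesis sg_v : forall g i, g \in A -> sg g (v i) = cstX (lam i g) * v i.
Hypothesis v_span : forall f, exists r, (forall i, F0 (r i)) /\ f = \sum_i r i * v i.
Hypothesis v_free : forall r, (forall i, F0 (r i)) -> \sum_i r i * v i = 0 -> forall i, r i = 0.
Hypothesis sg_fix : forall g f, F0 f -> sg g f = f.
Hypothesis A_gt0 : (0 < #|A|)%N.
Hypothesis v_pow : forall i, F0 (v i ^+ #|A|).
Hypothesis averaging : forall r i, (forall i, F0 (r i)) ->
  \sum_(g in A) cstX (lam i g)^-1 * sg g (\sum_i r i * v i) = #|A|%:R * (r i * v i).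

Let A_neq0 : #|A|%:R != 0 :> k.
Proof. by move/pcharf0P: k_char0 => ->; rewrite -lt0n. Qed.

(** Averaging f against the character of v_h, for a nonzero component h, yields both a constant
    multiple of f and |A| times that component. *)
Lemma eigenvector_ratio f : f != 0 ->
  (forall g, g \in A -> exists c, sg g f = cstX c * f) -> exists h, F0 (f / v h).
Proof.
move=> f0 eig; have /choice[c cE] : forall g, exists c, g \in A -> sg g f = cstX c * f.
  by move=> g; have [/eig[c ?]|_] := boolP (g \in A); [exists c | exists 0].
have [r [rF fE]] := v_span f.
have [h rh] : exists h, r h != 0.
  apply: contrapT => h; case/eqP: f0; rewrite fE big1 // => i _.
  by have [->|ri] := eqVneq (r i) 0; [rewrite mul0r | case: h; exists i].
exists h; have := averaging h rF; rewrite -fE.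
have -> : \sum_(g in A) cstX (lam h g)^-1 * sg g f = cstX (\sum_(g in A) (lam h g)^-1 * c g) * f.
  rewrite rmorph_sum mulr_suml; apply: eq_bigr => g gA.
  by rewrite cE // rmorphM mulrA.
set s := \sum_(g in A) _ => e.
have s0 : cstX s != 0.
  have : #|A|%:R * (r h * v h) != 0 by rewrite !mulf_neq0 // -(rmorph_nat cstX) fmorph_eq0.
  by rewrite -e mulf_eq0 => /norP[].
have -> : f / v h = cstX (s^-1 * #|A|%:R) * r h.
  rewrite rmorphM fmorphV rmorph_nat; apply: (mulIf (v_neq0 h)); rewrite divfK //.
  by apply: (mulfI s0); rewrite e !mulrA mulfV // mul1r.
by apply: homfracM => //; apply: homfracC.
Qed.

Lemma kummer_normal_form : exists (m : nat) (w : 'I_N -> K) (l : 'I_N -> nat)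
    (Phi : 'I_N -> {mpoly k[n.+1]}) (Aut : {rmorphism K -> K} -> Prop),
  kummer_forms cstX y m.+2 w l Phi /\ kummer_action y w l Aut.
Proof.
(* Twice the group order, so that the exponent is at least 2 even for a trivial group; the v_i
   raised to it still lie in F0. *)
have [m mE] : exists m, m.+2 = (2 * #|A|)%N.
  by exists (2 * #|A|).-2; move: A_gt0; clear; lia.
have /choice[lPw lPwE] : forall i, exists lPw : nat * {mpoly k[n.+1]} * K,
    power_free_form cstX y m.+2 lPw.1.1 lPw.1.2 lPw.2 /\
    forall t, F0 (lPw.2 / y t ^+ lPw.1.1 / v i).
  move=> i; have [||l [P [w [h1 h2]]]] := power_free_root y_generic (m := m.+2) _ (v_neq0 i).
  - by [].
  - by rewrite mE mulnC exprM; apply: homfracX.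
  by exists (l, P, w).
pose l i := (lPw i).1.1; pose w i := (lPw i).2; pose W t i := kf_W y w l t i.
have WF t i : F0 (W t i / v i) := (lPwE i).2 t.
have W0 t i : W t i != 0.
  have [[_ _ w0 _ _] _] := lPwE i.
  by rewrite mulf_neq0 ?invr_neq0 ?expf_neq0 // (coord_neq0 y_generic).
have FW t i : F0 (v i / W t i) by rewrite -invf_div; apply: homfracV.
have eigW g t i : g \in A -> sg g (W t i) = cstX (lam i g) * W t i.
  move=> gA; rewrite -[W t i](divfK (v_neq0 i)) rmorphM sg_fix // sg_v //.
  by rewrite mulrCA.
have toW t f h : F0 (f / v h) -> F0 (f / W t h).
  by move=> /homfracM/(_ (FW t h)); rewrite mulrA divfK.
have kf : kummer_forms cstX y m.+2 w l (fun i => (lPw i).1.2).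
  split=> //; first by move=> i; apply: (lPwE i).1.
  - move=> t f; have [r [rF fE]] := v_span f; exists (fun i => r i * (v i / W t i)).
    split=> [i|]; first by apply: homfracM.
    by rewrite fE; apply: eq_bigr => i _; rewrite -/(W t i) -mulrA divfK.
  - move=> t r rF e i.
    have : r i * (W t i / v i) = 0.
      apply: (v_free (r := fun i => r i * (W t i / v i))) => [j|]; first exact: homfracM.
      by rewrite -[RHS]e; apply: eq_bigr => j _; rewrite -mulrA divfK.
    have Wv : W t i / v i != 0 := mulf_neq0 (W0 t i) (invr_neq0 (v_neq0 i)).
    by move/eqP; rewrite mulf_eq0 (negPf Wv) orbF => /eqP.
  - move=> t i j; have [||h hF] := @eigenvector_ratio (W t i * W t j).
    + by rewrite mulf_neq0.
    + move=> g gA; exists (lam i g * lam j g); rewrite [LHS]rmorphM !eigW //.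
      by rewrite [cstX (_ * _)]rmorphM mulrACA.
    by exists h; apply: toW.
  - move=> t i; have [||h hF] := @eigenvector_ratio (W t i)^-1.
    + by rewrite invr_neq0.
    + by move=> g gA; exists (lam i g)^-1; rewrite fmorphV eigW // invfM fmorphV.
    by exists h; have := homfracV (toW t _ _ hF); rewrite invfM !invrK.
exists m, w, l, (fun i => (lPw i).1.2), (fun s => exists2 g, g \in A & s = sg g); split=> //.
split.
- by move=> _ [g gA ->] f; apply: sg_fix.
- by move=> _ [g gA ->] i t; exists (lam i g); apply: eigW.
move=> T T0 TD TC TA t r i rF TS.
have := averaging i (r := fun i => r i * (W t i / v i)) _.
have -> : \sum_i r i * (W t i / v i) * v i = \sum_j r j * W t j.
  by apply: eq_bigr => j _; rewrite -mulrA divfK.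
move=> /(_ (fun j => homfracM (rF j) (WF t j))); rewrite -mulrA divfK // => e.
have -> : r i * kf_W y w l t i = cstX (#|A|%:R^-1) *
    \sum_(g in A) cstX (lam i g)^-1 * sg g (\sum_j r j * W t j).
  rewrite e fmorphV rmorph_nat mulKf // -(rmorph_nat cstX) fmorph_eq0 //.
apply: (TC); elim/big_ind: _ => // g gA.
by apply: (TC); apply: TA TS; exists g.
Qed.

End KummerNormalisation.

(** * The target of the cover is the plane *)

Section Dimension.
Variables (k : closedFieldType) (X : projVariety k).
Local Notation K := (funField X).
Local Notation cstX := (@Defs.cst k X).
Hypothesis k_char0 : [pchar k] =i pred0.
Variables (n : nat) (y : 'I_n.+1 -> K).
Local Notation F0 := (homfrac cstX y).
Implicit Types (D E : derivation X) (f g u v : K).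

Lemma wedge_proportional D E f0 u v : D f0 != 0 -> (forall f, E f0 * D f = D f0 * E f) ->
  D u * E v - D v * E u = 0.
Proof.
move=> D0 h; have EE f : E f = E f0 / D f0 * D f by rewrite mulrAC h mulrAC mulfV ?mul1r.
by rewrite (EE u) (EE v); ring.
Qed.

Lemma der_swap D E f0 : exists D', forall f, D' f = E f0 * D f - D f0 * E f.
Proof.
by have [D' e] := der_comb D E (E f0) (- D f0); exists D' => f; rewrite e mulNr.
Qed.

Lemma section_neq0_wedge (s : pluriform X) p D E : pluriform_regular_at 1 p s -> s D E != 0 ->
  exists u v, D u * E v - D v * E u != 0.
Proof.
move=> [r [f [u [v [_ _ _ ->]]]]] s0; apply: contrapT => h; case/eqP: s0.
rewrite big1 // => i _; rewrite big_ord1; have [->|e] := eqVneq (D (u i ord0) * E (v i ord0) -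
  D (v i ord0) * E (u i ord0)) 0; first by rewrite mulr0.
by case: h; exists (u i ord0), (v i ord0).
Qed.

Hypothesis y_generic : generic_coord cstX y.

Lemma der_homfrac_eq0 D : (forall i, D (y i / y ord0) = 0) -> forall f, F0 f -> D f = 0.
Proof.
move=> Dx _ [d [P [Q [hP hQ Q0 ->]]]]; have y0 := coord_neq0 y_generic ord0.
have yd : y ord0 ^+ d != 0 by rewrite expf_neq0.
have xE R : R \is d.-homog -> mmap cstX (fun i => (y ord0)^-1 * y i) R = mmap cstX y R / y ord0 ^+ d.
  by move=> hR; rewrite (mmap_scale cstX y _ hR) exprVn mulrC.
have D0 R : D (mmap cstX (fun i => (y ord0)^-1 * y i) R) = 0.
  by rewrite der_mmap big1 // => i _; rewrite [_ * y i]mulrC Dx mulr0.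
have -> : mmap cstX y P / mmap cstX y Q = mmap cstX (fun i => (y ord0)^-1 * y i) P
    / mmap cstX (fun i => (y ord0)^-1 * y i) Q.
  by rewrite !xE // invf_div mulrA divfK.
by rewrite der_div ?D0 ?mul0r ?mulr0 ?subrr ?mul0r // xE // mulf_neq0 ?invr_neq0.
Qed.

Lemma der_radical_eq0 D (N e : nat) (v : 'I_N -> K) : (0 < e)%N -> (forall i, F0 (v i ^+ e)) ->
  (forall f, exists r, (forall i, F0 (r i)) /\ f = \sum_i r i * v i) ->
  (forall f, F0 f -> D f = 0) -> forall f, D f = 0.
Proof.
move=> e0 ve span D0 f; have e0K : e%:R != 0 :> K.
  by rewrite -(rmorph_nat cstX) fmorph_eq0; move/pcharf0P: k_char0 => ->; rewrite -lt0n.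
have [r [rF ->]] := span f; rewrite der_sum big1 // => i _.
have [->|v0] := eqVneq (v i) 0; first by rewrite mulr0 der0.
have := derX D (v i) e; rewrite (D0 _ (ve i)) mulr0 derM (D0 _ (rF i)) mul0r add0r.
by move/esym/eqP; rewrite !mulf_eq0 (negPf e0K) expf_eq0 (negPf v0) andbF => /eqP->; rewrite mulr0.
Qed.

Hypothesis y_surj : surjective_map y.

(** By surjectivity, a relation between the affine coordinates holds at every point of affine
    space. *)
Lemma coordinates_indep : alg_indep (fun i : 'I_n => y (lift ord0 i) / y ord0).
Proof.
move=> F F_0; apply: meval_eq0 => z; pose z' i := if unlift ord0 i is Some j then z j else 1.
have z'0 : z' ord0 = 1 by rewrite /z' unlift_none.
have [|p Xp [_ [a a0 az]]] := y_surj (z := z').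
  by exists ord0; rewrite z'0 oner_neq0.
apply: (value_at_uniq Xp (f := 0)); last exact: value_at0.
rewrite -F_0; apply: value_at_mmap => // i.
have -> : z i = z' (lift ord0 i) / z' ord0 by rewrite z'0 divr1 /z' liftK.
have -> : y (lift ord0 i) / y ord0 = a * y (lift ord0 i) / (a * y ord0).
  by rewrite -mulf_div divff ?mul1r.
by apply: value_at_div => //; rewrite z'0 oner_neq0.
Qed.

Lemma alg_indep_widen (N N' : nat) (u : 'I_N' -> K) (h : (N <= N')%N) :
  alg_indep u -> alg_indep (fun i : 'I_N => u (widen_ord h i)).
Proof.
move=> ui F F_0; pose G : {mpoly k[N']} := mmap (@mpolyC N' k) (fun i : 'I_N => 'X_(widen_ord h i)) F.
have GE (S : comNzRingType) (f : {rmorphism k -> S}) (z : 'I_N' -> S) :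
    mmap f z G = mmap f (fun i => z (widen_ord h i)) F.
  apply: (@mpoly_rmorph_ext _ _ _ (mmap f z \o mmap (@mpolyC N' k) (fun i : 'I_N => 'X_(widen_ord h i)))
    (mmap f (fun i => z (widen_ord h i)))) => [c|i] /=; first by rewrite !mmapC.
  by rewrite !(mmapX, mmap1U).
have G0 : G = 0 by apply: ui; rewrite GE.
apply: meval_eq0 => z; pose z' i := if insub (i : nat) : option 'I_N is Some j then z j else 0.
have := GE _ idfun z'; rewrite G0 rmorph0 => /esym; rewrite -[mmap idfun _ F]/(F.@[_]) => <-.
by apply: meval_eq => i; rewrite /z' /= valK.
Qed.

(** If n < 2, a derivation killing the single function y_n / y_0 is zero, K being generated by
    radicals over F0. So any two derivations are proportional and all 2-forms vanish, against the
    existence of a nonzero canonical section. If n > 2, the affine coordinates contain three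
    algebraically independent functions on a surface. *)
Lemma cover_dimension : smooth_surface X -> canonical_map y -> abelian_extension y -> n = 2%N.
Proof.
move=> [[_ td] _] [s [sec indep _] [eta sE]] [F [L [j [[j_bij F0E] gal ab]]]].
have [D [E sDE]] : exists D E, s ord0 D E != 0.
  apply: contrapT => h; have s0 D E : s ord0 D E = 0.
    by apply: contrapT => /eqP s0; apply: h; exists D, E.
  have /eqP : ((ord0 == ord0 :> 'I_n.+1)%:R : k) = 0; last by rewrite eqxx oner_eq0.
  apply: (indep (fun i => (i == ord0)%:R)) => D E.
  rewrite (bigD1 ord0) //= s0 mulr0 add0r big1 // => i /negPf->.
  by rewrite rmorph0 mul0r.
have [n2|n2|//] := ltngtP n 2.
  have [p Xp _] : exists2 p, point p & map_value y p (fun=> 1).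
    by apply: y_surj; exists ord0; apply: oner_neq0.
  have [u [v uv]] := section_neq0_wedge (sec ord0 p Xp) sDE.
  have [gT [A [sg [N [v' [lam [[_ _ _ span _] [_ _ A0 vp _]]]]]]]] :=
    kummer_basis k_char0 j_bij F0E (homfracC cstX y) gal ab.
  have killed D' : D' (y ord_max / y ord0) = 0 -> forall f, D' f = 0.
    move=> Dx; apply: (der_radical_eq0 A0 vp span); apply: der_homfrac_eq0 => i.
    have [->|->] : i = ord0 \/ i = ord_max.
      by case: i n2 => [[|[|i]]] hi; rewrite !ltnS => n2; [left | right | lia]; apply: val_inj => /=; lia.
      by rewrite divff ?der1 ?(coord_neq0 y_generic).
    by [].
  have [D' D'E] := der_swap D E (y ord_max / y ord0).
  have D'0 := killed D' _; case/eqP: uv.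
  have [Dx|Dx] := eqVneq (D (y ord_max / y ord0)) 0.
    by rewrite !(killed D Dx) !mul0r subrr.
  apply: (wedge_proportional _ _ Dx) => f; apply/eqP; rewrite -subr_eq0 -D'E D'0 //.
  by rewrite D'E mulrC subrr.
have ind := alg_indep_widen (h := n2) coordinates_indep.
by case: (td _ (fun=> I) ind).
Qed.

End Dimension.

(** * The degrees l_i of a canonical cover *)

Section CanonicalCover.
Variables (k : closedFieldType) (X : projVariety k).
Local Notation K := (funField X).
Local Notation cstX := (@Defs.cst k X).
Hypothesis k_char0 : [pchar k] =i pred0.

Lemma section_ext (m : nat) (s s' : pluriform X) : (forall D E, s D E = s' D E) ->
  pluricanonical_section m s -> pluricanonical_section m s'.
Proof.
move=> ss' h p /h[r [f [u [v [fr ur vr e]]]]]; exists r, f, u, v; split=> // D E.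
by rewrite -ss'.
Qed.

Lemma basis_section_neq0 n (s : 'I_n -> pluriform X) i :
  pluricanonical_basis 1 s -> exists D E, s i D E != 0.
Proof.
move=> [_ indep _]; apply: contrapT => h.
have s0 D E : s i D E = 0 by apply: contrapT => /eqP s0; apply: h; exists D, E.
have /eqP : ((i == i)%:R : k) = 0; last by rewrite eqxx oner_eq0.
apply: (indep (fun j => (j == i)%:R)) => D E.
by rewrite (bigD1 i) //= s0 mulr0 add0r big1 // => j /negPf->; rewrite rmorph0 mul0r.
Qed.

Variable y : 'I_3 -> K.
Local Notation S := {mpoly k[3]}.
Local Notation ev := (mmap cstX y).
Local Notation F0 := (homfrac cstX y).
Hypothesis y_generic : generic_coord cstX y.
Hypothesis y_finite : finite_morphism y.
Hypothesis y_surj : surjective_map y.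
Hypothesis X_normal : normal_variety X.
Hypothesis X_smooth : forall p : 'I_(ambient X).+1 -> k, point p -> smooth_at p.
Variables (N m : nat) (w : 'I_N -> K) (l : 'I_N -> nat) (Phi : 'I_N -> S).
Hypothesis kf : kummer_forms cstX y m w l Phi.
Variable Aut : {rmorphism K -> K} -> Prop.
Hypothesis ka : kummer_action y w l Aut.

(** If Omega vanished on (D, E), these would be proportional on the affine coordinates, hence
    everywhere by [der_eq0], and every 2-form would vanish on them. *)
Lemma Omega_neq0_of_section (s : pluriform X) D E :
  pluricanonical_section 1 s -> s D E != 0 -> Omega y D E != 0.
Proof.
move=> sec s0; have [p Xp _] : exists2 p, @point k X p & map_value y p (fun=> 1).
  by apply: y_surj; exists ord0; apply: oner_neq0.
have [u [v uv]] := section_neq0_wedge (sec p Xp) s0.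
pose t : 'I_3 := ord0; apply: contraNneq uv; rewrite (Omega_chart y_generic t).
move=> /eqP; rewrite mulf_eq0 expf_eq0 (negPf (coord_neq0 y_generic t)) andbF /=.
set xa := chart_coord y t (ordS t); set xb := chart_coord y t (ordS (ordS t)) => /eqP de.
have zero := der_eq0 k_char0 y_generic kf (t := t).
have [Da Dae] := der_swap D E xa; have [Db Dbe] := der_swap D E xb.
have {}de : D xa * E xb - D xb * E xa = 0 by [].
have Da0 : forall f, Da f = 0.
  by apply: zero; rewrite Dae -/xa -/xb; [ring | rewrite -[RHS]oppr0 -de; ring].
have Db0 : forall f, Db f = 0.
  by apply: zero; rewrite Dbe -/xa -/xb; [rewrite -[RHS]de; ring | ring].
have swap (D' : derivation X) x : (forall f, D' f = E x * D f - D x * E f) ->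
    (forall f, D' f = 0) -> forall f, E x * D f = D x * E f.
  by move=> D'e D'0 f; apply/eqP; rewrite -subr_eq0 -D'e D'0.
have [Dxa|Dxa] := eqVneq (D xa) 0; last first.
  by apply/eqP/(wedge_proportional _ _ Dxa)/(swap Da).
have [Dxb|Dxb] := eqVneq (D xb) 0; last first.
  by apply/eqP/(wedge_proportional _ _ Dxb)/(swap Db).
by rewrite !(zero D Dxa Dxb) !mul0r subrr.
Qed.

Lemma linear_form_eq0 (u : 'rV[k]_3) e :
  \sum_a u 0 a *: ('X_a * 'X_ord0 ^+ e : S) = 0 -> u = 0.
Proof.
have -> : \sum_a u 0 a *: ('X_a * 'X_ord0 ^+ e : S) = (\sum_a u 0 a *: 'X_a) * 'X_ord0 ^+ e.
  by rewrite mulr_suml; apply: eq_bigr => a _; rewrite scalerAl.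
move/eqP; rewrite mulf_eq0 expf_eq0 (negPf (Xi_neq0 _ _)) andbF orbF => /eqP e0.
apply/rowP => a; have := congr1 (meval (fun b => (b == a)%:R)) e0.
rewrite rmorph0 rmorph_sum /= (bigD1 a) //= mevalZ mevalXU eqxx mulr1 mxE.
by rewrite big1 ?addr0 // => b /negPf ba; rewrite mevalZ mevalXU ba mulr0.
Qed.

(* [p_g = 3] is used up by the three sections [Y_a Y_0^(l-4) / w_i0]. *)
Lemma canonical_degrees : canonical_map y ->
  exists i0, (4 <= l i0)%N /\ forall i, i != i0 -> (l i <= 2)%N.
Proof.
move=> [s sb [eta sE]]; have [sec _ gen] := sb.
have [D [E s0]] := basis_section_neq0 ord0 sb.
have O0 := Omega_neq0_of_section (sec ord0) s0.
have On : exists D E, Omega y D E != 0 by exists D, E.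
have [g0 g0E] := canonical_form_multiple k_char0 y_generic y_surj kf On (sec ord0).
pose g := g0 / y ord0; have y0 := coord_neq0 y_generic ord0.
have sgE a D' E' : s a D' E' = y a * g * Omega y D' E'.
  rewrite sE /g; apply: (mulfI y0); rewrite mulrCA -sE g0E.
  by field.
have gn0 : g != 0.
  by apply: contraNneq s0 => gz; rewrite sgE gz mulr0 mul0r.
have [i0 l0] := canonical_degree k_char0 y_generic y_finite y_surj X_normal X_smooth kf ka On gn0
  (fun a => section_ext (sgE a) (sec a)).
exists i0; split=> // i ii0; rewrite leqNgt; apply/negP => li.
have lower j P d : P \is d.-homog -> (d + 3 = l j)%N ->
    exists c : 'rV[k]_3, ev P / w j = \sum_a cstX (c 0 a) * (y a * g).
  move=> hP dl; have [c cE] := gen _ (canonical_section_of_form k_char0 y_generic y_finite X_normal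
    X_smooth kf ka On hP dl).
  exists (\row_a c a); apply: (mulIf O0); rewrite cE mulr_suml.
  by apply: eq_bigr => a _; rewrite mxE sgE mulrA.
have hX a : ('X_a * 'X_ord0 ^+ (l i0 - 4) : S) \is (l i0 - 3).-homog.
  rewrite (_ : (l i0 - 3 = 1 + (l i0 - 4))%N); last by move: l0; clear; lia.
  by apply: dhomogM; [apply: dhomogXi | apply: dhomogXin].
have /choice[M ME] : forall a, exists c : 'rV[k]_3,
    ev ('X_a * 'X_ord0 ^+ (l i0 - 4)) / w i0 = \sum_b cstX (c 0 b) * (y b * g).
  by move=> a; apply: lower (hX a) _; rewrite subnK // ltnW.
have [c cE] := lower i ('X_ord0 ^+ (l i - 3)) (l i - 3)%N (dhomogXin _ _ _) (subnK li).
pose B : 'M_3 := \matrix_(a, b) M a 0 b.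
pose Q (u : 'rV[k]_3) : S := \sum_a u 0 a *: ('X_a * 'X_ord0 ^+ (l i0 - 4)).
have QE u : ev (Q u) / w i0 = \sum_b cstX ((u *m B) 0 b) * (y b * g).
  rewrite rmorph_sum mulr_suml.
  under eq_bigr do rewrite -mul_mpolyC rmorphM /= evC -mulrA ME mulr_sumr.
  rewrite exchange_big; apply: eq_bigr => b _ /=; rewrite mxE rmorph_sum mulr_suml.
  by apply: eq_bigr => a _; rewrite !mxE rmorphM !mulrA.
have hQ u : Q u \is (l i0 - 3).-homog by apply: rpred_sum => a _; apply: dhomogZ.
have w0 j := kf_w0 kf j.
(* The map u -> Q u is injective, so the three forms X_a X_0^(l i0 - 4) / w_i0 are again a basis of
   the canonical sections. *)
have Bu : B \in unitmx.
  rewrite -row_free_unit -kermx_eq0; apply: contrapT => /negP/rowV0Pn[u /sub_kermxP uB].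
  apply/negP; rewrite negbK; apply/eqP/(@linear_form_eq0 _ (l i0 - 4)); rewrite -/(Q u).
  apply: (y_generic (hQ u)); apply: (mulIf (invr_neq0 (w0 i0))); rewrite mul0r QE uB.
  by rewrite big1 // => b _; rewrite mxE rmorph0 mul0r.
(* A section from another summand i would thus be a combination of those from i0, making W_i an
   F0-multiple of W_i0. *)
have {}cE : ev ('X_ord0 ^+ (l i - 3)) / w i = ev (Q (c *m invmx B)) / w i0.
  by rewrite cE QE mulmxKV.
have X0 : ev ('X_ord0 ^+ (l i - 3)) != 0 by rewrite rmorphXn /= evX expf_neq0.
case/eqP: ii0; apply/esym; apply: (kf_ratio kf (t := ord0)
  (f := (ev (Q (c *m invmx B)) / y ord0 ^+ (l i0 - 3)) / (ev ('X_ord0 ^+ (l i - 3)) / y ord0 ^+ (l i - 3)))).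
  by apply: homfrac_div; apply: (polyring_homfrac y_generic (t := ord0));
    [exists (l i0 - 3)%N, (Q (c *m invmx B)) | exists (l i - 3)%N, ('X_ord0 ^+ (l i - 3)); rewrite dhomogXin].
have -> : ev (Q (c *m invmx B)) = ev ('X_ord0 ^+ (l i - 3)) * w i0 / w i.
  by rewrite mulrAC cE divfK.
rewrite /kf_W -[in X in _ = _ * (w i / X)](subnK li) -[in LHS](subnK (ltnW l0)) !exprD.
have yn j : y ord0 ^+ j != 0 by rewrite expf_neq0.
move: (yn (l i - 3)%N) (yn (l i0 - 3)%N) (yn 3) (w0 i) (w0 i0) X0.
move: (y ord0 ^+ (l i - 3)) (y ord0 ^+ (l i0 - 3)) (y ord0 ^+ 3) (ev _) (w i) (w i0).
by move=> Y1 Y2 Y3 Z w1 w2 h1 h2 h3 h4 h5 h6; field; rewrite h1 h2 h3 h4 h6.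
Qed.

End CanonicalCover.

(** * The degree of a canonical abelian cover *)

Theorem canonical_abelian_degree (k : closedFieldType) (X : projVariety k) (y : 'I_3 -> funField X) d :
  [pchar k] =i pred0 -> smooth_surface X -> canonical_map y -> map_degree y d ->
  abelian_cover y -> d \in [:: 2; 3; 4; 6; 8; 9; 16]%N.
Proof.
move=> k0 [_ smooth] can [F' [L' [j' [[j'_bij F0E'] <-]]]].
move=> [fin surj normal [F [L [j [[j_bij F0E] gal ab]]]]].
have gen := surjective_generic surj.
have [gT [A [sg [n [v [lam [[nE v0 sgv span free] [fx _ A0 vp avg]]]]]]]] :=
  kummer_basis k0 j_bij F0E (homfracC (@Defs.cst k X) y) gal ab.
(* The degree is read off one model of the extension and the eigenbasis off another, so the two
   dimensions have to be compared. *)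
have -> : \dim {:L'} = n.+1.
  rewrite nE; apply/eqP; rewrite eqn_leq.
  apply/andP; split.
    by apply: (model_dim_le j'_bij j_bij) => f; rewrite -F0E -F0E'.
  by apply: (model_dim_le j_bij j'_bij) => f; rewrite -F0E -F0E'.
have [m [w [l [Phi [Aut [kf ka]]]]]] := kummer_normal_form k0 gen v0 sgv span free fx A0 vp avg.
have [i0 [l0 l2]] := canonical_degrees k0 gen fin surj normal smooth kf ka can.
exact: (kummer_degree k0 gen kf l0 l2).
Qed.

Theorem theorem1p2 (R : realType) (X : projVariety R[i]) (n : nat)
    (phi : 'I_n.+1 -> funField X) (d : nat) :
  minimal_surface_of_general_type X ->
  canonical_map phi ->
  map_degree phi d ->
  (n = 2%N -> abelian_cover phi -> d \in [:: 2; 3; 4; 6; 8; 9; 16]%N) /\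
  (d = 36%N -> ~ abelian_cover phi).
Proof.
move=> [[smooth _] _] can deg.
have k0 : [pchar R[i]] =i pred0 by apply: pchar_num.
have main : n = 2%N -> abelian_cover phi -> d \in [:: 2; 3; 4; 6; 8; 9; 16]%N.
  by move=> n2; subst n; apply: canonical_abelian_degree.
(* The second claim leaves n open, so the dimension of the target is determined first. *)
split=> // d36 cover; have [_ surj _ ab] := cover.
have n2 := cover_dimension k0 (surjective_generic surj) surj smooth can ab.
by have := main n2 cover; rewrite d36.
Qed.
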